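(* Let $k$ be an algebraically closed field of characteristic $p>0$. Let $\tau\colon \mathbb{Z}\to\mathbb{Z}_{\geq 0}$ be a function with finite support $i_1<\cdots<i_r$. Let $n_j:=\tau(i_j)$, write $J=(n_r,\ldots,n_1)$, and let $n:=n_1+\cdots+n_r$. Then there is a bijection $$\{\text{isomorphism classes of } F\text{-zips of type } \tau \text{ over } k\}\;\longleftrightarrow\;(S_{n_r}\times\cdots\times S_{n_1})\backslash S_n=:{}^JW .$$ More precisely, to each $u\in{}^JW$ one associates a ''standard $F$-zip'' $\underline{M}^u_\tau$ over $\mathbb{F}_p$ (described in the context) such that any $F$-zip $\underline{M}$ of type $\tau$ over $k$ is isomorphic to $\underline{M}^u_\tau\otimes_{\mathbb{F}_p}k$ for some uniquely determined $u\in{}^JW$.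
   Context: For a scheme $S$ of characteristic $p$ and an $\mathcal{O}_S$-module $M$, $M^{(p)}$ denotes the pull-back of $M$ under the absolute Frobenius ($x\mapsto x^p$) of $S$. **$F$-zips.** An $F$-zip over $S$ (with respect to $q=p$) is a tuple $\underline{M}=(M,C^\bullet,D_\bullet,\varphi_\bullet)$ where $M$ is a locally free $\mathcal{O}_S$-module of finite rank; $C^\bullet=(C^i)_{i\in\mathbb{Z}}$ is a descending filtration of $M$ (each $C^i$ is locally a direct summand of $C^{i-1}$, $C^i=M$ for $i\ll0$, $C^i=0$ for $i\gg0$); $D_\bullet=(D_i)_{i\in\mathbb{Z}}$ is an ascending filtration of $M$ (with the analogous conditions); and $\varphi_i\colon (\mathrm{gr}^i_C)^{(p)}\to\mathrm{gr}_i^D$ ($i\in\mathbb{Z}$) are $\mathcal{O}_S$-linear isomorphisms, where $\mathrm{gr}^i_C=C^i/C^{i+1}$, $\mathrm{gr}^D_i=D_i/D_{i-1}$. An isomorphism of $F$-zips is an isomorphism of the underlying modules compatible with both filtrations and with all $\varphi_i$. The $F$-zip has type $\tau$ if $\mathrm{rank}(\mathrm{gr}^i_C)=\tau(i)$ for all $i$. The flag associated to a filtration is its set of submodules, forgetting the enumeration. **The set ${}^JW$.** Let $W=S_n$ be the group of permutations of $\{1,\ldots,n\}$, put $m_j:=n_1+\cdots+n_j$ ($m_0=0$), and regard $W_J=S_{n_r}\times\cdots\times S_{n_1}$ as a subgroup of $S_n$ in the usual way (preserving the blocks $\{n-m_j+1,\ldots,n-m_{j-1}\}$). The coset space $W_J\backslash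 W$ is identified with the set ${}^JW$ of $u\in W$ with $u^{-1}(n-m_j+1)<u^{-1}(n-m_j+2)<\cdots<u^{-1}(n-m_{j-1})$ for all $j=1,\ldots,r$, i.e. of those $u$ that are of minimal length in their coset $W_Ju$. **Standard $F$-zips.** Let $x\in W$ be given by $x(i)=i+m_j+m_{j-1}-n$ if $n-m_j<i\le n-m_{j-1}$; this is the element of minimal length in $w_0W_J$, where $w_0$ is the longest element of $W$. For $A\subset\{1,\ldots,n\}$ let $\mathbb{F}_p^A\subset\mathbb{F}_p^n$ be the span of the standard basis vectors $e_a$, $a\in A$. For $u\in{}^JW$, the standard $F$-zip $\underline{M}^u_\tau$ over $\mathbb{F}_p$ is given as follows: - the underlying module is $\mathbb{F}_p^n$; - $C^\bullet$ is the unique filtration of type $\tau$ whose associated flag is $\mathbb{F}_p^n\supset\mathbb{F}_p^{\{u(1),\ldots,u(m_{r-1})\}}\supset\mathbb{F}_p^{\{u(1),\ldots,u(m_{r-2})\}}\supset\cdots\supset\mathbb{F}_p^{\{u(1),\ldots,u(m_1)\}}\supset(0)$; - $D_\bullet$ is the unique filtration of type $\tau$ whose associated flag is $(0)\subset\mathbb{F}_p^{\{1,\ldots,n-m_{r-1}\}}\subset\mathbb{F}_p^{\{1,\ldots,n-m_{r-2}\}}\subset\cdots\subset\mathbb{F}_p^{\{1,\ldots,n-m_0\}}=\mathbb{F}_p^n$; - $\varphi_i=0$ for $i\notin\{i_1,\ldots,i_r\}$, and for $i=i_j$ it is the isomorphism $(\mathrm{gr}^i_C)^{(p)}=\mathbb{F}_p^{\{u(m_{r-j}+1),\ldots,u(m_{r-j+1})\}}\to\mathrm{gr}^D_i=\mathbb{F}_p^{\{n-m_{r-j+1}+1,\ldots,n-m_{r-j}\}}$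 induced by the permutation matrix associated to $x^{-1}u^{-1}$.
   Formalization: For the standard F-zips and their set ^JW, n_j is taken to be τ(i_{r+1−j}) instead of τ(i_j), since otherwise the described flags do not have type τ unless τ is palindromic; the bare bijection is also proved with n_j = τ(i_j). *)

(* Defs.v *)
From HB Require Import structures.
From mathcomp Require Import all_boot all_order all_fingroup all_algebra.
From mathcomp Require Import zify.

Set Implicit Arguments.
Unset Strict Implicit.
Unset Printing Implicit Defensive.

Import Order.TTheory GRing.Theory Num.Theory.

Local Open Scope ring_scope.

Definition lfun_bij (K : fieldType) (M N : vectType K) (f : 'Hom(M, N)) : bool :=
  (lker f == 0%VS) && (limg f == fullv).

Lemma lfun_bij_dim (K : fieldType) (M N : vectType K) (f : 'Hom(M, N)) :
  limg f = fullv -> \dim {:M} = \dim {:N} -> lfun_bij f.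
Proof.
move=> fs dMN; rewrite /lfun_bij fs eqxx andbT -dimv_eq0.
have := limg_ker_dim f fullv; rewrite capfv fs dMN => /eqP.
by rewrite -{2}[\dim {:N}]add0n eqn_add2r.
Qed.

Lemma lfun_bij_dimE (K : fieldType) (M N : vectType K) (f : 'Hom(M, N)) :
  lfun_bij f -> \dim {:M} = \dim {:N}.
Proof.
case/andP=> /eqP k0 /eqP fs.
by rewrite -(limg_ker_dim f fullv) k0 capv0 dimv0 fs.
Qed.

(* The quotient U / (U :&: W) of a subspace U of V, realised on the chosen
   complement U :\: W; by [qpr_surj] and [qpr_eq0] the map [qpr U W] restricts
   to a linear surjection U ->> quot U W with kernel U :&: W. *)
Section Quotient.
Variables (K : fieldType) (V : vectType K).
Implicit Types U W : {vspace V}.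

Definition quot U W : vectType K := subvs_of (U :\: W)%VS.

Definition qpr U W : 'Hom(V, quot U W) :=
  (linfun (vsproj (U :\: W)) \o addv_pi1 U W)%VF.

Lemma val_qpr U W v : vsval (qpr U W v) = addv_pi1 U W v.
Proof. by rewrite comp_lfunE lfunE /= vsprojK // memv_pi. Qed.

Lemma qprK U W (y : quot U W) : qpr U W (vsval y) = y.
Proof.
apply: val_inj; rewrite /= val_qpr /addv_pi1 daddv_pi_id ?subvsP //.
exact: capv_diff.
Qed.

Lemma quot_mem U W (y : quot U W) : vsval y \in U.
Proof. exact: (subvP (diffvSl U W)) (subvsP y). Qed.

Lemma qpr_surj U W (y : quot U W) : exists2 v, v \in U & qpr U W v = y.
Proof. by exists (vsval y); rewrite ?quot_mem ?qprK. Qed.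

Lemma qpr_subK U W v : v \in U -> v - vsval (qpr U W v) \in W.
Proof.
move=> vU; rewrite val_qpr.
have /addv_pi1_pi2 {1}<- : v \in (U + W)%VS by apply: (subvP (addvSl _ _)).
by rewrite addrC addKr memv_pi2.
Qed.

Lemma qpr_eq0 U W v : v \in U -> (qpr U W v == 0) = (v \in W).
Proof.
move=> vU; apply/eqP/idP=> [q0 | vW].
  have := qpr_subK W vU; rewrite q0.
  by have -> : vsval (0 : quot U W) = 0 by []; rewrite subr0.
apply: val_inj; apply/eqP; rewrite -[_ == _]memv0 -(capv_diff U W) memv_cap.
rewrite subvsP /= -(subKr v (vsval _)); apply: memvB => //.
exact: qpr_subK.
Qed.

Lemma dim_quot U W : (W <= U)%VS -> (\dim {: quot U W} + \dim W)%N = \dim U.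
Proof.
move=> sWU; rewrite -[RHS](dimv_cap_compl U W) addnC (capv_idPr sWU).
by congr addn; rewrite dimvf.
Qed.

End Quotient.

Definition qmap (K : fieldType) (V V' : vectType K) (U W : {vspace V})
    (U' W' : {vspace V'}) (f : 'Hom(V, V')) : 'Hom(quot U W, quot U' W') :=
  (qpr U' W' \o f \o linfun vsval)%VF.

Lemma qmapE (K : fieldType) (V V' : vectType K) (U W : {vspace V})
    (U' W' : {vspace V'}) (f : 'Hom(V, V')) (x : V) :
  (f @: U <= U')%VS -> (f @: W <= W')%VS -> x \in U ->
  qmap U W U' W' f (qpr U W x) = qpr U' W' (f x).
Proof.
move=> /subvP sU /subvP sW xU.
have -> : qmap U W U' W' f (qpr U W x) = qpr U' W' (f (vsval (qpr U W x))).
  rewrite /qmap 2!comp_lfunE; congr (qpr _ _ (f _)); exact: lfunE.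
apply/eqP; rewrite eq_sym -subr_eq0 -linearB /= -linearB qpr_eq0 /=.
  exact/sW/memv_img/qpr_subK.
by apply/sU/memv_img/rpredB; rewrite ?quot_mem.
Qed.

(* Pull-back sigma^* M = M (x)_(K, sigma) L along a ring morphism, in
   coordinates with respect to a basis of M: [pbu] is x |-> x (x) 1, and the
   universal property is given by [pblE] and [pbl_uniq]. *)
Section Pullback.
Variables (K L : fieldType).

Definition pullback (sigma : {rmorphism K -> L}) (M : vectType K) : vectType L :=
  'rV[L]_(\dim {: M}).

Variable sigma : {rmorphism K -> L}.

Definition pbu (M : vectType K) (x : M) : pullback sigma M :=
  \row_i sigma (coord (vbasis {: M}) i x).

Definition std_vec (M : vectType K) (i : 'I_(\dim {: M})) : M := (vbasis {: M})`_i.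

Definition pbl_fun (M : vectType K) (N : vectType L) (g : M -> N)
    (a : pullback sigma M) : N :=
  \sum_i (a : 'rV_(\dim {: M})) 0 i *: g (std_vec i).

Definition pbl (M : vectType K) (N : vectType L) (g : M -> N) :
  'Hom(pullback sigma M, N) := linfun (pbl_fun g).

Definition pbmap (M N : vectType K) (f : 'Hom(M, N)) :
    'Hom(pullback sigma M, pullback sigma N) :=
  pbl (fun x => pbu (f x)).

(* The image of sigma^* U in sigma^* M. *)
Definition pbs (M : vectType K) (U : {vspace M}) : {vspace pullback sigma M} :=
  <<[seq pbu x | x <- vbasis U]>>%VS.

Fact pbl_fun_is_linear (M : vectType K) (N : vectType L) (g : M -> N) :
  linear (@pbl_fun M N g).
Proof.
move=> c a b; rewrite /pbl_fun scaler_sumr -big_split /=.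
by apply: eq_bigr => i _; rewrite !mxE scalerDl scalerA.
Qed.
HB.instance Definition _ (M : vectType K) (N : vectType L) (g : M -> N) :=
  GRing.isSemilinear.Build L (pullback sigma M) N _
  (@pbl_fun M N g) (GRing.semilinear_linear (@pbl_fun_is_linear M N g)).

Definition semilinear_along (M : vectType K) (N : vectType L) (g : M -> N) :=
  forall c x y, g (c *: x + y) = sigma c *: g x + g y.

Lemma pbu_semilinear (M : vectType K) : semilinear_along (@pbu M).
Proof. by move=> c x y; apply/rowP=> i; rewrite !mxE linearP rmorphD rmorphM. Qed.

Lemma semilin0 (M : vectType K) (N : vectType L) (g : M -> N) :
  @semilinear_along M N g -> g 0 = 0.
Proof.
move=> h; have := h (-1) 0 0.
by rewrite scaler0 addr0 rmorphN1 scaleN1r addNr.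
Qed.

Lemma semilinZ (M : vectType K) (N : vectType L) (g : M -> N) c x :
  @semilinear_along M N g -> g (c *: x) = sigma c *: g x.
Proof. by move=> h; rewrite -[c *: x]addr0 h (semilin0 h) addr0. Qed.

Lemma semilinD (M : vectType K) (N : vectType L) (g : M -> N) x y :
  @semilinear_along M N g -> g (x + y) = g x + g y.
Proof. by move=> h; rewrite -[x]scale1r h rmorph1 !scale1r. Qed.

Lemma semilinB (M : vectType K) (N : vectType L) (g : M -> N) x y :
  @semilinear_along M N g -> g (x - y) = g x - g y.
Proof.
by move=> h; rewrite addrC -scaleN1r h rmorphN1 scaleN1r addrC.
Qed.

Lemma semilin_sum (M : vectType K) (N : vectType L) (g : M -> N) (I : Type)
    (r : seq I) (c : I -> K) (x : I -> M) :
  @semilinear_along M N g ->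
  g (\sum_(i <- r) c i *: x i) = \sum_(i <- r) sigma (c i) *: g (x i).
Proof.
move=> h; elim: r => [|i r IH]; first by rewrite !big_nil semilin0.
by rewrite !big_cons h IH.
Qed.

Lemma std_vec_sum (M : vectType K) (x : M) :
  x = \sum_i coord (vbasis {: M}) i x *: std_vec i.
Proof.
exact: coord_vbasis (memvf x).
Qed.

Lemma pblE (M : vectType K) (N : vectType L) (g : M -> N) x :
  semilinear_along g -> pbl g (pbu x) = g x.
Proof.
move=> h; rewrite lfunE /= /pbl_fun {2}[x]std_vec_sum (semilin_sum _ _ _ h).
by apply: eq_bigr => i _; rewrite mxE.
Qed.

Lemma pbmapE (M N : vectType K) (f : 'Hom(M, N)) (x : M) :
  pbmap f (pbu x) = pbu (f x).
Proof.
by rewrite (@pblE M) // => c y z; rewrite linearP pbu_semilinear.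
Qed.

Lemma pbu_std (M : vectType K) (i : 'I_(\dim {: M})) : pbu (std_vec i) = delta_mx 0 i.
Proof. 
apply/rowP=> j; rewrite !mxE coord_free ?(basis_free (vbasisP _)) //.
by rewrite eqxx /= rmorph_nat eq_sym.
 Qed.

Lemma pbu_sum (M : vectType K) (a : pullback sigma M) :
  a = \sum_i (a : 'rV_(\dim {: M})) 0 i *: pbu (std_vec i).
Proof.
by rewrite {1}[a]row_sum_delta; apply: eq_bigr => i _; rewrite pbu_std.
Qed.

Lemma pbl_uniq (M : vectType K) (N : vectType L) (f f' : 'Hom(pullback sigma M, N)) :
  (forall x, f (pbu x) = f' (pbu x)) -> f = f'.
Proof.
move=> h; apply/lfunP=> a; rewrite [a]pbu_sum !linear_sum.
by apply: eq_bigr => i _; rewrite !linearZ /= h.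
Qed.

Lemma dim_pullback (M : vectType K) : \dim {: pullback sigma M} = \dim {: M}.
Proof. by rewrite dimvf [LHS]dim_matrix mul1r. Qed.

Lemma pbu_mem (M : vectType K) (U : {vspace M}) x : x \in U -> pbu x \in pbs U.
Proof.
move=> xU; rewrite (coord_vbasis xU) (semilin_sum _ _ _ (@pbu_semilinear M)).
apply: memv_suml => i _; apply: memvZ; apply: memv_span.
by apply: map_f; apply: mem_nth; rewrite size_tuple.
Qed.

Lemma pbsP (M : vectType K) (U : {vspace M}) (X : {vspace pullback sigma M}) :
  (forall x, x \in U -> pbu x \in X) -> (pbs U <= X)%VS.
Proof.
move=> h; apply/span_subvP => _ /mapP[x xb ->]; apply: h.
exact: vbasis_mem xb.
Qed.

Lemma pbsS (M : vectType K) (U W : {vspace M}) :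
  (U <= W)%VS -> (pbs U <= pbs W)%VS.
Proof. by move=> /subvP sUW; apply: pbsP => x /sUW; apply: pbu_mem. Qed.

Lemma pbs0 (M : vectType K) : pbs (0%VS : {vspace M}) = 0%VS.
Proof.
apply/eqP; rewrite -subv0; apply: pbsP => x; rewrite memv0 => /eqP->.
by rewrite (semilin0 (@pbu_semilinear M)) mem0v.
Qed.

Lemma pbsT (M : vectType K) : pbs (fullv : {vspace M}) = fullv.
Proof.
apply/eqP; rewrite eqEsubv subvf; apply/subvP => a _; rewrite [a]pbu_sum.
by apply: memv_suml => i _; apply/memvZ/pbu_mem/memvf.
Qed.

Lemma dim_pbs (M : vectType K) (U : {vspace M}) : \dim (pbs U) = \dim U.
Proof.
have le (X : {vspace M}) : (\dim (pbs X) <= \dim X)%N.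
  by apply: leq_trans (dim_span _) _; rewrite size_map size_tuple.
apply/eqP; rewrite eqn_leq le /=.
have sub : (fullv <= pbs U + pbs U^C)%VS.
  rewrite -pbsT; apply: pbsP => x _.
  have : x \in (U + U^C)%VS by rewrite addv_complf memvf.
  case/memv_addP=> y yU [z zU ->]; rewrite (semilinD _ _ (@pbu_semilinear M)).
  by apply: memv_add; apply: pbu_mem.
have := leq_trans (dimvS sub) (dimv_add_leqif _ _).
have := le U^C%VS; rewrite dim_pullback dimv_compl.
have := dimvS (subvf U); lia.
Qed.

End Pullback.

Definition frob (p : nat) (K : fieldType) (chK : p \in [pchar K]) :
  {rmorphism K -> K} := pFrobenius_aut chK.

(* Over a field the condition "locally a direct summand" on the steps of a
   filtration is automatic. *)
Record fzip (p : nat) (K : fieldType) (chK : p \in [pchar K]) := FZip {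
  fz_mod :> vectType K;
  fz_C : int -> {vspace fz_mod};
  fz_D : int -> {vspace fz_mod};
  fz_phi : forall i : int,
    'Hom(pullback (frob chK) (quot (fz_C i) (fz_C (i + 1))),
         quot (fz_D i) (fz_D (i - 1)));
  fz_C_desc : forall i : int, (fz_C i <= fz_C (i - 1))%VS;
  fz_C_full : exists a : int, forall i : int, i <= a -> fz_C i = fullv;
  fz_C_zero : exists b : int, forall i : int, b <= i -> fz_C i = 0%VS;
  fz_D_asc : forall i : int, (fz_D (i - 1) <= fz_D i)%VS;
  fz_D_zero : exists a : int, forall i : int, i <= a -> fz_D i = 0%VS;
  fz_D_full : exists b : int, forall i : int, b <= i -> fz_D i = fullv;
  fz_phi_iso : forall i : int, lfun_bij (fz_phi i)
}.

Definition grC (p : nat) (K : fieldType) (chK : p \in [pchar K]) (Z : fzip chK)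
  (i : int) : vectType K := quot (fz_C Z i) (fz_C Z (i + 1)).

Definition grD (p : nat) (K : fieldType) (chK : p \in [pchar K]) (Z : fzip chK)
  (i : int) : vectType K := quot (fz_D Z i) (fz_D Z (i - 1)).

Definition fzip_type (p : nat) (K : fieldType) (chK : p \in [pchar K])
    (tau : int -> nat) (Z : fzip chK) : Prop :=
  forall i : int, \dim {: grC Z i} = tau i.

Definition fzip_iso (p : nat) (K : fieldType) (chK : p \in [pchar K])
    (Z Z' : fzip chK) : Prop :=
  exists f : 'Hom(fz_mod Z, fz_mod Z'),
    [/\ lfun_bij f,
        forall i : int, (f @: fz_C Z i)%VS = fz_C Z' i,
        forall i : int, (f @: fz_D Z i)%VS = fz_D Z' i
      & forall i : int,
          (fz_phi Z' i \o
             pbmap (frob chK)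
               (qmap (fz_C Z i) (fz_C Z (i + 1))
                  (fz_C Z' i) (fz_C Z' (i + 1)) f))%VF
          = (qmap (fz_D Z i) (fz_D Z (i - 1))
               (fz_D Z' i) (fz_D Z' (i - 1)) f \o fz_phi Z i)%VF].

Section BaseChange.
Variables (K L : fieldType) (iota : {rmorphism K -> L}).

(* The canonical isomorphism iota^*(U / W) ~ iota^*U / iota^*W. *)
Definition bc_quot (M : vectType K) (U W : {vspace M}) :
    'Hom(pullback iota (quot U W), quot (pbs iota U) (pbs iota W)) :=
  pbl iota (fun y => qpr (pbs iota U) (pbs iota W) (pbu iota (vsval y))).

Lemma bc_quot_semilinear (M : vectType K) (U W : {vspace M}) :
  semilinear_along iota
    (fun y : quot U W => qpr (pbs iota U) (pbs iota W) (pbu iota (vsval y))).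
Proof. by move=> c x y; rewrite linearP /= pbu_semilinear linearP. Qed.

Lemma bc_quotE (M : vectType K) (U W : {vspace M}) (x : M) : x \in U ->
  bc_quot U W (pbu iota (qpr U W x)) =
  qpr (pbs iota U) (pbs iota W) (pbu iota x).
Proof.
move=> xU; rewrite (pblE _ (@bc_quot_semilinear M U W)); apply/eqP.
rewrite eq_sym -subr_eq0 -linearB /= -(semilinB _ _ (@pbu_semilinear _ _ iota M)).
have h := qpr_subK W xU.
rewrite qpr_eq0 ?pbu_mem //.
by rewrite rpredB ?quot_mem.
Qed.

Lemma bc_quot_bij (M : vectType K) (U W : {vspace M}) :
  (W <= U)%VS -> lfun_bij (bc_quot U W).
Proof.
move=> sWU; apply: lfun_bij_dim.
  apply/eqP; rewrite eqEsubv subvf; apply/subvP => y _.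
  have [v vU <-] := qpr_surj y; rewrite memv_preim.
  apply: (subvP _ _ vU); apply: pbsP => x xU; rewrite -memv_preim -bc_quotE //.
  exact/memv_img/memvf.
have h1 := dim_quot sWU; have := dim_quot (pbsS iota sWU).
by rewrite !dim_pbs dim_pullback -h1 => /addIn.
Qed.

Variables (p : nat) (chK : p \in [pchar K]) (chL : p \in [pchar L]).

Section Phi.
Variables (M : vectType K) (U W U' W' : {vspace M}).
Variable phi : 'Hom(pullback (frob chK) (quot U W), quot U' W').

(* The Frobenius-linear map y |-> (iota^* phi) (1 (x) y), written in the
   coordinates of iota^*(U / W); see [bc_phiE]. *)
Definition bc_semi (y : quot (pbs iota U) (pbs iota W)) :
    quot (pbs iota U') (pbs iota W') :=
  \sum_j frob chL ((((bc_quot U W)^-1)%VF y : 'rV_(\dim {: quot U W})) 0 j)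
     *: bc_quot U' W' (pbu iota (phi (pbu (frob chK) (std_vec j)))).

Definition bc_phi :
    'Hom(pullback (frob chL) (quot (pbs iota U) (pbs iota W)),
         quot (pbs iota U') (pbs iota W')) := pbl (frob chL) bc_semi.

Fact pbu_phi_semilinear :
  semilinear_along iota (fun z => pbu iota (phi z)).
Proof. by move=> c x y; rewrite linearP /= pbu_semilinear. Qed.

Lemma bc_semi_semilinear : semilinear_along (frob chL) bc_semi.
Proof.
move=> c x y; rewrite /bc_semi scaler_sumr -big_split /=.
apply: eq_bigr => i _; rewrite linearP !mxE.
by rewrite !(rmorphD, rmorphM) scalerDl scalerA.
Qed.

Hypotheses (sWU : (W <= U)%VS) (sWU' : (W' <= U')%VS).

Lemma bc_semiE (y : quot U W) :
  bc_semi (bc_quot U W (pbu iota y)) =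
  bc_quot U' W' (pbu iota (phi (pbu (frob chK) y))).
Proof.
have /andP[/eqP k0 _] := bc_quot_bij sWU.
rewrite /bc_semi lker0_lfunK ?k0 //.
rewrite [y in RHS]std_vec_sum.
rewrite (semilin_sum _ _ _ (@pbu_semilinear _ _ (frob chK) _)).
rewrite (semilin_sum _ _ _ pbu_phi_semilinear) linear_sum /=.
apply: eq_bigr => i _; rewrite linearZ /= !mxE; congr (_ *: _).
by rewrite !pFrobenius_autE rmorphXn.
Qed.

(* (iota^* phi) (1 (x) [x (x) 1]) = phi (1 (x) [x]) (x) 1 *)
Lemma bc_phiE (x : M) : x \in U ->
  bc_phi (pbu (frob chL) (qpr (pbs iota U) (pbs iota W) (pbu iota x))) =
  bc_quot U' W' (pbu iota (phi (pbu (frob chK) (qpr U W x)))).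
Proof.
by move=> xU; rewrite (pblE _ bc_semi_semilinear) -bc_quotE // bc_semiE.
Qed.

Lemma bc_phi_bij : lfun_bij phi -> lfun_bij bc_phi.
Proof.
move=> phib; have /lfun_bij_dimE d1 := phib.
have /lfun_bij_dimE d2 := bc_quot_bij sWU.
have /lfun_bij_dimE d3 := bc_quot_bij sWU'.
apply: lfun_bij_dim; last first.
  by rewrite dim_pullback -d2 dim_pullback -d3 dim_pullback -d1 dim_pullback.
apply/eqP; rewrite eqEsubv subvf; apply/subvP => y _.
have /andP[_ /eqP s3] := bc_quot_bij sWU'.
have : y \in limg (bc_quot U' W') by rewrite s3 memvf.
case/memv_imgP => a _ ->; rewrite memv_preim.
apply: (subvP _ _ (memvf a)); rewrite -(pbsT iota); apply: pbsP => z _.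
have /andP[_ /eqP s1] := phib.
have : z \in limg phi by rewrite s1 memvf.
case/memv_imgP => b _ ->; rewrite -memv_preim [b]pbu_sum.
rewrite (semilin_sum _ _ _ pbu_phi_semilinear) linear_sum /=.
apply: memv_suml => i _; rewrite linearZ /= -bc_semiE.
rewrite -(pblE _ bc_semi_semilinear); apply: memvZ.
exact/memv_img/memvf.
Qed.

End Phi.

End BaseChange.

Section FzipBaseChange.
Variables (K L : fieldType) (iota : {rmorphism K -> L}) (p : nat).
Variables (chK : p \in [pchar K]) (chL : p \in [pchar L]) (Z : fzip chK).

Fact bc_C_desc (i : int) : (pbs iota (fz_C Z i) <= pbs iota (fz_C Z (i - 1)))%VS.
Proof. exact/pbsS/fz_C_desc. Qed.

Fact bc_C_full :
  exists a : int, forall i, i <= a -> pbs iota (fz_C Z i) = fullv.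
Proof. by have [a ha] := fz_C_full Z; exists a => i /ha ->; rewrite pbsT. Qed.

Fact bc_C_zero :
  exists b : int, forall i, b <= i -> pbs iota (fz_C Z i) = 0%VS.
Proof. by have [b hb] := fz_C_zero Z; exists b => i /hb ->; rewrite pbs0. Qed.

Fact bc_D_asc (i : int) : (pbs iota (fz_D Z (i - 1)) <= pbs iota (fz_D Z i))%VS.
Proof. exact/pbsS/fz_D_asc. Qed.

Fact bc_D_zero :
  exists a : int, forall i, i <= a -> pbs iota (fz_D Z i) = 0%VS.
Proof. by have [a ha] := fz_D_zero Z; exists a => i /ha ->; rewrite pbs0. Qed.

Fact bc_D_full :
  exists b : int, forall i, b <= i -> pbs iota (fz_D Z i) = fullv.
Proof. by have [b hb] := fz_D_full Z; exists b => i /hb ->; rewrite pbsT. Qed.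

Fact bc_phi_iso (i : int) : lfun_bij (bc_phi iota chL (fz_phi Z i)).
Proof.
apply: bc_phi_bij (fz_phi_iso Z i); last exact: fz_D_asc.
by have := fz_C_desc Z (i + 1); rewrite addrK.
Qed.

Definition fzip_bc : fzip chL :=
  @FZip p L chL (pullback iota Z) (fun i => pbs iota (fz_C Z i))
    (fun i => pbs iota (fz_D Z i)) (fun i => bc_phi iota chL (fz_phi Z i))
    bc_C_desc bc_C_full bc_C_zero bc_D_asc bc_D_zero bc_D_full bc_phi_iso.

End FzipBaseChange.

Definition Fp_emb (p : nat) (L : fieldType) (chL : p \in [pchar L]) (a : 'F_p) : L :=
  (a : nat)%:R.

Section FpEmb.
Variables (p : nat) (L : fieldType) (chL : p \in [pchar L]).

Lemma Fp_emb_nat (m : nat) : Fp_emb chL m%:R = m%:R.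
Proof.
by rewrite /Fp_emb val_Fp_nat ?(pcharf_prime chL) // (GRing.natr_mod_pchar chL).
Qed.

Fact Fp_emb_is_zmod_morphism : zmod_morphism (Fp_emb chL).
Proof.
move=> a b; apply/eqP; rewrite eq_sym subr_eq; apply/eqP.
rewrite -[a in LHS](subrK b) -[X in Fp_emb chL (X + _)]natr_Zp.
by rewrite -[b in LHS]natr_Zp -natrD Fp_emb_nat natrD -!Fp_emb_nat !natr_Zp.
Qed.
HB.instance Definition _ := GRing.isZmodMorphism.Build 'F_p L (Fp_emb chL)
  Fp_emb_is_zmod_morphism.

Fact Fp_emb_is_monoid_morphism : monoid_morphism (Fp_emb chL).
Proof.
split=> [|a b]; first exact: (Fp_emb_nat 1).
rewrite -[a in LHS]natr_Zp -[b in LHS]natr_Zp -natrM Fp_emb_nat natrM.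
by rewrite -!Fp_emb_nat !natr_Zp.
Qed.
HB.instance Definition _ := GRing.isMonoidMorphism.Build 'F_p L (Fp_emb chL)
  Fp_emb_is_monoid_morphism.
End FpEmb.

(* Conventions for permutations: positions 1, ..., n are shifted to the elements
   0, ..., n - 1 of 'I_n.  [ns] is the list n_1, ..., n_r and n = sumn ns. *)
Definition psum (ns : seq nat) (j : nat) : nat := sumn (take j ns).

(* a + 1 lies in {n - m_j + 1, ..., n - m_(j-1)}, for 1 <= j <= r. *)
Definition in_block (ns : seq nat) (j a : nat) : bool :=
  (sumn ns - psum ns j <= a < sumn ns - psum ns j.-1)%N.

Definition W_J (ns : seq nat) : {set 'S_(sumn ns)} :=
  [set w : 'S_(sumn ns) | [forall j : 'I_(size ns), forall a : 'I_(sumn ns),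
     in_block ns j.+1 a ==> in_block ns j.+1 (w a)]].

(* The cosets W_J u = {w o u}.  The product of permutations is
   (s * t) a = t (s a), so they are the library's left cosets u *: W_J. *)
Definition W_J_cosets (ns : seq nat) : {set {set 'S_(sumn ns)}} :=
  lcosets (W_J ns) [set: 'S_(sumn ns)].

Definition JW (ns : seq nat) : {set 'S_(sumn ns)} :=
  [set u : 'S_(sumn ns) | [forall j : 'I_(size ns),
     forall a : 'I_(sumn ns), forall b : 'I_(sumn ns),
     [&& in_block ns j.+1 a, in_block ns j.+1 b & (a < b)%N]
       ==> ((u^-1)%g a < (u^-1)%g b)%N]].

Definition block_of (ns : seq nat) (a : nat) : nat :=
  find (fun j => (sumn ns - psum ns j <= a)%N) (iota 0 (size ns).+1).

Definition x_val (ns : seq nat) (a : nat) : nat :=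
  (a + psum ns (block_of ns a) + psum ns (block_of ns a).-1 - sumn ns)%N.

Section XPerm.
Variable ns : seq nat.

Lemma psum_leq (i j : nat) : (i <= j)%N -> (psum ns i <= psum ns j)%N.
Proof.
by move=> ij; rewrite /psum -(subnKC ij) takeD sumn_cat leq_addr.
Qed.

Lemma psum_le_sum (j : nat) : (psum ns j <= sumn ns)%N.
Proof. by rewrite -[X in (_ <= sumn X)%N](cat_take_drop j) sumn_cat leq_addr. Qed.

Lemma block_ofP (a : nat) : (a < sumn ns)%N ->
  (0 < block_of ns a <= size ns)%N /\ in_block ns (block_of ns a) a.
Proof.
move=> an; rewrite /in_block /block_of; set P := fun j => _; set s := iota _ _.
have hs : has P s.
  apply/hasP; exists (size ns); first by rewrite mem_iota /=.
  by rewrite /P /psum take_size subnn.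
have lt : (find P s < (size ns).+1)%N by rewrite -(size_iota 0 (size ns).+1) -has_find.
have := nth_find 0%N hs; rewrite nth_iota // add0n => h1.
case E: (find P s) h1 lt => [|j] h1 lt.
  by move: h1; rewrite /P /psum take0 subn0 leqNgt an.
have jf : (j < find P s)%N by rewrite E.
have := before_find 0%N jf; rewrite nth_iota ?add0n; last exact: ltnW.
by rewrite /P => /negbT; rewrite -ltnNge => h2; split=> //; apply/andP.
Qed.

Lemma x_val_bounds (a : nat) : (a < sumn ns)%N ->
  (psum ns (block_of ns a).-1 <= x_val ns a < psum ns (block_of ns a))%N.
Proof.
move=> an; have [/andP[j0 _] /andP[]] := block_ofP an; rewrite /x_val.
set j := block_of ns a in j0 *.
have := psum_leq (leq_pred j); have := psum_le_sum j; lia.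
Qed.

Lemma x_val_psum (a k : nat) : (a < sumn ns)%N ->
  (x_val ns a < psum ns k)%N = (sumn ns - psum ns k <= a)%N.
Proof.
move=> an; have B := x_val_bounds an; have [_ /andP[A1 A2]] := block_ofP an.
have := psum_le_sum k; have := psum_le_sum (block_of ns a).
case: (leqP (block_of ns a) k) => kj.
  have := psum_leq kj; lia.
have := @psum_leq k (block_of ns a).-1; lia.
Qed.

Fact x_val_ltn (a : 'I_(sumn ns)) : (x_val ns a < sumn ns)%N.
Proof.
have /andP[_ h] := x_val_bounds (ltn_ord a).
exact: leq_trans h (psum_le_sum _).
Qed.

Fact x_val_inj : injective (fun a => Ordinal (x_val_ltn a)).
Proof.
move=> a b /(congr1 val) /= E; apply: val_inj => /=.
have A := x_val_bounds (ltn_ord a); have B := x_val_bounds (ltn_ord b).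
have [_ /andP[A1 A2]] := block_ofP (ltn_ord a).
have [_ /andP[B1 B2]] := block_ofP (ltn_ord b).
have lA := psum_le_sum (block_of ns a); have lB := psum_le_sum (block_of ns b).
have lA' := psum_le_sum (block_of ns a).-1.
have lB' := psum_le_sum (block_of ns b).-1.
case: (ltngtP (block_of ns a) (block_of ns b)) => [lt|lt|eq].
- have := @psum_leq (block_of ns a) (block_of ns b).-1; lia.
- have := @psum_leq (block_of ns b) (block_of ns a).-1; lia.
- move: E; rewrite /x_val -eq in A1 A2 B1 B2 lA *; lia.
Qed.

Definition x_perm : 'S_(sumn ns) := perm x_val_inj.

End XPerm.

(* [s] lists the support i_1 < ... < i_r of tau.  The j-th step from the bottom
   of the flag of [std_C] has dimension n_1 + ... + n_j and is the one of index
   i_(r-j+1), so "of type tau" forces n_j = tau (i_(r-j+1)). *)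
Definition std_ns (tau : int -> nat) (s : seq int) : seq nat :=
  [seq tau i | i <- rev s].

Section StandardFZip.
Variables (p : nat) (p_pr : prime p) (tau : int -> nat) (s : seq int).
Local Notation ns := (std_ns tau s).
Local Notation n := (sumn ns).
Variable u : 'S_n.

(* The span F_p^A of the e_a, a in A. *)
Definition coordv (A : {set 'I_n}) : {vspace 'rV['F_p]_n} :=
  span [seq delta_mx 0 a | a in A].

(* {u(1), ..., u(m_(r-j+1))} for i_(j-1) < i <= i_j *)
Definition std_Cset (i : int) : {set 'I_n} :=
  u @: [set a : 'I_n | (a < psum ns (size s - count (fun l => (l < i)%R) s))%N].

(* {1, ..., n - m_(r-j)} for i_j <= i < i_(j+1) *)
Definition std_Dset (i : int) : {set 'I_n} :=
  [set a : 'I_n | (a < n - psum ns (size s - count (fun l => (l <= i)%R) s))%N].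

Definition std_C (i : int) : {vspace 'rV['F_p]_n} := coordv (std_Cset i).
Definition std_D (i : int) : {vspace 'rV['F_p]_n} := coordv (std_Dset i).

Definition std_move (a : 'I_n) : 'I_n := ((x_perm ns)^-1)%g ((u^-1)%g a).

(* y = sum_(a in A) y_a [e_a] is sent to sum_(a in A) y_a ^+ p
   [e_(std_move a)], where A = std_Cset i :\: std_Cset (i + 1); the
   coordinates in A do not depend on the representative of y. *)
Definition std_semi (i : int) (y : quot (std_C i) (std_C (i + 1))) :
    quot (std_D i) (std_D (i - 1)) :=
  qpr (std_D i) (std_D (i - 1))
    (\sum_(a in std_Cset i :\: std_Cset (i + 1))
       ((vsval y : 'rV['F_p]_n) 0 a) ^+ p
         *: delta_mx 0 (std_move a)).

Definition std_phi (i : int) :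
    'Hom(pullback (frob (pchar_Fp p_pr)) (quot (std_C i) (std_C (i + 1))),
         quot (std_D i) (std_D (i - 1))) :=
  pbl (frob (pchar_Fp p_pr)) (@std_semi i).

Lemma coordvP (A : {set 'I_n}) (v : 'rV['F_p]_n) :
  reflect (forall a, a \notin A -> v 0 a = 0) (v \in coordv A).
Proof.
apply: (iffP idP) => [vA a aA | h]; last first.
  rewrite [v]row_sum_delta; apply: memv_suml => a _.
  have [aA|/h ->] := boolP (a \in A); last by rewrite scale0r mem0v.
  by apply/memvZ/memv_span/image_f.
pose X := [seq delta_mx 0 a | a in A] : seq 'rV['F_p]_n.
have vX : v \in span (in_tuple X) by [].
rewrite (coord_span vX) summxE big1 // => i _; rewrite !mxE.
have /mapP[b] : X`_i \in X by apply: mem_nth.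
rewrite mem_enum => bA ->.
by rewrite !mxE eqxx /=; case: eqP aA => [->|_ _]; rewrite ?bA ?mulr0.
Qed.

Lemma coordvS (A B : {set 'I_n}) : A \subset B -> (coordv A <= coordv B)%VS.
Proof.
move=> /subsetP AB; apply/subvP => v /coordvP h; apply/coordvP => a aB.
by apply: h; apply: contra aB => /AB.
Qed.

Lemma coordvT : coordv setT = fullv.
Proof.
apply/eqP; rewrite eqEsubv subvf; apply/subvP => v _; apply/coordvP => a.
by rewrite inE.
Qed.

Lemma coordv0 : coordv set0 = 0%VS.
Proof.
apply/eqP; rewrite -subv0; apply/subvP => v /coordvP h; rewrite memv0.
by apply/eqP/rowP => a; rewrite h ?inE // mxE.
Qed.

Lemma delta_coordv (A : {set 'I_n}) a : (delta_mx 0 a \in coordv A) = (a \in A).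
Proof.
apply/coordvP/idP => [h | aA b bA].
  apply: contraT => /h /eqP; by rewrite mxE !eqxx oner_eq0.
by rewrite mxE eqxx /=; case: eqP bA => // ->; rewrite aA.
Qed.

Lemma dim_coordv (A : {set 'I_n}) : \dim (coordv A) = #|A|.
Proof.
have le (B : {set 'I_n}) : (\dim (coordv B) <= #|B|)%N.
  by apply: leq_trans (dim_span _) _; rewrite size_image.
apply/eqP; rewrite eqn_leq le /=.
have sub : (fullv <= coordv A + coordv (~: A))%VS.
  apply/subvP => v _; rewrite [v]row_sum_delta; apply: memv_suml => a _.
  apply: memvZ; have [aA|aA] := boolP (a \in A).
    by apply: (subvP (addvSl _ _)); rewrite delta_coordv.
  by apply: (subvP (addvSr _ _)); rewrite delta_coordv inE.
have := leq_trans (dimvS sub) (dimv_add_leqif _ _).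
rewrite dimvf dim_matrix mul1r; have := le (~: A); have := cardsC A.
rewrite card_ord => H1 H2 H3; rewrite -(leq_add2r #|~: A|) H1.
by apply: leq_trans H3 _; rewrite leq_add2l.
Qed.

Lemma size_std_ns : size ns = size s.
Proof. by rewrite size_map size_rev. Qed.

Lemma std_CsetS (i j : int) : i <= j -> std_Cset j \subset std_Cset i.
Proof.
move=> ij; apply: imsetS; apply/subsetP => a; rewrite !inE => /leq_trans; apply.
apply/psum_leq/leq_sub2l/sub_count => l /=; move/lt_le_trans; exact.
Qed.

Lemma std_DsetS (i j : int) : i <= j -> std_Dset i \subset std_Dset j.
Proof.
move=> ij; apply/subsetP => a; rewrite !inE => /leq_trans; apply.
apply/leq_sub2l/psum_leq/leq_sub2l/sub_count => l /=; move/le_trans; exact.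
Qed.

Lemma std_bounds :
  exists ab : int * int, forall l, l \in s -> ab.1 < l < ab.2.
Proof.
elim: s => [|l t [[a b] /= h]]; first by exists (0, 0).
exists (Num.min a (l - 1), Num.max b (l + 1)) => l' /=.
rewrite inE => /orP[/eqP-> | /h]; lia.
Qed.

Fact std_C_desc (i : int) : (std_C i <= std_C (i - 1))%VS.
Proof. by apply/coordvS/std_CsetS; lia. Qed.

Fact std_C_full : exists a : int, forall i, i <= a -> std_C i = fullv.
Proof.
have [[a b] /= h] := std_bounds; exists a => i ia; rewrite -coordvT.
congr coordv; apply/setP=> c; rewrite inE -(permKV u c) imset_f //.
rewrite inE (_ : count _ _ = 0%N); last first.
  apply/eqP; rewrite -leqn0 leqNgt -has_count; apply/hasPn => l /h /andP[al _].
  by rewrite -leNgt; apply/ltW/(le_lt_trans ia).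
by rewrite subn0 -size_std_ns /psum take_size ltn_ord.
Qed.

Fact std_C_zero : exists b : int, forall i, b <= i -> std_C i = 0%VS.
Proof.
have [[a b] /= h] := std_bounds; exists b => i ib; rewrite -coordv0.
rewrite /std_C /std_Cset (_ : count _ _ = size s); last first.
  by apply/eqP; rewrite -all_count; apply/allP => l /h /andP[_ /lt_le_trans]; apply.
rewrite subnn /psum take0 (_ : [set _ | _] = set0) ?imset0 //.
Qed.

Fact std_D_asc (i : int) : (std_D (i - 1) <= std_D i)%VS.
Proof. by apply/coordvS/std_DsetS; lia. Qed.

Fact std_D_zero : exists a : int, forall i, i <= a -> std_D i = 0%VS.
Proof.
have [[a b] /= h] := std_bounds; exists a => i ia; rewrite -coordv0.
congr coordv; apply/setP=> c; rewrite !inE (_ : count _ _ = 0%N).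
  by rewrite subn0 -size_std_ns /psum take_size subnn.
apply/eqP; rewrite -leqn0 leqNgt -has_count; apply/hasPn => l /h /andP[al _].
by rewrite -ltNge; apply: le_lt_trans al.
Qed.

Fact std_D_full : exists b : int, forall i, b <= i -> std_D i = fullv.
Proof.
have [[a b] /= h] := std_bounds; exists b => i ib; rewrite -coordvT.
congr coordv; apply/setP=> c; rewrite !inE (_ : count _ _ = size s).
  by rewrite subnn /psum take0 subn0 ltn_ord.
apply/eqP; rewrite -all_count; apply/allP => l /h /andP[_ lb].
exact/ltW/(lt_le_trans lb).
Qed.

Fact std_semi_semilinear (i : int) :
  semilinear_along (frob (pchar_Fp p_pr)) (@std_semi i).
Proof.
move=> c y z; rewrite /std_semi -linearP; congr (qpr _ _ _).
rewrite scaler_sumr -big_split /=; apply: eq_bigr => a _.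
rewrite !mxE -!(pFrobenius_autE (pchar_Fp p_pr)).
by rewrite rmorphD rmorphM scalerDl scalerA.
Qed.

Lemma std_move_inj : injective std_move.
Proof. by move=> a b /perm_inj/perm_inj. Qed.

Lemma std_moveK (b : 'I_n) : std_move (u (x_perm ns b)) = b.
Proof. by rewrite /std_move !permK. Qed.

Lemma std_CD (i : int) (b : 'I_n) :
  (u (x_perm ns b) \in std_Cset i) = (b \notin std_Dset (i - 1)).
Proof.
rewrite mem_imset; last exact: perm_inj.
rewrite !inE permE /= x_val_psum // -leqNgt.
by rewrite (@eq_count _ _ (fun l => l <= i - 1)) // => l /=; lia.
Qed.

Lemma std_block (i : int) (b : 'I_n) :
  (u (x_perm ns b) \in std_Cset i :\: std_Cset (i + 1)) =
  (b \in std_Dset i :\: std_Dset (i - 1)).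
Proof. by rewrite !in_setD !std_CD addrK negbK andbC. Qed.

(* phi (1 (x) [e_a]) = [e_(x^-1 (u^-1 a))] *)
Lemma std_phiE (i : int) (a : 'I_n) : a \in std_Cset i :\: std_Cset (i + 1) ->
  std_phi i (pbu (frob (pchar_Fp p_pr))
               (qpr (std_C i) (std_C (i + 1)) (delta_mx 0 a))) =
  qpr (std_D i) (std_D (i - 1)) (delta_mx 0 (std_move a)).
Proof.
move=> aA; rewrite (pblE _ (@std_semi_semilinear i)) /std_semi.
congr (qpr _ _ _).
have /setDP[aC _] := aA.
have := @qpr_subK _ _ (std_C i) (std_C (i + 1)) (delta_mx 0 a).
rewrite delta_coordv => /(_ aC)/coordvP h.
rewrite (bigD1 a) //= big1 ?addr0 => [|b /andP[/setDP[_ bC] ba]].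
  have /setDP[_ /h] := aA; rewrite !mxE !eqxx /= => /eqP.
  by rewrite subr_eq0 => /eqP <-; rewrite expr1n scale1r.
have := h b bC; rewrite !mxE eqxx /= (negbTE ba) => /eqP.
rewrite subr_eq0 => /eqP <-.
by rewrite expr0n; case: p p_pr => //= *; rewrite scale0r.
Qed.

Fact std_phi_iso (i : int) : lfun_bij (std_phi i).
Proof.
apply: lfun_bij_dim.
  apply/eqP; rewrite eqEsubv subvf; apply/subvP => y _.
  have [v /coordvP vD <-] := qpr_surj y.
  rewrite [v]row_sum_delta linear_sum; apply: memv_suml => b _.
  rewrite linearZ /=; have [bD|/vD->] := boolP (b \in std_Dset i); last first.
    by rewrite scale0r mem0v.
  apply: memvZ; have [bD'|bD'] := boolP (b \in std_Dset (i - 1)).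
    have /eqP -> : qpr (std_D i) (std_D (i - 1)) (delta_mx 0 b) == 0.
      by rewrite qpr_eq0 delta_coordv.
    exact: mem0v.
  rewrite -[b]std_moveK -std_phiE; first exact/memv_img/memvf.
  by rewrite std_block inE bD bD'.
rewrite dim_pullback.
have sC : (std_C (i + 1) <= std_C i)%VS.
  by have := std_C_desc (i + 1); rewrite addrK.
have := dim_quot sC; have := dim_quot (std_D_asc i); rewrite !dim_coordv.
have sD : std_Dset (i - 1) \subset std_Dset i by apply: std_DsetS; lia.
have sC' : std_Cset (i + 1) \subset std_Cset i by apply: std_CsetS; lia.
have := cardsD (std_Dset i) (std_Dset (i - 1)).
have := cardsD (std_Cset i) (std_Cset (i + 1)).
rewrite (setIidPr sD) (setIidPr sC').
have -> : #|std_Cset i :\: std_Cset (i + 1)| = #|std_Dset i :\: std_Dset (i - 1)|.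
  pose f (b : 'I_n) := u (x_perm ns b).
  have fI : injective f by move=> b c /perm_inj/perm_inj.
  rewrite -[RHS](card_imset _ fI); apply: eq_card => a.
  have -> : a = f (((x_perm ns)^-1)%g ((u^-1)%g a)) by rewrite /f !permKV.
  by rewrite std_block (mem_imset _ _ fI).
have := subset_leq_card sD; have := subset_leq_card sC'; lia.
Qed.

Definition std_fzip : fzip (pchar_Fp p_pr) :=
  @FZip p 'F_p (pchar_Fp p_pr) 'rV['F_p]_n std_C std_D std_phi
    std_C_desc std_C_full std_C_zero std_D_asc std_D_zero std_D_full std_phi_iso.

End StandardFZip.

(* [cl] induces a bijection from the set of isomorphism classes of F-zips of
   type tau onto X. *)
Definition classifies (p : nat) (K : fieldType) (chK : p \in [pchar K])
    (tau : int -> nat) (T : finType) (X : {set T}) (cl : fzip chK -> T) : Prop :=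
  [/\ forall Z : fzip chK, fzip_type tau Z -> cl Z \in X,
      forall Z Z' : fzip chK, fzip_type tau Z -> fzip_type tau Z' ->
        (cl Z = cl Z' <-> fzip_iso Z Z')
    & forall c : T, c \in X -> exists2 Z : fzip chK, fzip_type tau Z & cl Z = c].

Definition std_fzip_over (p : nat) (p_pr : prime p) (k : fieldType)
    (chk : p \in [pchar k]) (tau : int -> nat) (s : seq int)
    (u : 'S_(sumn (std_ns tau s))) : fzip chk :=
  fzip_bc (Fp_emb chk) chk (std_fzip p_pr u).

(* Main.v *)
Require Import Defs.
From HB Require Import structures.
From mathcomp Require Import all_boot all_order all_fingroup all_algebra.
From mathcomp Require Import zify.
From mathcomp Require Import boolp.

(* Lift phi_i to a Frobenius-linear map psi_i with values in D_i, and for a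
   subspace U let R_i(U) be the set of x in C^i with psi_i x in U + D_(i-1).
   The subspaces obtained from the C^i by applying the R_i form a chain.  Count
   its steps U < U': the R_i map the chain to itself and separate U from U' for
   at least one i, while distinct (step, i) give distinct steps; so exactly one i
   works, and the steps are permuted.  Each step U'/U thus lies in one graded
   piece of D, and the psi_i induce Frobenius-linear bijections between the
   steps, to which Lang's theorem applies: fixed vectors span over k, and lift
   to V because x |-> x - psi x is surjective, also where psi degenerates.  The
   fixed vectors give a basis in which the F-zip is standard.
   Conversely, two standard bases of the same F-zip define two full flags; the
   steps common to both contain the C^i and are stable under the R_i, so by the
   same count each common step lies in one graded piece of D, and the two
   permutations have the same blocks. *)

Set Implicit Arguments.
Unset Strict Implicit.
Unset Printing Implicit Defensive.

Import Order.TTheory GRing.Theory Num.Theory.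

Local Open Scope ring_scope.

(** [R_i(U)] always lies between [C^(i+1)] and [C^i]. Hence steps reached through different [i]
    occupy disjoint ranges of dimensions, and this is what makes the count work. Sending the
    positions of each step to those of its image defines a permutation theta of the positions. In a
    standard basis, listed as [e_(u b)], the vector at position [theta b] is sent to the vector at
    position [b] exactly when [theta b = x (u b)]. So [u] is read off as [x^-1] after theta, and
    minimality of [u] in its coset is the monotonicity of theta on positions with the same [i]. The
    obstacle to applying Lang's theorem is twofold. Since theta permutes the steps, a step need not
    carry an endomorphism of its own; and the vectors wanted must respect the chain and [D]
    simultaneously. The theorem is therefore applied to the space of all families of vectors, one
    for each position, on which the [psi_i] combine into one Frobenius-linear endomorphism. This
    endomorphism is under control only modulo the families lying in the preceding steps, whence a
    relative form of the theorem. *)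

(** * Frobenius-linear maps over an algebraically closed field *)

Section Lang.
Variables (p : nat) (k : closedFieldType) (chk : p \in [pchar k]).

Lemma frobE (a : k) : frob chk a = a ^+ p.
Proof. exact: pFrobenius_autE. Qed.

Lemma frob_surj (a : k) : exists b, frob chk b = a.
Proof.
have [|x /rootP] := closed_rootP ('X^p - a%:P) _.
  by rewrite size_XnsubC ?eqSS -?lt0n prime_gt0 // (pcharf_prime chk).
rewrite !hornerE => /eqP; rewrite subr_eq0 => /eqP xpa.
by exists x; rewrite frobE.
Qed.

(* If Phi^(m+1) a = w + sum_(i <= m) c_i Phi^i a, then t = sum_(i <= m) x_i Phi^i a
   satisfies t - Phi t = e a - y^p w as soon as x_i = (lang_poly e c i).[y] for
   all i and y = x_m.  The last condition has a root y, because lang_poly has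
   derivative 0. *)
Fixpoint lang_poly (e : k) (c : nat -> k) (i : nat) : {poly k} :=
  if i is i'.+1 then lang_poly e c i' ^+ p + c i *: 'X^p
  else e%:P + c 0 *: 'X^p.

Lemma deriv_expp (P : {poly k}) : (P ^+ p)^`() = 0.
Proof.
rewrite deriv_exp -mulr_natl -polyC_natr.
by have /andP[_ /eqP->] := chk; rewrite polyC0 mul0r.
Qed.

Lemma deriv_lang_poly e c i : (lang_poly e c i)^`() = 0.
Proof.
by case: i => [|i] /=; rewrite derivD derivZ !(deriv_expp, derivC) scaler0 addr0.
Qed.

Lemma lang_poly_fix e c i : exists y, (lang_poly e c i).[y] = y.
Proof.
have [|y /rootP] := closed_rootP (lang_poly e c i - 'X) _.
  apply: contraTN isT => /eqP s1.
  have /size_poly1P[a _ E] : size (lang_poly e c i - 'X) == 1%N by rewrite s1.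
  have := congr1 (fun q => q^`()) E.
  rewrite derivB deriv_lang_poly derivX derivC sub0r => /eqP.
  by rewrite oppr_eq0 oner_eq0.
by rewrite !hornerE => /eqP; rewrite subr_eq0 => /eqP; exists y.
Qed.

Lemma size_lang_poly c i j :
  (j <= i)%N -> c j != 0 -> (p < size (lang_poly 0%R c i))%N.
Proof.
have p1 : (1 < p)%N by rewrite prime_gt1 // (pcharf_prime chk).
have p0 : (p == 0%N) = false by rewrite gtn_eqF // ltnW.
have cp : (0 < p)%N by rewrite ltnW.
have sX (a : k) : (size (a *: 'X^p) <= p.+1)%N.
  by rewrite (leq_trans (size_scale_leq _ _)) // size_polyXn.
have sX' (a : k) : a != 0 -> (p < size (a *: 'X^p))%N.
  by move=> a0; rewrite size_scale ?size_polyXn.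
elim: i j => [|i IH] j /=.
  by rewrite leqn0 => /eqP-> c0; rewrite polyC0 add0r sX'.
have [[l li cl]|no] := pselect (exists2 l, (l <= i)%N & c l != 0); last first.
  move=> ji cj; have zero l : (l <= i)%N -> c l = 0.
    by move=> li; apply/eqP/negP => /negP cl; apply: no; exists l.
  have -> : lang_poly 0 c i = 0.
    elim: i zero {no IH ji} => [|i IH] z /=.
      by rewrite z // scale0r addr0.
    rewrite IH => [|l li]; last by rewrite z // ltnW.
    by rewrite z // scale0r expr0n p0 addr0.
  rewrite expr0n p0 add0r sX' //.
  suff -> : i.+1 = j by [].
  move: ji; rewrite leq_eqVlt => /orP[/eqP//|/zero cj0].
  by rewrite cj0 eqxx in cj.
move=> _ _.
have {li cl}IH := IH l li cl.
have sE := size_exp (lang_poly 0%R c i) p.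
have sE' : (p.+1 < size (lang_poly 0%R c i ^+ p))%N.
  rewrite -ltn_predRL sE; apply: (@leq_trans (p * p)).
    by rewrite -{1}[p]muln1 ltn_mul2l cp.
  by rewrite leq_mul2r -ltnS (leq_trans IH) ?orbT // leqSpred.
by rewrite size_polyDl; [apply: ltnW | apply: leq_ltn_trans (sX _) _].
Qed.

(** For [e = 0] the point 0 is fixed, and another fixed point is wanted. Write the polynomial as
    ['X * G]. Then [G.[0] = 0], being the value at 0 of the vanishing derivative, so every root of
    [G - 1] is a nonzero fixed point. Such a root exists because the degree is at least [p > 1], so
    that [G] is not constant. *)
Lemma lang_poly_fix_neq0 c i j : (j <= i)%N -> c j != 0 ->
  exists2 y, y != 0 & (lang_poly 0%R c i).[y] = y.
Proof.
move=> ji cj; have sP := size_lang_poly ji cj.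
have p1 : (1 < p)%N by rewrite prime_gt1 // (pcharf_prime chk).
have Xp : 'X^p = 'X * 'X^(p.-1) :> {poly k} by rewrite -exprS prednK // ltnW.
have [G EG] : exists G, lang_poly 0%R c i = 'X * G.
  elim: (i) => [|l [G EG]] /=.
    by exists (c 0 *: 'X^(p.-1)); rewrite polyC0 add0r Xp scalerAr.
  exists ('X^(p.-1) * G ^+ p + c l.+1 *: 'X^(p.-1)).
  by rewrite EG exprMn Xp mulrDr mulrA scalerAr.
have G0 : G.[0] = 0.
  have := congr1 (fun q => q^`().[0]) EG.
  by rewrite deriv_lang_poly derivM derivX !hornerE.
have sG : size G != 1%N.
  apply: contraTneq sP => sG; rewrite -leqNgt EG.
  by rewrite (leq_trans (size_polyMleq _ _)) // size_polyX sG.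
have [|y /rootP] := closed_rootP (G - 1) _.
  apply: contraNneq sG => s1.
  have /size_poly1P[a a0 E] : size (G - 1) == 1%N by rewrite s1.
  have Ga : G = (a + 1)%:P by rewrite polyCD -E polyC1 subrK.
  have := G0; rewrite Ga hornerC => a10; rewrite a10 polyC0 in Ga.
  by move: sP; rewrite EG Ga mulr0 size_poly0.
rewrite !hornerE => /eqP; rewrite subr_eq0 => /eqP Gy.
exists y; last by rewrite EG !hornerE Gy mulr1.
by apply: contra_eqN Gy => /eqP ->; rewrite G0 eq_sym oner_eq0.
Qed.

Section SeqSpan.
Variables (W : vectType k) (f : nat -> W).

Lemma span_mkseqP m w :
  reflect (exists c : nat -> k, w = \sum_(i < m) c i *: f i)
          (w \in <<mkseq f m>>%VS).
Proof.
apply: (iffP idP) => [|[c ->]]; last first.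
  apply: memv_suml => i _; apply/memvZ/memv_span/mapP.
  by exists (i : nat) => //; rewrite mem_iota add0n ltn_ord.
pose X := map_tuple f (iota_tuple m 0).
move=> /(coord_span (X := X)) ->.
exists (fun i => oapp (fun j => coord X j w) 0 (insub i)).
by apply: eq_bigr => i _; rewrite valK /= nth_mkseq.
Qed.

Lemma seq_dependent : exists m, f m \in <<mkseq f m>>%VS.
Proof.
apply: contrapT => no.
have fr m : free (mkseq f m).
  elim: m => [|m IH]; first exact: nil_free.
  rewrite mkseqS (perm_free (Y := f m :: mkseq f m)) ?perm_rcons //.
  by rewrite free_cons IH andbT; apply/negP => h; apply: no; exists m.
have := dimvS (subvf <<mkseq f (\dim {:W}).+1>>).
by rewrite (eqP (fr _)) size_mkseq ltnn.
Qed.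

End SeqSpan.

Section Semilinear.
Variables (W : vectType k) (Phi : W -> W).
Hypothesis Phi_lin : semilinear_along (frob chk) Phi.

Lemma lang_poly_comb e (c : nat -> k) m a w y :
    iter m.+1 Phi a = w + \sum_(i < m.+1) c i *: iter i Phi a ->
    (lang_poly e c m).[y] = y ->
  let t := \sum_(i < m.+1) (lang_poly e c i).[y] *: iter i Phi a in
  t - Phi t = e *: a - y ^+ p *: w.
Proof.
move=> Ea Ey t; have -> : Phi t = \sum_(i < m) (lang_poly e c i).[y] ^+ p *: iter i.+1 Phi a
    + y ^+ p *: (w + \sum_(i < m.+1) c i *: iter i Phi a).
  rewrite /t (semilin_sum _ _ _ Phi_lin) big_ord_recr /= -Ea Ey.
  by rewrite frobE; congr (_ + _); apply: eq_bigr => i _; rewrite frobE.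
rewrite /t big_ord_recl [in RHS]addrC scalerDr [\sum_(i < m.+1) c i *: _]big_ord_recl.
rewrite /= scalerDr !hornerE scalerDl !scalerA [c 0 * _]mulrC scaler_sumr.
set A := \sum_(i < m) _; set B := \sum_(i < m) (_ *: _); set C := \sum_(i < m) (_ *: _).
have -> : A = B + C.
  rewrite -big_split; apply: eq_bigr => i _ /=.
  by rewrite hornerD horner_exp hornerZ hornerXn scalerDl scalerA [c _ * _]mulrC.
apply/eqP; rewrite subr_eq [B + _]addrC !addrA [- _ + _]addrC.
by rewrite [_ - _ + B]addrAC subrK [_ + B + _]addrAC [_ + B + C]addrAC.
Qed.

(** This is [lang_poly_comb] with [e = 1] and [w = 0], applied to a linear relation among the
    iterates of [a]. *)
Lemma lang_additive (S : {vspace W}) a :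
  (forall x, x \in S -> Phi x \in S) -> a \in S ->
  exists2 x, x \in S & x - Phi x = a.
Proof.
move=> stS aS; have aiS i : iter i Phi a \in S by elim: i => //= i; apply: stS.
have [[|m] /span_mkseqP[c Ea]] := seq_dependent (fun i => iter i Phi a).
  move: Ea; rewrite big_ord0 /= => ->; exists 0; first exact: mem0v.
  by rewrite (semilin0 Phi_lin) subr0.
have [y Ey] := lang_poly_fix 1 c m.
have := @lang_poly_comb 1 c m a 0 y; rewrite add0r => /(_ Ea Ey) /=.
rewrite scale1r scaler0 subr0 => E; eexists; last exact: E.
by apply: memv_suml => i _; apply: memvZ.
Qed.

(** This is [lang_poly_comb] with [e = 0], at the first iterate that depends on the earlier ones
    modulo [S]; the error [y ^+ p *: s] then lies in [S]. The iterates stay outside [S], so the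
    relation has a nonzero coefficient and [y] can be chosen nonzero. *)
Lemma lang_fixed_mod (X S : {vspace W}) w0 :
  (forall x, x \in X -> Phi x \in X) ->
  (forall x, x \in X -> Phi x \in S -> x \in S) ->
  w0 \in X -> w0 \notin S ->
  exists w, [/\ w \in X, w \notin S & w - Phi w \in S].
Proof.
move=> stX injS w0X w0S.
have aiX i : iter i Phi w0 \in X by elim: i => //= i; apply: stX.
have aiS i : iter i Phi w0 \notin S.
  by elim: i => //= i; apply: contra; apply: injS.
pose Q m := iter m Phi w0 \in (S + <<mkseq (fun i => iter i Phi w0) m>>)%VS.
have exQ : exists m, Q m.
  have [m mP] := seq_dependent (fun i => iter i Phi w0).
  by exists m; apply: (subvP (addvSr _ _)).
case: (ex_minnP exQ) => -[|m] Qm minQ.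
  by move: Qm; rewrite /Q span_nil addv0 (negbTE (aiS 0)).
have /memv_addP[s sS [t /span_mkseqP[c Et] Ew]] := Qm; rewrite {}Et in Ew.
have [j cj] : exists j : 'I_m.+1, c j != 0.
  apply/existsP; apply: contraT; rewrite negb_exists => /forallP c0.
  move: (aiS m.+1); rewrite Ew big1 ?addr0 ?sS // => i _.
  by have := c0 i; rewrite negbK => /eqP->; rewrite scale0r.
have [y y0 Ey] := lang_poly_fix_neq0 (ltn_ord j : (j <= m)%N) cj.
have /= E := lang_poly_comb Ew Ey.
exists (\sum_(i < m.+1) (lang_poly 0 c i).[y] *: iter i Phi w0).
split; last first.
- by rewrite E scale0r sub0r memvN memvZ.
(* The last coefficient is [y != 0], so a combination lying in [S] would make the iterate of index
   [m] dependent already, against the minimality of [m.+1]. *)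
- apply/negP; rewrite big_ord_recr /= Ey => tS.
  suff : Q m by move/minQ; rewrite ltnn.
  set A := \sum_(i < m) _ in tS.
  rewrite /Q; have -> : iter m Phi w0 = y^-1 *: ((A + y *: iter m Phi w0) - A).
    by rewrite addrC addKr scalerA mulVf // scale1r.
  apply/memvZ/memv_add; rewrite ?memvN //.
  by apply/span_mkseqP; exists (fun i => (lang_poly 0 c i).[y]).
- by apply: memv_suml => i _; apply: memvZ.
Qed.

(* Lang's theorem: modulo [K], on which [Phi] may degenerate, [X] is spanned by
   vectors fixed by [Phi]. *)
Lemma lang_fixed_span (X K N : {vspace W}) :
  (K <= X)%VS -> (K <= N)%VS ->
  (forall x, x \in X -> Phi x \in X) -> (forall x, x \in K -> Phi x \in K) ->
  (forall x, x \in X -> Phi x \in K -> x \in K) ->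
  (forall x, x \in X -> Phi x = x -> x \in N) -> (X <= N)%VS.
Proof.
move=> KX KN stX + + fixN.
elim: {K}_.+1 {-2}K (ltnSn (\dim X - \dim K)) KX KN => // d IH S dS SX SN stS injS.
have [XS|/subvPn[w0 w0X w0S]] := boolP (X <= S)%VS; first exact: subv_trans SN.
have [w [wX wS]] := lang_fixed_mod stX injS w0X w0S.
(* The vector [w] is fixed only modulo [S]; subtracting the solution [x] in [S] of
   [x - Phi x = w - Phi w] makes it fixed exactly. The line of [w - x] then enlarges [S]. *)
move=> /(lang_additive stS)[x xS Ex].
have xX := subvP SX x xS.
have fz : Phi (w - x) = w - x.
  rewrite (semilinB _ _ Phi_lin); apply/eqP; rewrite eq_sym -subr_eq0.
  by rewrite opprB [_ - Phi w]addrC addrACA -Ex [- x + _]addrC addrA subrK subrr.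
have zX : w - x \in X by rewrite rpredB.
have zS : w - x \notin S.
  by apply: contra wS => h; rewrite -(subrK x w) rpredD.
have SX' : (S + <[w - x]> <= X)%VS by rewrite subv_add SX -memvE.
have dSS' : (\dim S < \dim (S + <[w - x]>))%N.
  by rewrite (ltn_leqif (dimv_leqif_sup (addvSl _ _))) subv_add subvv -memvE.
apply: (IH (S + <[w - x]>)%VS); rewrite ?subv_add ?SN ?SX -?memvE ?fixN //.
- by move: dS dSS' (dimvS SX'); clear; lia.
- move=> _ /memv_addP[t tS [_ /vlineP[c ->] ->]].
  rewrite (semilinD _ _ Phi_lin) (semilinZ _ _ Phi_lin) fz.
  by rewrite memv_add ?stS // memvZ // memv_line.
- move=> v vX /memv_addP[t tS [_ /vlineP[c ->] Ev]].
  (* Subtracting the fixed vector with coefficient a [p]-th root of [c] cancels its component in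
     [Phi v], which reduces to the old [S]. *)
  have [b Eb] := frob_surj c.
  rewrite -(subrK (b *: (w - x)) v) memv_add ?memvZ ?memv_line //.
  apply: injS; first by rewrite rpredB ?memvZ.
  by rewrite (semilinB _ _ Phi_lin) (semilinZ _ _ Phi_lin) fz Ev Eb addrK.
Qed.


End Semilinear.

(** [Psi] induces a Frobenius-linear bijection from [X / X0] to [Y / Y0]. Images of a basis of a
    complement of [X0] span [Y] modulo [Y0]. Preimages of a basis of a complement of [Y0] span [X]
    modulo [X0], with [p]-th roots of the coefficients. *)
Lemma semilinear_dim (W W' : vectType k) (Psi : W -> W')
    (X X0 : {vspace W}) (Y Y0 : {vspace W'}) :
  semilinear_along (frob chk) Psi -> (X0 <= X)%VS -> (Y0 <= Y)%VS ->
  (forall x, x \in X -> Psi x \in Y) ->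
  (forall x, x \in X -> (Psi x \in Y0) = (x \in X0)) ->
  (forall y, y \in Y -> exists2 x, x \in X & Psi x - y \in Y0) ->
  (\dim X + \dim Y0 = \dim Y + \dim X0)%N.
Proof.
move=> Plin X0X Y0Y XY XY0 surj.
have eX := dimv_cap_compl X X0; have eY := dimv_cap_compl Y Y0.
rewrite (capv_idPr X0X) in eX; rewrite (capv_idPr Y0Y) in eY.
suff [leY leX] : (\dim Y <= \dim (X :\: X0) + \dim Y0)%N /\
    (\dim X <= \dim (Y :\: Y0) + \dim X0)%N by move: eX eY leY leX; clear; lia.
have dec (V : vectType k) (U U0 : {vspace V}) (v : V) : v \in U ->
    exists c : 'I_(\dim (U :\: U0)) -> k,
      v - \sum_i c i *: (vbasis (U :\: U0))`_i \in U0.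
  move=> vU; have : v \in (U :\: U0 + U :&: U0)%VS by rewrite addv_diff_cap.
  case/memv_addP => v1 /coord_vbasis E1 [v0 /memv_capP[_ v0U] ->].
  exists (fun i => coord (vbasis (U :\: U0)) i v1).
  by rewrite -E1 addrC addKr.
split.
- pose T := [seq Psi x | x <- vbasis (X :\: X0)].
  apply: (@leq_trans (\dim (<<T>> + Y0))); last first.
    apply: leq_trans (dimv_add_leqif _ _) _; rewrite leq_add2r.
    by rewrite (leq_trans (dim_span _)) // size_map size_tuple.
  apply: dimvS; apply/subvP => y yY; have [x xX xy] := surj y yY.
  have [c cx] := dec _ _ X0 x xX.
  set x1 := \sum_i _ in cx.
  have x1X : x1 \in X by rewrite -[x1](subKr x) rpredB // (subvP X0X).
  rewrite -XY0 ?rpredB // in cx.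
  rewrite (semilinB _ _ Plin) in cx.
  have -> : y = Psi x1 + (Psi x - Psi x1 - (Psi x - y)).
    by rewrite opprB addrA [Psi x1 + _]addrC subrK addrC subrK.
  apply: memv_add; last exact: rpredB.
  rewrite /x1 (semilin_sum _ _ _ Plin).
  apply: memv_suml => i _; apply/memvZ/memv_span/map_f/mem_nth.
  by rewrite size_tuple.
- have /choice[g gP] : forall y, exists x, y \in Y -> x \in X /\ Psi x - y \in Y0.
    move=> y; have [/surj[x xX xy]|yY] := boolP (y \in Y); last by exists 0.
    by exists x.
  pose T := [seq g y | y <- vbasis (Y :\: Y0)].
  apply: (@leq_trans (\dim (<<T>> + X0))); last first.
    apply: leq_trans (dimv_add_leqif _ _) _; rewrite leq_add2r.
    by rewrite (leq_trans (dim_span _)) // size_map size_tuple.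
  apply: dimvS; apply/subvP => x xX.
  have [c cy] := dec _ _ Y0 _ (XY x xX).
  have /choice[b Eb] : forall i, exists b, frob chk b = c i by move=> i; apply: frob_surj.
  pose e i := (vbasis (Y :\: Y0))`_i.
  have eiY (i : 'I_(\dim (Y :\: Y0))) : e i \in Y.
    by apply: (subvP (diffvSl Y Y0)); apply/vbasis_mem/mem_nth; rewrite size_tuple.
  pose x1 := \sum_(i < \dim (Y :\: Y0)) b i *: g (e i).
  have x1X : x1 \in X by apply: memv_suml => i _; apply: memvZ; case: (gP (e i)).
  rewrite -[x](subrK x1) addrC memv_add //.
    apply: memv_suml => i _; apply/memvZ/memv_span/map_f/mem_nth.
    by rewrite size_tuple.
  rewrite -XY0 ?rpredB // (semilinB _ _ Plin).
  rewrite /x1 (semilin_sum _ _ _ Plin).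
  rewrite -[Psi x](subrK (\sum_i c i *: (vbasis (Y :\: Y0))`_i)) -addrA.
  rewrite rpredD // -sumrB; apply: memv_suml => i _.
  rewrite Eb -scalerBr -opprB memvZ // memvN.
  by case: (gP (e i)).
Qed.

End Lang.

(** A subspace inside [P] is enlarged by a vector of [P] until it is all of [P]. This yields
    subspaces cut out by conditions such as semilinear ones, which are not kernels of linear
    maps. *)
Lemma vspace_comprehension (K : fieldType) (W : vectType K) (P : W -> Prop) :
  P 0 -> (forall a x y, P x -> P y -> P (a *: x + y)) ->
  exists U : {vspace W}, forall x, x \in U <-> P x.
Proof.
move=> P0 Plin.
have : exists U : {vspace W}, forall x, x \in U -> P x.
  by exists 0%VS => x; rewrite memv0 => /eqP->.
case=> U; elim: _.+1 {-2}U (ltnSn (\dim {:W} - \dim U)) => // d IH {}U dU UP.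
have [|no] := pselect (forall x, P x -> x \in U); first by exists U => x; split; auto.
have [x xP xU] : exists2 x, P x & x \notin U.
  apply: contrapT => h; apply: no => x xP; apply: contrapT => /negP xU.
  by apply: h; exists x.
apply: (IH (U + <[x]>)%VS).
  have : (\dim U < \dim (U + <[x]>))%N.
    by rewrite (ltn_leqif (dimv_leqif_sup (addvSl _ _))) subv_add subvv -memvE.
  by move: dU (dimvS (subvf (U + <[x]>)%VS)); clear; lia.
by move=> _ /memv_addP[u uU [_ /vlineP[a ->] ->]]; rewrite addrC; apply: Plin; auto.
Qed.

Lemma int_ind_up (P : int -> Prop) (a : int) :
  (forall i, i <= a -> P i) -> (forall i, P (i - 1) -> P i) -> forall i, P i.
Proof.
move=> Pa Pi i; have [/Pa//|ai] := lerP i a.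
have -> : i = a + `|i - a|%N by lia.
elim: `|i - a|%N => [|l IH]; first by apply: Pa; rewrite addr0.
by apply: Pi; rewrite (_ : a + l.+1 - 1 = a + l) //; lia.
Qed.

(** * The lifts [psi_i] and the operators [R_i] *)

Section FZipMaps.
Variables (p : nat) (k : closedFieldType) (chk : p \in [pchar k]).
Variable Z : fzip chk.
Local Notation C := (fz_C Z).
Local Notation D := (fz_D Z).

(** The lift takes values in the chosen complement of [D (i - 1)] in [D i]. Only its class modulo
    [D (i - 1)], and only for [x] in [C i], has a meaning independent of choices. *)
Definition fz_psi (i : int) (x : Z) : Z :=
  vsval (fz_phi Z i (pbu (frob chk) (qpr (C i) (C (i + 1)) x))).

Lemma fz_psi_lin i : semilinear_along (frob chk) (fz_psi i).
Proof. by move=> c x y; rewrite /fz_psi linearP pbu_semilinear linearP. Qed.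

Lemma fz_psi_mem i x : fz_psi i x \in D i.
Proof. exact: quot_mem. Qed.

Lemma fz_C_anti (i j : int) : i <= j -> (C j <= C i)%VS.
Proof.
move=> ij; have -> : j = i + `|j - i|%N by lia.
elim: `|j - i|%N => [|l IH]; first by rewrite addr0.
apply: subv_trans IH; have := fz_C_desc Z (i + l.+1).
by rewrite (_ : i + l.+1 - 1 = i + l) //; lia.
Qed.

Lemma fz_D_mono (i j : int) : i <= j -> (D i <= D j)%VS.
Proof.
move=> ij; have -> : j = i + `|j - i|%N by lia.
elim: `|j - i|%N => [|l IH]; first by rewrite addr0.
apply: (subv_trans IH); have := fz_D_asc Z (i + l.+1).
by rewrite (_ : i + l.+1 - 1 = i + l) //; lia.
Qed.

Lemma pbu_eq0 (M : vectType k) (x : M) : (pbu (frob chk) x == 0) = (x == 0).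
Proof.
apply/eqP/eqP => [x0|->]; last exact: (semilin0 (@pbu_semilinear _ _ _ M)).
rewrite [x]std_vec_sum big1 // => i _.
have /eqP := congr1 (fun a : 'rV_(\dim {: M}) => a 0 i) x0.
by rewrite !mxE fmorph_eq0 => /eqP->; rewrite scale0r.
Qed.

Lemma fz_psi_ker i x : x \in C i -> (fz_psi i x \in D (i - 1)) = (x \in C (i + 1)).
Proof.
move=> xC; have /andP[k0 _] := fz_phi_iso Z i.
rewrite -(@qpr_eq0 _ _ (D i)) ?fz_psi_mem // /fz_psi qprK.
by rewrite -[RHS](@qpr_eq0 _ _ (C i)) // -[RHS]pbu_eq0 -memv_ker (eqP k0) memv0.
Qed.

(** Since [k] is perfect, every element of the pull-back is a pure tensor. Surjectivity of [phi_i]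
    can therefore be expressed by vectors. *)
Lemma pbu_surj (M : vectType k) (a : pullback (frob chk) M) :
  exists x : M, pbu (frob chk) x = a.
Proof.
have /choice[b Eb] : forall i, exists b, frob chk b = (a : 'rV_(\dim {: M})) 0 i.
  by move=> i; apply: frob_surj.
exists (\sum_i b i *: std_vec i).
rewrite (semilin_sum _ _ _ (@pbu_semilinear _ _ _ M)) [RHS]pbu_sum.
by apply: eq_bigr => i _; rewrite Eb.
Qed.

Lemma fz_psi_surj i y : y \in D i ->
  exists2 x, x \in C i & fz_psi i x - y \in D (i - 1).
Proof.
move=> yD; have /andP[_ /eqP s1] := fz_phi_iso Z i.
have : qpr (D i) (D (i - 1)) y \in limg (fz_phi Z i) by rewrite s1 memvf.
case/memv_imgP => a _ Ea; have [z Ez] := pbu_surj a.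
have [x xC Ex] := qpr_surj z.
exists x => //; rewrite /fz_psi Ex Ez -Ea -opprB memvN.
exact: qpr_subK.
Qed.

(* R_i(U): phi_i identifies its image in gr^i_C with the image of U in gr_i^D. *)
Lemma fz_pull_exists i (U : {vspace Z}) :
  exists U' : {vspace Z}, forall x,
    x \in U' <-> (x \in C i) && (fz_psi i x \in (U + D (i - 1))%VS).
Proof.
apply: vspace_comprehension => [|a x y /andP[xC xU] /andP[yC yU]].
  by rewrite mem0v (semilin0 (@fz_psi_lin i)) mem0v.
by rewrite fz_psi_lin !memvD ?memvZ.
Qed.

Definition fz_pull i U := sval (cid (fz_pull_exists i U)).

Lemma fz_pullP i U x :
  (x \in fz_pull i U) = (x \in C i) && (fz_psi i x \in (U + D (i - 1))%VS).
Proof.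
rewrite /fz_pull; case: cid => U' /= h.
by apply/idP/idP => /h.
Qed.

Lemma fz_pull_mono i U U' : (U <= U')%VS -> (fz_pull i U <= fz_pull i U')%VS.
Proof.
move=> UU'; apply/subvP => x; rewrite !fz_pullP => /andP[-> /=].
by apply: subvP; apply: addvS.
Qed.

Lemma fz_pull_le i U : (fz_pull i U <= C i)%VS.
Proof. by apply/subvP => x; rewrite fz_pullP => /andP[]. Qed.

Lemma fz_pull_ge i U : (C (i + 1) <= fz_pull i U)%VS.
Proof.
apply/subvP => x xC; have xC' : x \in C i.
  by apply: (subvP (fz_C_anti _)) xC; rewrite lerDl.
by rewrite fz_pullP xC' (subvP (addvSr _ _)) // fz_psi_ker.
Qed.

(** A preimage [z] of [x] under [psi_i] lies in [R_i(U')], hence in [R_i(U)], so [x] agrees with a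
    vector of [U] modulo [D (i - 1)]. In other words, [U] and [U'] have the same image in
    [gr_i^D]. *)
Lemma fz_pull_nojump i U U' x : (U <= U')%VS -> (fz_pull i U' <= fz_pull i U)%VS ->
  x \in U' -> x \in D i -> x \in (U + U' :&: D (i - 1))%VS.
Proof.
move=> UU' /subvP le xU' xD; have [z zC zx] := fz_psi_surj xD.
have : z \in fz_pull i U.
  apply: le; rewrite fz_pullP zC -(subrK x (fz_psi i z)) addrC.
  by rewrite memv_add.
rewrite fz_pullP zC /= => /memv_addP[u uU [d dD E]].
have {}dD : x - u \in D (i - 1).
  have -> : x - u = d - (fz_psi i z - x) by rewrite E opprB addrCA opprD [d + _]addrC subrK.
  by rewrite rpredB.
rewrite -(subrK u x) addrC memv_add // memv_cap dD andbT rpredB //.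
exact: (subvP UU').
Qed.

(** If no [R_i] separated the two, induction along [D] would push each [U' :&: D i] into [U], and
    [D] exhausts the module. *)
Lemma fz_pull_jump U U' : (U <= U')%VS -> ~~ (U' <= U)%VS ->
  exists i, ~~ (fz_pull i U' <= fz_pull i U)%VS.
Proof.
move=> UU' /negP UU; apply: contrapT => no; apply: UU.
have le i : (fz_pull i U' <= fz_pull i U)%VS.
  by apply: contrapT => h; apply: no; exists i; apply/negP.
suff h i : (U' :&: D i <= U)%VS.
  by have [b hb] := fz_D_full Z; have := h b; rewrite hb // capvf.
have [a ha] := fz_D_zero Z; move: i; apply: (@int_ind_up _ a) => i.
  by move/ha->; rewrite capv0 sub0v.
move=> IH; apply/subvP => x /memv_capP[xU xD].
have /memv_addP[u uU [d dD ->]] := fz_pull_nojump UU' (le i) xU xD.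
by rewrite memvD // (subvP IH).
Qed.

(** [U' / U] is carried by [gr_i^D] alone: the induction along [D] meets no obstruction below [i],
    which gives the first claim, and none above [i], which gives the second. *)
Lemma fz_pull_single i U U' : (U <= U')%VS ->
  (forall j, ~~ (fz_pull j U' <= fz_pull j U)%VS -> j = i) ->
  (U' :&: D (i - 1) <= U)%VS /\ (U' <= U + U' :&: D i)%VS.
Proof.
move=> UU' uniq; have le j : j != i -> (fz_pull j U' <= fz_pull j U)%VS.
  by apply: contraNT => /uniq->.
split.
  suff h j : j < i -> (U' :&: D j <= U)%VS by apply: h; lia.
  have [a ha] := fz_D_zero Z; move: j; apply: (@int_ind_up _ a) => j.
    by move/ha->; rewrite capv0 sub0v.
  move=> IH ji; apply/subvP => x /memv_capP[xU xD].
  have [|u uU [d dD ->]] := memv_addP (fz_pull_nojump UU' (le j _) xU xD); first lia.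
  rewrite memvD // (subvP (IH _)) //; lia.
suff h j : (U' :&: D j <= U + U' :&: D i)%VS.
  by have [b hb] := fz_D_full Z; have := h b; rewrite hb // capvf.
move: j; apply: (@int_ind_up _ i) => [j ji|j IH].
  by apply: subv_trans (addvSr _ _); apply/capvS/fz_D_mono.
have [ji|ij] := lerP j i.
  by apply: subv_trans (addvSr _ _); apply/capvS/fz_D_mono.
apply/subvP => x /memv_capP[xU xD].
have [|u uU [d dD ->]] := memv_addP (fz_pull_nojump UU' (le j _) xU xD); first lia.
by apply: memvD; [exact: (subvP (addvSl _ _)) | exact: (subvP IH)].
Qed.

(** [psi_i x] lies only in [U' + D (i - 1)]; projecting along [D (i - 1)] moves it into
    [U' :&: D i]. As [U' :&: D (i - 1)] lies in [U], this gives a well-defined injection of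
    [R_i(U') / R_i(U)] into [U' / U]. *)
Lemma fz_pull_proj i U U' x : (U <= U')%VS -> (U' :&: D (i - 1) <= U)%VS ->
  x \in fz_pull i U' ->
  let y := addv_pi1 (U' :&: D i) (D (i - 1)) (fz_psi i x) in
  [/\ y \in U', y \in D i, fz_psi i x - y \in D (i - 1)
    & (y \in U) = (x \in fz_pull i U)].
Proof.
move=> UU' lowU xU' y; have xC := subvP (fz_pull_le i U') x xU'.
move: xU'; rewrite !fz_pullP xC /= => xU.
have /memv_capP[yU' yD] : y \in (U' :&: D i)%VS by apply: memv_pi1.
have xy : fz_psi i x - y \in D (i - 1).
  rewrite /y.
  have /addv_pi1_pi2 {1}<- : fz_psi i x \in (U' :&: D i + D (i - 1))%VS.
    rewrite capvC vspace_modr ?memv_cap ?fz_psi_mem //.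
    by apply: fz_D_mono; lia.
  by rewrite addrC addKr memv_pi2.
split=> //; apply/idP/idP => [yU|/memv_addP[u uU [d dD E]]].
  by rewrite -(subrK y (fz_psi i x)) addrC memv_add.
rewrite -(subrK u y); apply: memvD => //; apply: (subvP lowU).
rewrite memv_cap rpredB //=; last exact: (subvP UU').
have -> : y - u = d - (fz_psi i x - y).
  by rewrite E opprB addrCA opprD [d + _]addrC subrK.
by rewrite rpredB.
Qed.

Lemma fz_pull_dim i U U' : (U <= U')%VS ->
  (U' :&: D (i - 1) <= U)%VS -> (U' <= U + U' :&: D i)%VS ->
  (\dim (fz_pull i U') + \dim U = \dim U' + \dim (fz_pull i U))%N.
Proof.
move=> UU' lowU upU.
pose pr := addv_pi1 (U' :&: D i) (D (i - 1)).
apply: (@semilinear_dim p k chk _ _ (fun x => pr (fz_psi i x))) => //.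
- by move=> c x y; rewrite fz_psi_lin linearP.
- exact: fz_pull_mono.
- by move=> x /(fz_pull_proj UU' lowU)[].
- by move=> x /(fz_pull_proj UU' lowU)[].
- move=> y yU'; have /memv_addP[u uU [y' /memv_capP[y'U y'D] ->]] := subvP upU y yU'.
  have [x xC xy] := fz_psi_surj y'D.
  have xU' : x \in fz_pull i U'.
    by rewrite fz_pullP xC -(subrK y' (fz_psi i x)) addrC memv_add.
  exists x => //; have [h1 h2 h3 _] := fz_pull_proj UU' lowU xU'.
  have -> : pr (fz_psi i x) - (u + y') = pr (fz_psi i x) - y' - u.
    by rewrite opprD addrA addrAC.
  apply: memvB => //; apply: (subvP lowU); rewrite memv_cap rpredB //=.
  rewrite -[X in X - y'](subrK (fz_psi i x)) -addrA memvD //.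
  by rewrite -opprB memvN.
Qed.

End FZipMaps.

(** * Chains stable under the [R_i] and the permutation of their steps *)

Section StableChain.
Variables (p : nat) (k : closedFieldType) (chk : p \in [pchar k]).
Variable Z : fzip chk.
Local Notation C := (fz_C Z).
Local Notation D := (fz_D Z).
Local Notation N := (\dim {: Z}).
Local Notation pull := (@fz_pull p k chk Z).

(** These are the only properties the count uses. Keeping [L] abstract lets the same results serve
    the canonical chain and the chain of common steps of two flags. *)
Definition stable_chain (L : {vspace Z} -> Prop) : Prop :=
  [/\ forall U U', L U -> L U' -> (U <= U')%VS \/ (U' <= U)%VS,
      forall i, L (C i)
    & forall i U, L U -> L (pull i U)].

Inductive canonical_chain : {vspace Z} -> Prop :=
  | CanonicalC i : canonical_chain (C i)
  | CanonicalPull i U : canonical_chain U -> canonical_chain (pull i U).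

(** For different indices the inclusions [C (i + 1) <= R_i(U) <= C i] decide the comparison; for
    equal indices monotonicity of [R_i] reduces it to shorter words in the operators. *)
Lemma canonical_chainP : stable_chain canonical_chain.
Proof.
split=> [U U' LU LU'||]; [|exact: CanonicalC|exact: CanonicalPull].
have CC i j : (C i <= C j)%VS \/ (C j <= C i)%VS.
  by case: (lerP i j) => [|/ltW] /(fz_C_anti Z); auto.
have Cpull i j V : (C i <= pull j V)%VS \/ (pull j V <= C i)%VS.
  have [ij|ji] := lerP i j; [right|left].
    exact: subv_trans (fz_pull_le j V) (fz_C_anti Z ij).
  by apply: subv_trans (fz_pull_ge j V); apply: fz_C_anti; lia.
elim: LU U' LU' => [i|i {}U _ IH] U' [j|j V LV]; [exact: CC|exact: Cpull| |].
  by case: (Cpull j i U); auto.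
have [->|] := eqVneq i j.
  by case: (IH V LV) => /(fz_pull_mono j); auto.
rewrite neq_lt => /orP[] ij; [right|left].
  apply: subv_trans (fz_pull_le j V) _; apply: subv_trans (fz_pull_ge i U).
  by apply: fz_C_anti; lia.
apply: subv_trans (fz_pull_le i U) _; apply: subv_trans (fz_pull_ge j V).
by apply: fz_C_anti; lia.
Qed.

Variable L : {vspace Z} -> Prop.
Hypothesis Lstable : stable_chain L.

Let Lchain U U' : L U -> L U' -> (U <= U')%VS \/ (U' <= U)%VS.
Proof. by case: Lstable => + _ _; apply. Qed.
Let LC i : L (C i). Proof. by case: Lstable. Qed.
Let Lpull i U : L U -> L (pull i U). Proof. by case: Lstable => _ _; apply. Qed.

(** A member of a chain is determined by its dimension. So [L], a mere predicate on subspaces, is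
    encoded by a finite set of numbers, on which one can count. *)
Definition chain_dim (a : nat) : bool := `[< exists2 U, L U & \dim U = a >].
Local Notation A := chain_dim.

Lemma chain_step_exists : exists E : nat -> {vspace Z},
  forall a, A a -> L (E a) /\ \dim (E a) = a.
Proof.
have /choice[E EP] : forall a, exists U, A a -> L U /\ \dim U = a.
  move=> a; have [[U LU dU]|no] := pselect (exists2 U, L U & \dim U = a).
    by exists U.
  by exists 0%VS => /asboolP.
by exists E.
Qed.

Definition chain_step := sval (cid chain_step_exists).
Local Notation E := chain_step.

Lemma chain_stepP a : A a -> L (E a) /\ \dim (E a) = a.
Proof. by rewrite /E; case: cid => /= E' h /h. Qed.

Lemma chain_dimP U : L U -> A (\dim U).
Proof. by move=> LU; apply/asboolP; exists U. Qed.

Lemma chain_le U U' : L U -> L U' -> (\dim U <= \dim U')%N -> (U <= U')%VS.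
Proof.
move=> LU LU' d; case: (Lchain LU LU') => // U'U.
have : U' == U by rewrite eqEdim U'U d.
by move/eqP->; rewrite subvv.
Qed.

Lemma chain_stepE U : L U -> E (\dim U) = U.
Proof.
move=> LU; have [LE dE] := chain_stepP (chain_dimP LU).
by apply/eqP; rewrite eqEsubv !chain_le // dE.
Qed.

Lemma chain_step_le a b : A a -> A b -> (a <= b)%N -> (E a <= E b)%VS.
Proof.
move=> /chain_stepP[La da] /chain_stepP[Lb db] ab.
by apply: chain_le; rewrite // da db.
Qed.

Lemma chain_dim0 : A 0.
Proof.
have [b hb] := fz_C_zero Z.
by have := chain_dimP (LC b); rewrite hb // dimv0.
Qed.

Lemma chain_dim_full : A N.
Proof. by have [a ha] := fz_C_full Z; have := chain_dimP (LC a); rewrite ha. Qed.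

Lemma chain_dim_le a : A a -> (a <= N)%N.
Proof. by move=> /chain_stepP[_ <-]; apply/dimvS/subvf. Qed.

(* For b < N, the consecutive dimensions of steps with lo b <= b < hi b; the
   positions b in this range make up the piece E (hi b) / E (lo b). *)
Definition chain_lo (b : nat) : nat := \max_(a < b.+1 | A a) a.
Definition chain_hi (b : nat) : nat := find (fun a => A a && (b < a)%N) (iota 0 N.+1).

Local Notation lo := chain_lo.
Local Notation hi := chain_hi.

Lemma chain_loP b : [/\ A (lo b), (lo b <= b)%N & forall a, A a -> (a <= b)%N -> (a <= lo b)%N].
Proof.
rewrite /chain_lo; split.
- have [|a Aa ->//] := @eq_bigmax_cond _ [pred a : 'I_b.+1 | A a] (fun a => val a).
  by apply/card_gt0P; exists ord0; apply: chain_dim0.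
- by apply/bigmax_leqP => a _; rewrite -ltnS.
- by move=> a Aa ab; apply: (@leq_bigmax_cond _ _ _ (Ordinal (ab : (a < b.+1)%N))).
Qed.

Lemma chain_hiP b : (b < N)%N ->
  [/\ A (hi b), (b < hi b)%N & forall a, A a -> (b < a)%N -> (hi b <= a)%N].
Proof.
move=> bN; rewrite /chain_hi; set P := fun a => _.
have hP : has P (iota 0 N.+1).
  by apply/hasP; exists N; rewrite ?mem_iota //= /P chain_dim_full.
have lt : (find P (iota 0 N.+1) < N.+1)%N by rewrite -[X in (_ < X)%N](size_iota 0) -has_find.
have /andP[h1 h2] := nth_find 0%N hP; rewrite nth_iota // add0n in h1 h2.
split=> // a Aa ba; rewrite leqNgt; apply/negP => lta.
have := before_find 0%N lta; rewrite nth_iota; last exact: ltn_trans lt.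
by rewrite add0n /P Aa ba.
Qed.

Lemma chain_lo_unique b a : A a -> (a <= b)%N ->
  (forall a', A a' -> (a' <= b)%N -> (a' <= a)%N) -> lo b = a.
Proof.
move=> Aa ab h; have [A1 l1 m1] := chain_loP b.
by apply/eqP; rewrite eqn_leq h //= m1.
Qed.

Lemma chain_hi_unique b a : A a -> (b < a)%N ->
  (forall a', A a' -> (b < a')%N -> (a <= a')%N) -> hi b = a.
Proof.
move=> Aa ba h; have [|A1 l1 m1] := @chain_hiP b; first exact: leq_trans ba (chain_dim_le Aa).
by apply/eqP; rewrite eqn_leq h // m1.
Qed.

Lemma chain_lo_pred_hi b : (b < N)%N -> lo (hi b).-1 = lo b.
Proof.
move=> bN; have [A1 l1 m1] := chain_hiP bN; have [A2 l2 m2] := chain_loP b.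
apply: chain_lo_unique => //.
  by rewrite -ltnS prednK; [apply: leq_ltn_trans l1 | apply: leq_trans l1].
move=> a Aa ah; apply: m2 => //; rewrite leqNgt; apply/negP => /(m1 _ Aa) h.
have := leq_trans h ah; rewrite -ltnS prednK ?ltnn //; exact: leq_trans l1.
Qed.

(* E (lo a.-1) is the step of the chain that precedes E a. *)
Local Notation jump i a := (~~ (pull i (E a) <= pull i (E (lo a.-1)))%VS).

Lemma chain_jump_dim i a : A a -> (0 < a)%N -> jump i a ->
  [/\ (pull i (E (lo a.-1)) <= pull i (E a))%VS,
      (\dim (C (i + 1)) <= \dim (pull i (E (lo a.-1))))%N,
      (\dim (pull i (E (lo a.-1))) < \dim (pull i (E a)))%N
    & (\dim (pull i (E a)) <= \dim (C i))%N].
Proof.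
move=> Aa a0 ji; have [A1 l1 _] := chain_loP a.-1.
have le : (pull i (E (lo a.-1)) <= pull i (E a))%VS.
  by apply/fz_pull_mono/chain_step_le => //; rewrite (leq_trans l1) // leq_pred.
split=> //; first exact/dimvS/fz_pull_ge.
  by rewrite (ltn_leqif (dimv_leqif_sup le)).
exact/dimvS/fz_pull_le.
Qed.

Lemma chain_jump_exists a : A a -> (0 < a)%N -> exists i, jump i a.
Proof.
move=> Aa a0; have [A1 l1 _] := chain_loP a.-1.
have lta : (lo a.-1 < a)%N by rewrite -[X in (_ < X)%N](prednK a0) ltnS.
apply: fz_pull_jump; first by rewrite chain_step_le // ltnW.
have [[_ d1] [_ d2]] := (chain_stepP A1, chain_stepP Aa).
by apply/negP => /dimvS; rewrite d1 d2 leqNgt lta.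
Qed.

Lemma C_block_unique i j a :
  (\dim (C (i + 1)) <= a < \dim (C i))%N -> (\dim (C (j + 1)) <= a < \dim (C j))%N -> i = j.
Proof.
wlog ij : i j / i < j => [W|/andP[i1 i2] /andP[j1 j2]].
  by case: (ltrgtP i j) => // h h1 h2; [apply: W|apply/esym/W].
have := dimvS (@fz_C_anti _ _ _ Z (i + 1) j _); rewrite leqNgt (leq_ltn_trans i1) //.
by move/(_ _)/negP; case; [lia|].
Qed.

(** If [a < b], the step preceding [E b] contains [E a], so a jump at [b] makes [R_i(E b)] strictly
    larger than [R_i(E a)]. *)
Lemma chain_jump_inj i a b : A a -> A b -> (0 < a)%N -> (0 < b)%N ->
  jump i a -> jump i b -> \dim (pull i (E a)) = \dim (pull i (E b)) -> a = b.
Proof.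
wlog ab : a b / (a < b)%N => [W Aa Ab a0 b0 ja jb e|].
  by case: (ltngtP a b) => // h; [apply: W|apply/esym/W].
move=> Aa Ab a0 b0 ja /negP jb e; case: jb; have [A1 _ m1] := chain_loP b.-1.
have ab' : (a <= lo b.-1)%N by apply: m1; rewrite // -ltnS prednK.
have [La _] := chain_stepP Aa; have [Lb _] := chain_stepP Ab.
apply: subv_trans (fz_pull_mono i (chain_step_le Aa A1 ab')).
by apply: chain_le; try exact: Lpull; rewrite e.
Qed.

(* The map a |-> dim (pull (w a) (E a)), for any choice of a jump w a, is injective
   on the positive dimensions of the chain, hence bijective; a second jump at a
   would give a value already taken. *)
Lemma chain_jump : exists w : nat -> int,
  forall a, A a -> (0 < a)%N ->
  [/\ jump (w a) a, forall i, jump i a -> i = w a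
    & forall a', A a' ->
        ~~ (\dim (pull (w a) (E (lo a.-1))) < a' < \dim (pull (w a) (E a)))%N].
Proof.
have /choice[w wP] : forall a, exists i, A a -> (0 < a)%N -> jump i a.
  move=> a; have [Aa|] := boolP (A a); last by exists 0.
  by have [/(chain_jump_exists Aa)[i ji]|] := boolP (0 < a)%N; [exists i|exists 0].
exists w.
pose S := [set a : 'I_N.+1 | A a && (0 < a)%N].
pose g (a : 'I_N.+1) : 'I_N.+1 := inord (\dim (pull (w a) (E a))).
have gE a : g a = \dim (pull (w a) (E a)) :> nat by rewrite inordK // ltnS; apply/dimvS/subvf.
have gS a : a \in S -> g a \in S.
  rewrite !inE gE => /andP[Aa a0]; have [La _] := chain_stepP Aa.
  rewrite chain_dimP ?(leq_ltn_trans (leq0n _) _) //; last exact: Lpull.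
  by have [_ _ lt _] := chain_jump_dim Aa a0 (wP _ Aa a0); apply: leq_ltn_trans lt.
(* The predecessor appears because the dimension at the top of a jump lies in the interval from
   [\dim (C (i + 1))] excluded to [\dim (C i)] included, whereas [C_block_unique] uses intervals
   closed below and open above. *)
have block i (a : nat) : A a -> (0 < a)%N -> jump i a ->
    (\dim (C (i + 1)) <= (\dim (pull i (E a))).-1 < \dim (C i))%N.
  move=> Aa a0 /(chain_jump_dim Aa a0)[_ h1 h2 h3].
  by move: h1 h2 h3; clear; lia.
have gI : {in S &, injective g}.
  move=> a b; rewrite !inE => /andP[Aa a0] /andP[Ab b0] /(congr1 val).
  rewrite /= !gE => e; have ja := wP _ Aa a0; have jb := wP _ Ab b0.
  have wab : w a = w b.
    by apply: (C_block_unique (block _ _ Aa a0 ja)); rewrite e; apply: block.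
  by apply/val_inj/(chain_jump_inj Aa Ab a0 b0 ja); rewrite ?wab // -wab e wab.
have gsurj a : A a -> (0 < a)%N -> exists b : nat,
    [/\ A b, (0 < b)%N, jump (w b) b & a = \dim (pull (w b) (E b))].
  move=> Aa a0; have gS' : g @: S = S.
    apply/eqP; rewrite eqEcard card_in_imset // leqnn andbT.
    by apply/subsetP => _ /imsetP[b bS ->]; apply: gS.
  have : inord a \in g @: S.
    by rewrite gS' inE inordK ?Aa ?a0 // ltnS chain_dim_le.
  case/imsetP => b; rewrite inE => /andP[Ab b0] /(congr1 val)/=.
  rewrite inordK ?gE ?ltnS ?chain_dim_le // => ->.
  by exists b; split=> //; apply: wP.
move=> a Aa a0; have ja := wP a Aa a0; have [La da] := chain_stepP Aa.
split=> // [i ji|a' Aa'].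
  have [|b [Ab b0 jb e]] := gsurj _ (chain_dimP (Lpull i La)).
    by have [_ _ lt _] := chain_jump_dim Aa a0 ji; apply: leq_ltn_trans lt.
  have iw : i = w b.
    by apply: (C_block_unique (block _ _ Aa a0 ji)); rewrite e; apply: block.
  rewrite iw; congr w; apply/esym/(chain_jump_inj Aa Ab a0 b0 _ jb); first by rewrite -iw.
  by rewrite -iw e iw.
(* By surjectivity [a'] is the value at some [b], and its position between the [C i] forces the same
   index. Monotonicity makes this value too large if [b >= a] and too small if [b < a]. *)
apply/negP => /andP[l1 l2]; have a'0 : (0 < a')%N by apply: leq_ltn_trans l1.
have [b [Ab b0 jb e]] := gsurj _ Aa' a'0.
have wab : w a = w b.
  apply: (@C_block_unique _ _ a'.-1); last by rewrite {1 2}e block.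
  have [_ h1 _ h2] := chain_jump_dim Aa a0 ja.
  move: (leq_ltn_trans h1 l1) (leq_trans l2 h2); clear.
  set x := \dim _; set y := \dim _; lia.
have [A1 _ m1] := chain_loP a.-1.
have [ab|ba] := leqP a b.
  have := dimvS (fz_pull_mono (w b) (chain_step_le Aa Ab ab)).
  by rewrite -e -wab leqNgt l2.
have bl : (b <= lo a.-1)%N by apply: m1; rewrite // -ltnS prednK.
have := dimvS (fz_pull_mono (w b) (chain_step_le Ab A1 bl)).
by rewrite -e -wab leqNgt l1.
Qed.

Definition chain_word := sval (cid chain_jump).
(** By [pos_step] this is the index of the graded piece of [D] in which the step containing position
    [b] lives. *)
Definition pos_word (b : nat) : int := chain_word (hi b).
(* The positions of each piece are sent in order to those of the piece that the
   psi_i map to it. *)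
Definition pos_theta (b : nat) : nat :=
  (\dim (pull (pos_word b) (E (lo b))) + (b - lo b))%N.
Local Notation w := pos_word.
Local Notation theta := pos_theta.

Lemma chain_lo_hi_bounds b : (b < N)%N -> (lo b <= b < hi b)%N.
Proof.
by move=> bN; have [_ l1 _] := chain_hiP bN; have [_ l2 _] := chain_loP b; rewrite l2.
Qed.

Lemma chain_step_lo_hi b : (b < N)%N -> (E (lo b) <= E (hi b))%VS.
Proof.
move=> bN; have [Ah _ _] := chain_hiP bN; have [Al _ _] := chain_loP b.
by have /andP[l1 l2] := chain_lo_hi_bounds bN; rewrite chain_step_le // (leq_trans l1) // ltnW.
Qed.

Lemma pos_word_jump b : (b < N)%N ->
  [/\ ~~ (pull (w b) (E (hi b)) <= pull (w b) (E (lo b)))%VS,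
      forall i, ~~ (pull i (E (hi b)) <= pull i (E (lo b)))%VS -> i = w b
    & forall a, A a ->
      ~~ (\dim (pull (w b) (E (lo b))) < a < \dim (pull (w b) (E (hi b))))%N].
Proof.
move=> bN; have [Ah lh _] := chain_hiP bN; have h0 : (0 < hi b)%N by apply: leq_ltn_trans lh.
by rewrite /w /chain_word; case: cid => w0 /= /(_ _ Ah h0); rewrite chain_lo_pred_hi.
Qed.

Lemma pos_word_unique b i : (b < N)%N ->
  ~~ (pull i (E (hi b)) <= pull i (E (lo b)))%VS -> i = w b.
Proof. by move=> bN; have [_ h _] := pos_word_jump bN; apply: h. Qed.

Lemma pos_step b : (b < N)%N ->
  (E (hi b) :&: D (w b - 1) <= E (lo b))%VS /\
  (E (hi b) <= E (lo b) + E (hi b) :&: D (w b))%VS.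
Proof.
move=> bN; have [_ h _] := pos_word_jump bN.
exact: fz_pull_single (chain_step_lo_hi bN) h.
Qed.

Lemma pos_pull_dim b : (b < N)%N ->
  \dim (pull (w b) (E (hi b))) = (\dim (pull (w b) (E (lo b))) + (hi b - lo b))%N.
Proof.
move=> bN; have [h1 h2] := pos_step bN.
have := fz_pull_dim (chain_step_lo_hi bN) h1 h2.
have [Ah _ _] := chain_hiP bN; have [Al _ _] := chain_loP b.
have [[_ ->] [_ ->]] := (chain_stepP Ah, chain_stepP Al).
by have := chain_lo_hi_bounds bN; clear; set x := \dim _; set y := \dim _; lia.
Qed.

Lemma pos_theta_bounds b : (b < N)%N ->
  (\dim (pull (w b) (E (lo b))) <= theta b < \dim (pull (w b) (E (hi b))))%N.
Proof.
move=> bN; rewrite (pos_pull_dim bN) /theta leq_addr ltn_add2l.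
by have := chain_lo_hi_bounds bN; clear; lia.
Qed.

Lemma pos_theta_block b : (b < N)%N ->
  (\dim (C (w b + 1)) <= theta b < \dim (C (w b)))%N.
Proof.
move=> /pos_theta_bounds/andP[h1 h2].
rewrite (leq_trans (dimvS (fz_pull_ge _ _)) h1) /=.
exact: leq_trans h2 (dimvS (fz_pull_le _ _)).
Qed.

Lemma pos_theta_lt b : (b < N)%N -> (theta b < N)%N.
Proof.
move=> /pos_theta_block/andP[_ h]; apply: leq_trans h _; exact/dimvS/subvf.
Qed.

(** No member of the chain lies strictly between [R_i(E (lo b))] and [R_i(E (hi b))], so theta sends
    whole pieces to whole pieces. *)
Lemma chain_lo_theta b : (b < N)%N -> lo (theta b) = \dim (pull (w b) (E (lo b))).
Proof.
move=> bN; have /andP[h1 h2] := pos_theta_bounds bN.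
have [Al _ _] := chain_loP b; have [Ll _] := chain_stepP Al.
apply: chain_lo_unique => //; first exact/chain_dimP/Lpull.
move=> a Aa ab; have [_ _ /(_ a Aa)] := pos_word_jump bN.
by rewrite (leq_ltn_trans ab h2) andbT -leqNgt.
Qed.

Lemma chain_hi_theta b : (b < N)%N -> hi (theta b) = \dim (pull (w b) (E (hi b))).
Proof.
move=> bN; have /andP[h1 h2] := pos_theta_bounds bN.
have [Ah _ _] := chain_hiP bN; have [Lh _] := chain_stepP Ah.
apply: chain_hi_unique => //; first exact/chain_dimP/Lpull.
move=> a Aa ab; have [_ _ /(_ a Aa)] := pos_word_jump bN.
by rewrite (leq_ltn_trans h1 ab) /= -leqNgt.
Qed.

Lemma chain_step_lo_theta b : (b < N)%N -> E (lo (theta b)) = pull (w b) (E (lo b)).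
Proof.
move=> bN; have [Al _ _] := chain_loP b; have [Ll _] := chain_stepP Al.
by rewrite chain_lo_theta // chain_stepE //; apply: Lpull.
Qed.

Lemma chain_step_hi_theta b : (b < N)%N -> E (hi (theta b)) = pull (w b) (E (hi b)).
Proof.
move=> bN; have [Al _ _] := chain_hiP bN; have [Ll _] := chain_stepP Al.
by rewrite chain_hi_theta // chain_stepE //; apply: Lpull.
Qed.

Lemma pos_theta_sub_lo b : (b < N)%N -> (theta b - lo (theta b) = b - lo b)%N.
Proof. by move=> bN; rewrite chain_lo_theta // /theta addKn. Qed.

Lemma chain_lo_hi_piece b b' : (b < N)%N -> (lo b <= b' < hi b)%N ->
  lo b' = lo b /\ hi b' = hi b.
Proof.
move=> bN /andP[lb b'h]; have [Al ll ml] := chain_loP b; have [Ah lh mh] := chain_hiP bN; split.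
  apply: chain_lo_unique => // a Aa ab'; apply: ml => //.
  rewrite leqNgt; apply/negP => /(mh _ Aa).
  by rewrite leqNgt (leq_ltn_trans ab' b'h).
apply: chain_hi_unique => // a Aa b'a; apply: mh => //.
rewrite ltnNge; apply/negP => /(ml _ Aa) /leq_trans/(_ lb).
by rewrite leqNgt b'a.
Qed.

Lemma pos_theta_piece b b' : (b < N)%N -> (lo b <= b' < hi b)%N ->
  [/\ w b' = w b, lo (theta b') = lo (theta b), hi (theta b') = hi (theta b)
    & theta b' = lo (theta b) + (b' - lo b)]%N.
Proof.
move=> bN hb'; have [lE hE] := chain_lo_hi_piece bN hb'.
have b'N : (b' < N)%N.
  have [Ah _ _] := chain_hiP bN; have /andP[_ h] := hb'.
  exact: leq_trans h (chain_dim_le Ah).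
have wE : w b' = w b by rewrite /w hE.
by rewrite !chain_lo_theta // !chain_hi_theta // /theta !wE lE hE.
Qed.

(** Inside a piece theta is a shift, and across pieces [R_i] is monotone. This monotonicity is what
    will put the permutation read off from theta into [JW]. *)
Lemma pos_theta_mono b b' : (b < b')%N -> (b' < N)%N -> w b = w b' ->
  (theta b < theta b')%N.
Proof.
move=> bb' b'N wE; have bN := ltn_trans bb' b'N.
have [b'h|hb'] := ltnP b' (hi b).
  have [|lE hE] := @chain_lo_hi_piece b b' bN.
    by have [_ h _] := chain_loP b; rewrite b'h (leq_trans h) // ltnW.
  rewrite /theta wE lE ltn_add2l ltn_sub2r //.
  by have /andP[h _] := chain_lo_hi_bounds bN; apply: leq_ltn_trans h _.
have /andP[_ h1] := pos_theta_bounds bN; have /andP[h2 _] := pos_theta_bounds b'N.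
apply: leq_trans h1 (leq_trans _ h2); rewrite wE; apply/dimvS/fz_pull_mono.
have [Ah _ _] := chain_hiP bN; have [Al _ m] := chain_loP b'.
by apply: chain_step_le => //; apply: m.
Qed.

(** The index [w b] is recovered from [theta b] as the step of [C] containing that position;
    monotonicity for a fixed index does the rest. *)
Lemma pos_theta_inj b b' : (b < N)%N -> (b' < N)%N -> theta b = theta b' -> b = b'.
Proof.
move=> bN b'N e; have wE : w b = w b'.
  by apply: (C_block_unique (pos_theta_block bN)); rewrite e pos_theta_block.
case: (ltngtP b b') => // h.
  by have := pos_theta_mono h b'N wE; rewrite e ltnn.
by have := pos_theta_mono h bN (esym wE); rewrite e ltnn.
Qed.

End StableChain.

(** * A basis adapted to the chain, to [D] and to the [psi_i] *)

Section NormalPositions.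
Variables (p : nat) (k : closedFieldType) (chk : p \in [pchar k]).
Variable Z : fzip chk.
Local Notation C := (fz_C Z).
Local Notation D := (fz_D Z).
Local Notation N := (\dim {: Z}).
Variable L : {vspace Z} -> Prop.
Hypothesis Lstable : stable_chain L.

Local Notation A := (chain_dim L).
Local Notation E := (chain_step L).
Local Notation lo := (chain_lo L).
Local Notation hi := (chain_hi L).
Local Notation w := (pos_word Lstable).
Local Notation theta := (pos_theta Lstable).

(** The congruence is the one a standard basis satisfies. All positions are taken together because
    theta permutes the pieces. *)
Definition fixed_family (y : nat -> Z) : Prop :=
  forall b, (b < N)%N ->
  [/\ y b \in E (hi b), y b \in D (w b)
    & fz_psi (w b) (y (theta b)) - y b \in D (w b - 1)].

(** Lang's theorem is applied to [Phi] on families indexed by the positions. [X] consists of the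
    families with entries in [E (hi b) :&: D (w b)], and [K] of those among them with entries in the
    preceding steps. If all fixed families had their entry at [b0] in [V], then so would all of
    [X]. *)
Lemma fixed_family_exists b0 (V : {vspace Z}) : (b0 < N)%N ->
  (E (lo b0) <= V)%VS -> ~~ (E (hi b0) :&: D (w b0) <= V)%VS ->
  exists2 y, fixed_family y & y b0 \notin V.
Proof.
move=> b0N loV; apply: contraNP => no.
pose th (b : 'I_N) := Ordinal (pos_theta_lt Lstable (ltn_ord b)).
have thI : injective th.
  by move=> b b' /(congr1 val)/= /pos_theta_inj h; apply/val_inj/h.
pose Y (b : 'I_N) := (E (hi b) :&: D (w b))%VS.
pose pr (b : 'I_N) := addv_pi1 (Y b) (D (w b - 1)).
pose Phi (y : {ffun 'I_N -> fz_mod Z}) : {ffun 'I_N -> fz_mod Z} :=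
  [ffun b => pr b (fz_psi (w b) (y (th b)))].
have Plin : semilinear_along (frob chk) Phi.
  by move=> c x y; apply/ffunP => b; rewrite !ffunE fz_psi_lin linearP.
have [X XP] : exists X : {vspace {ffun 'I_N -> fz_mod Z}},
    forall y, y \in X <-> forall b, y b \in Y b.
  apply: vspace_comprehension => [b|a x y hx hy b]; first by rewrite ffunE mem0v.
  by rewrite !ffunE memvD ?memvZ.
have [K KP] : exists K : {vspace {ffun 'I_N -> fz_mod Z}},
    forall y, y \in K <-> y \in X /\ forall b, y b \in E (lo b).
  apply: vspace_comprehension => [|a x y [xX hx] [yX hy]].
    by split=> [|b]; rewrite ?mem0v // ffunE mem0v.
  by split=> [|b]; rewrite ?ffunE memvD ?memvZ.
have [M MP] : exists M : {vspace {ffun 'I_N -> fz_mod Z}},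
    forall y, y \in M <-> y (Ordinal b0N) \in V.
  apply: vspace_comprehension => [|a x y hx hy]; first by rewrite ffunE mem0v.
  by rewrite !ffunE memvD ?memvZ.
have projP (y : {ffun 'I_N -> fz_mod Z}) b : y \in X ->
    let z := pr b (fz_psi (w b) (y (th b))) in
    [/\ z \in E (hi b), z \in D (w b), fz_psi (w b) (y (th b)) - z \in D (w b - 1)
      & (z \in E (lo b)) = (y (th b) \in E (lo (th b)))].
  move=> /XP/(_ (th b))/memv_capP[]; rewrite /= chain_step_hi_theta // chain_step_lo_theta //.
  move=> yh _; have [low _] := pos_step Lstable (ltn_ord b).
  exact: (fz_pull_proj (chain_step_lo_hi _ (ltn_ord b)) low yh).
have XM : (X <= M)%VS.
  apply: (lang_fixed_span Plin (K := K)).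
  - by apply/subvP => y /KP[].
  - by apply/subvP => y /KP[_ h]; apply/MP; apply: (subvP loV); apply: h.
  - move=> y yX; apply/XP => b; rewrite ffunE.
    by have [h1 h2 _ _] := projP y b yX; rewrite memv_cap h1 h2.
  - move=> y /KP[yX yl]; apply/KP; split.
      by apply/XP => b; rewrite ffunE; have [h1 h2 _ _] := projP y b yX; rewrite memv_cap h1 h2.
    by move=> b; rewrite ffunE; have [_ _ _ ->] := projP y b yX; apply: yl.
  - move=> y yX /KP[_ h]; apply/KP; split=> // b.
    have -> : b = th (invF thI b) by rewrite f_invF.
    by have [_ _ _ <-] := projP y (invF thI b) yX; have := h (invF thI b); rewrite ffunE.
  - move=> y yX fy; apply/MP; apply: contrapT => /negP yV; apply: no.
    exists (fun b => oapp y 0 (insub b)); last by rewrite insubT.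
    move=> b bN; rewrite insubT /= insubT /=.
      exact: pos_theta_lt.
    move=> tN; have [h1 h2 h3 _] := projP y (Ordinal bN) yX.
    have fyb : y (Sub b bN) = pr (Ordinal bN) (fz_psi (w b) (y (th (Ordinal bN)))).
      by rewrite -{1}fy ffunE.
    have -> : Sub (theta b) tN = th (Ordinal bN) :> 'I_N by apply: val_inj.
    by rewrite fyb; split.
(* A family concentrated at [b0] transfers the inclusion of [X] in [M] to single vectors. *)
apply/subvP => x xY.
have : [ffun b => if b == Ordinal b0N then x else 0] \in X.
  by apply/XP => b; rewrite ffunE; case: eqP => [->|_]; rewrite ?mem0v.
by move/(subvP XM)/MP; rewrite ffunE eqxx.
Qed.

(* A fixed family is a basis in normal form once each y b avoids piece_below y b. *)
Definition piece_below (y : nat -> Z) (b : nat) : {vspace Z} :=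
  (E (lo b) + <<mkseq (fun j => y (lo b + j)%N) (b - lo b)>>)%VS.

Lemma eq_piece_below y z b : (forall b', (lo b <= b' < b)%N -> y b' = z b') ->
  piece_below y b = piece_below z b.
Proof.
move=> yz; congr (_ + span _)%VS; apply/eq_in_map => j; rewrite mem_iota add0n /= => jb.
by apply: yz; rewrite leq_addr -ltn_subRL.
Qed.

(** A relation at [b] lifts to [theta b] with [p]-th roots of its coefficients, because membership
    in [E (lo (theta b))] is tested by [psi]. Contrapositively, independence at one position
    propagates backwards along theta, hence over the whole orbit. *)
Lemma piece_below_theta y z b : (b < N)%N -> fixed_family y -> fixed_family z ->
  z b \in piece_below y b -> z (theta b) \in piece_below y (theta b).
Proof.
move=> bN fy fz /memv_addP[x xE [_ /span_mkseqP[a ->] Ez]].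
have /choice[al Eal] : forall j, exists c, frob chk c = a j by move=> j; apply: frob_surj.
have /andP[_ l2] := chain_lo_hi_bounds Lstable bN.
have pE (j : 'I_(b - lo b)) : [/\ (lo b + j < N)%N, w (lo b + j) = w b,
    hi (theta (lo b + j)%N) = hi (theta b) & theta (lo b + j)%N = (lo (theta b) + j)%N].
  have jb : (lo b + j < b)%N by rewrite -ltn_subRL ltn_ord.
  have [|-> _ ->] := @pos_theta_piece _ _ _ _ _ Lstable b (lo b + j)%N bN.
    by rewrite leq_addr (ltn_trans jb).
  by rewrite addKn (ltn_trans jb bN).
pose t := z (theta b) - \sum_(j < b - lo b) al j *: y (theta (lo b + j)).
have tN := pos_theta_lt Lstable bN.
have [_ _ zb] := fz b bN.
have tE : t \in E (lo (theta b)).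
  have tC v : v \in E (hi (theta b)) -> v \in C (w b).
    by rewrite chain_step_hi_theta //; apply: (subvP (fz_pull_le _ _)).
  rewrite chain_step_lo_theta // fz_pullP rpredB /=; last 2 first.
  - by apply: tC; have [] := fz _ tN.
  - apply: memv_suml => j _; apply/memvZ/tC; have [jN _ <- _] := pE j.
    by have [] := fy _ (pos_theta_lt Lstable jN).
  rewrite (semilinB _ _ (@fz_psi_lin _ _ _ Z (w b))).
  rewrite (semilin_sum _ _ _ (@fz_psi_lin _ _ _ Z (w b))).
  set P := fz_psi _ _; set T := \sum_(j < _) _.
  pose S := \sum_(j < b - lo b) a j *: y (lo b + j)%N.
  have ES : \sum_(j < b - lo b)
      a j *: (fz_psi (w b) (y (theta (lo b + j))) - y (lo b + j)%N) = T - S.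
    by rewrite -sumrB; apply: eq_bigr => j _; rewrite Eal scalerBr.
  have -> : P - T = x + ((P - z b) - (T - S)).
    by rewrite Ez opprB opprD !addrA subrK [x + P]addrC addrK.
  apply: memv_add => //; rewrite rpredB // -ES; apply: memv_suml => j _.
  by have [jN <- _ _] := pE j; have [_ _ h] := fy _ jN; apply: memvZ.
rewrite -(subrK (\sum_(j < b - lo b) al j *: y (theta (lo b + j))) (z (theta b))).
apply: memv_add => //; apply/span_mkseqP; rewrite pos_theta_sub_lo //; exists al.
by apply: eq_bigr => j _; have [_ _ _ ->] := pE j.
Qed.

(** Positions are treated one theta-orbit at a time, [S] being those done. Theta preserves the index
    [b - lo b] within a piece; choosing an untreated [b0] of least index ensures that everything
    below its orbit, inside the respective pieces, is already in [S]. *)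
Lemma good_family_exists : exists2 y, fixed_family y &
  forall b, (b < N)%N -> y b \notin piece_below y b.
Proof.
have [y0 fy0] : exists y, fixed_family y.
  exists (fun=> 0) => b bN; rewrite !mem0v subr0.
  by rewrite (semilin0 (@fz_psi_lin _ _ _ Z (w b))) mem0v.
pose th (b : 'I_N) := Ordinal (pos_theta_lt Lstable (ltn_ord b)).
have thI : injective th.
  by move=> b b' /(congr1 val)/= /pos_theta_inj h; apply/val_inj/h.
suff h (S : {set 'I_N}) (y : nat -> Z) : fixed_family y ->
    (forall b, (th b \in S) = (b \in S)) ->
    (forall b b' : 'I_N, b \in S -> (lo b <= b' < b)%N -> b' \in S) ->
    (forall b : 'I_N, b \in S -> y b \notin piece_below y b) ->
    exists2 y, fixed_family y & forall b, (b < N)%N -> y b \notin piece_below y b.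
  by apply: (h set0 y0) => // [b|b b'|b]; rewrite !inE.
elim: {S}_.+1 {-2}S (ltnSn #|~: S|) y => // d IH S dS y fy stS dcS gS.
have [b1 b1S|allS] := pickP (fun b : 'I_N => b \notin S); last first.
  exists y => // b bN; apply: (gS (Ordinal bN)).
  by have := allS (Ordinal bN); case: (_ \in S).
have [b0 b0S min0] := @arg_minnP _ b1 (fun b => b \notin S) (fun b : 'I_N => b - lo b)%N b1S.
have b0N := ltn_ord b0.
have [z fz zb0] : exists2 z, fixed_family z & z b0 \notin piece_below y b0.
  apply: fixed_family_exists => //; first exact: addvSl.
  (* Otherwise [E (hi b0)] would lie in [piece_below y b0], whose dimension is at most
     [lo b0 + (b0 - lo b0) = b0 < hi b0]. *)
  apply/negP => le; have [_ up] := pos_step Lstable b0N.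
  have {up}le : (E (hi b0) <= piece_below y b0)%VS.
    by apply: subv_trans up _; rewrite subv_add le addvSl.
  have [Ah _ _] := @chain_hiP _ _ _ _ L Lstable _ b0N; have [Al _ _] := chain_loP Lstable b0.
  have [[_ dh] [_ dl]] := (chain_stepP Ah, chain_stepP Al).
  have := leq_trans (dimvS le) (dimv_add_leqif _ _).
  rewrite dh dl; have := dim_span (mkseq (fun j => y (lo b0 + j)%N) (b0 - lo b0)).
  rewrite size_mkseq; have := chain_lo_hi_bounds Lstable b0N.
  by clear; set m := \dim _; lia.
pose sg := perm thI.
pose O := porbit sg b0.
have thO b : (th b \in O) = (b \in O).
  have -> : th b = sg b by rewrite permE.
  by rewrite /O ![_ \in porbit sg b0]porbit_sym -[sg]expg1 porbit_perm ?expg1.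
have idxO b : b \in O -> (b - lo b = b0 - lo b0)%N.
  case/porbitP => m ->; elim: m => [|m IHm]; first by rewrite expg0 perm1.
  by rewrite expgSr permM permE /= pos_theta_sub_lo.
have OS b : b \in O -> b \notin S.
  case/porbitP => m ->; elim: m => [|m IHm]; first by rewrite expg0 perm1.
  by rewrite expgSr permM permE stS.
have lowS (b b' : 'I_N) : b \in O -> (lo b <= b' < b)%N -> b' \in S.
  move=> bO hb'; apply: contraT => /min0; rewrite -(idxO b bO).
  have [|lE _] := @chain_lo_hi_piece _ _ _ _ L Lstable b b' (ltn_ord b).
    have /andP[-> h] := hb'.
    by have /andP[_] := chain_lo_hi_bounds Lstable (ltn_ord b); apply: ltn_trans.
  by rewrite lE; move: hb'; clear; lia.
have zO b : b \in O -> z b \notin piece_below y b.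
  rewrite porbit_sym => /porbitP[m Em].
  elim: m b Em => [|m IHm] b; first by rewrite expg0 perm1 => <-.
  rewrite expgS permM permE => /IHm; apply: contra; exact: piece_below_theta.
(* Replacing [y] by [z] on a whole orbit keeps the family fixed. The spaces [piece_below] at treated
   positions do not change, since they involve only entries at positions of [S], which the orbit
   avoids. *)
pose y' b := if [exists c in O, val c == b] then z b else y b.
have y'O (b : 'I_N) : b \in O -> y' b = z b.
  by move=> bO; rewrite /y'; case: existsP => // -[]; exists b; rewrite bO /=.
have y'S (b : 'I_N) : b \notin O -> y' b = y b.
  move=> bO; rewrite /y'; case: existsP => // -[c /andP[cO /eqP/val_inj cb]].
  by rewrite -cb cO in bO.
apply: (IH (S :|: O) _ y').
- have : (#|~: (S :|: O)| < #|~: S|)%N.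
    apply: proper_card; apply/properP; split; first by rewrite setCS subsetUl.
    by exists b0; rewrite !inE ?b0S // porbit_id orbT.
  by move: dS; clear; lia.
- move=> b bN; have [bO|bO] := boolP (Ordinal bN \in O).
    have tO : th (Ordinal bN) \in O by rewrite thO.
    by have := y'O _ bO; have := y'O _ tO; rewrite /= => -> ->; apply: fz.
  have tO : th (Ordinal bN) \notin O by rewrite thO.
  by have := y'S _ bO; have := y'S _ tO; rewrite /= => -> ->; apply: fy.
- by move=> b; rewrite !inE stS thO.
- move=> b b'; rewrite !inE => /orP[bS|bO] hb'; first by rewrite (dcS b).
  by rewrite (lowS b).
- have eqb (b b' : 'I_N) : b' \in S -> y' b' = y b'.
    by move=> b'S; apply: y'S; apply: contraL b'S; apply: OS.
  move=> b bSO; have -> : piece_below y' b = piece_below y b.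
    apply: eq_piece_below => b' hb'.
    have b'N : (b' < N)%N by have /andP[_ h] := hb'; apply: ltn_trans h _.
    have b'S : Ordinal b'N \in S.
      by move: bSO; rewrite inE => /orP[bS|bO]; [apply: (dcS b)|apply: (lowS b)].
    exact: (eqb b (Ordinal b'N)).
  move: bSO; rewrite inE => /orP[bS|bO]; first by rewrite eqb // gS.
  by rewrite y'O // zO.
Qed.

(** The spans [F b] of the first [b] vectors form a full flag refining the chain, which settles [C].
    For [D], vectors of [F b :&: D i] are expanded by induction on [b]. *)
Theorem normal_positions : exists v : nat -> Z,
  [/\ <<mkseq v N>>%VS = fullv,
      forall i, C i = <<mkseq v (\dim (C i))>>%VS,
      forall i, D i = <<[seq v j | j <- iota 0 N & (w j <= i)%R]>>%VS
    & forall b, (b < N)%N -> fz_psi (w b) (v (theta b)) - v b \in D (w b - 1)].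
Proof.
have [v fv gv] := good_family_exists; exists v.
pose F b := <<mkseq v b>>%VS.
have FS b : F b.+1 = (F b + <[v b]>)%VS.
  by rewrite /F mkseqS -cats1 span_cat span_seq1.
have Fmono b c : (b <= c)%N -> (F b <= F c)%VS.
  move=> bc; apply: sub_span => _ /mapP[j jb ->]; apply: map_f.
  by move: jb; rewrite !mem_iota /= !add0n => /leq_trans; apply.
have FE b : (b <= N)%N ->
    \dim (F b) = b /\ (forall a, (a <= b)%N -> A a -> E a = F a).
  elim: b => [|b IH] bN.
    split; first by rewrite /F span_nil dimv0.
    move=> a; rewrite leqn0 => /eqP-> /(chain_stepP) [_ d0]; rewrite /F span_nil.
    by apply/eqP; rewrite -dimv_eq0 d0.
  have [dF EF] := IH (ltnW bN).
  have [Al llo _] := chain_loP Lstable b.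
  have vbF : v b \notin F b.
    apply: contra (gv b bN); rewrite /piece_below EF // /F -span_cat.
    apply: subvP; apply: sub_span => _ /mapP[j jb ->].
    rewrite mem_cat; move: jb; rewrite mem_iota add0n /= => jb.
    have [jl|lj] := ltnP j (lo b).
      by rewrite map_f // mem_iota.
    rewrite orbC -(subnKC lj) map_f // mem_iota add0n /=.
    exact: ltn_sub2r (leq_ltn_trans lj jb) jb.
  have dFS : \dim (F b.+1) = b.+1.
    rewrite FS; apply/eqP; rewrite eqn_leq; apply/andP; split.
      apply: leq_trans (dimv_add_leqif _ _) _; rewrite dF dim_vline -addn1 leq_add2l.
      by case: (_ == _).
    rewrite -{1}dF (ltn_leqif (dimv_leqif_sup (addvSl _ _))) subv_add subvv /=.
    by rewrite -memvE.
  split=> // a; rewrite leq_eqVlt => /orP[/eqP->|]; last by rewrite ltnS; apply: EF.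
  move=> Ab; apply/esym/eqP; rewrite eqEdim; have [_ ->] := chain_stepP Ab.
  rewrite dFS leqnn andbT; apply/span_subvP => _ /mapP[j + ->]; rewrite mem_iota add0n /= => jb.
  have jN : (j < N)%N by apply: leq_trans jb bN.
  have [vj _ _] := fv j jN; apply: subvP vj.
  have [Ah _ mh] := @chain_hiP _ _ _ _ L Lstable _ jN.
  by apply: (chain_step_le Lstable) => //; apply: mh.
have EF a : A a -> E a = F a.
  by move=> Aa; have [_ h] := FE _ (chain_dim_le Aa); apply: h.
have LC i : L (C i) by case: Lstable.
have dF b : (b <= N)%N -> \dim (F b) = b by move=> /FE[].
split.
- by rewrite -/(F N); apply/eqP; rewrite eqEdim subvf /= dF ?leqnn.
- by move=> i; rewrite -[LHS](chain_stepE Lstable (LC i)) EF //; apply: chain_dimP.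
- move=> i; apply/eqP; rewrite eqEsubv; apply/andP; split; last first.
    apply/span_subvP => _ /mapP[j + ->].
    rewrite mem_filter mem_iota add0n /= => /andP[wj jN].
    by have [_ vj _] := fv j jN; apply: subvP vj; apply: fz_D_mono.
  set S := span _.
  suff h b : (b <= N)%N -> (F b :&: D i <= S)%VS.
    have := h N (leqnn N); have -> : F N = fullv.
      by apply/eqP; rewrite eqEdim subvf /= dF ?leqnn.
    by rewrite capfv.
  elim: b => [|b IH] bN; first by rewrite /F span_nil cap0v sub0v.
  apply/subvP => x /memv_capP[xF xD]; have [wb|wb] := lerP (w b) i.
    move: xF; rewrite FS => /memv_addP[f fF [_ /vlineP[c ->] Ex]].
    rewrite Ex; have [_ vD _] := fv b bN.
    have vDi : v b \in D i by apply: subvP vD; apply: fz_D_mono.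
    apply: memvD.
      apply: (subvP (IH (ltnW bN))); rewrite memv_cap fF /=.
      by rewrite -[f](addrK (c *: v b)) -Ex rpredB // memvZ.
    apply/memvZ/memv_span/map_f.
    by rewrite mem_filter wb mem_iota.
  (* Here [i < w b], so [x] lies in [E (hi b) :&: D (w b - 1)]. This is contained in [E (lo b)],
     hence in [F b]: the vector [v b] does not occur in [x]. *)
  apply: (subvP (IH (ltnW bN))); rewrite memv_cap xD andbT.
  have [Ah lh _] := @chain_hiP _ _ _ _ L Lstable _ bN; have [Al ll _] := chain_loP Lstable b.
  apply: (subvP (Fmono _ _ ll)); rewrite -EF //.
  have [low _] := pos_step Lstable bN; apply: (subvP low).
  rewrite memv_cap EF // (subvP (Fmono _ _ lh)) //=.
  by apply: subvP xD; apply: fz_D_mono; lia.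
- by move=> b bN; have [] := fv b bN.
Qed.

End NormalPositions.

(** * Coordinates in a basis indexed by ['I_n] *)

Section BasisFamily.
Variables (K : fieldType) (V : vectType K) (n : nat) (v : 'I_n -> V).

Definition famspan (P : {set 'I_n}) : {vspace V} := <<[seq v b | b in P]>>%VS.

Lemma famspan_mem (P : {set 'I_n}) b : b \in P -> v b \in famspan P.
Proof. by move=> bP; apply/memv_span/image_f. Qed.

Lemma famspanP (P : {set 'I_n}) (U : {vspace V}) :
  reflect (forall b, b \in P -> v b \in U) (famspan P <= U)%VS.
Proof.
apply: (iffP span_subvP) => [h b bP|h _ /imageP[b bP ->]]; last exact: h.
exact/h/image_f.
Qed.

Lemma famspanS (P Q : {set 'I_n}) : P \subset Q -> (famspan P <= famspan Q)%VS.
Proof. by move=> /subsetP PQ; apply/famspanP => b /PQ; apply: famspan_mem. Qed.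

Hypothesis vfull : famspan setT = fullv.
Hypothesis dimV : \dim {:V} = n.

Let X := [tuple v b | b < n].

Lemma family_basis : basis_of fullv X.
Proof.
rewrite basisEdim dimV size_tuple leqnn andbT -vfull.
apply/famspanP => b _; apply/memv_span/tnthP; exists b.
by rewrite tnth_mktuple.
Qed.

Definition famcoord (b : 'I_n) : V -> K := coord X b.
HB.instance Definition _ b := GRing.Linear.copy (famcoord b) (coord X b).

Lemma famcoord_sum x : x = \sum_b famcoord b x *: v b.
Proof.
rewrite {1}(coord_basis family_basis (memvf x)).
by apply: eq_bigr => b _; rewrite -tnth_nth tnth_mktuple.
Qed.

Lemma famcoord_family b b' : famcoord b (v b') = (b == b')%:R.
Proof.
have -> : v b' = X`_b' by rewrite -tnth_nth tnth_mktuple.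
by rewrite /famcoord coord_free ?(basis_free family_basis) // eq_sym.
Qed.

Lemma mem_famspan (P : {set 'I_n}) x :
  reflect (forall b, b \notin P -> famcoord b x = 0) (x \in famspan P).
Proof.
apply: (iffP idP) => [xP b bP|h]; last first.
  rewrite [x]famcoord_sum; apply: memv_suml => b _.
  by have [/famspan_mem/memvZ//|/h->] := boolP (b \in P); rewrite scale0r mem0v.
have : (famspan P <= lker (linfun (famcoord b : V -> K^o)))%VS.
  apply/famspanP => c cP; rewrite memv_ker lfunE /= famcoord_family.
  by case: (b =P c) bP => [->|_ _]; rewrite ?cP.
by move/subvP/(_ x xP); rewrite memv_ker lfunE /= => /eqP.
Qed.

Lemma dim_famspan (P : {set 'I_n}) : \dim (famspan P) = #|P|.
Proof.
have le (Q : {set 'I_n}) : (\dim (famspan Q) <= #|Q|)%N.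
  by apply: leq_trans (dim_span _) _; rewrite size_image.
apply/eqP; rewrite eqn_leq le /=.
have sub : (fullv <= famspan P + famspan (~: P))%VS.
  rewrite -vfull; apply/famspanP => b _; have [bP|bP] := boolP (b \in P).
    by apply: (subvP (addvSl _ _)); apply: famspan_mem.
  by apply: (subvP (addvSr _ _)); apply: famspan_mem; rewrite inE.
have := leq_trans (dimvS sub) (dimv_add_leqif _ _).
rewrite dimV -{1}[n]card_ord -(cardsC P) => h.
rewrite -(leq_add2r #|~: P|); apply: leq_trans h _; rewrite leq_add2l; exact: le.
Qed.

Lemma famspan_add (P Q : {set 'I_n}) : (famspan P + famspan Q)%VS = famspan (P :|: Q).
Proof.
apply/eqP; rewrite eqEsubv subv_add !famspanS ?subsetUl ?subsetUr //=.
apply/famspanP => b; rewrite inE => /orP[] /famspan_mem.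
  exact: (subvP (addvSl _ _)).
exact: (subvP (addvSr _ _)).
Qed.

End BasisFamily.

(** * Blocks and minimal coset representatives *)

Lemma card_ord_lt (n c : nat) : (c <= n)%N -> #|[set b : 'I_n | (b < c)%N]| = c.
Proof.
move=> cn; rewrite -sum1dep_card -(big_mkord (fun b => b < c)%N (fun=> 1%N)).
by rewrite -[RHS]subn0 -[RHS]muln1 -sum_nat_const_nat (big_nat_widen _ _ _ _ _ cn).
Qed.

Lemma down_closed_set (n : nat) (P : {set 'I_n}) :
  (forall b b' : 'I_n, b \in P -> (b' <= b)%N -> b' \in P) ->
  P = [set b : 'I_n | (b < #|P|)%N].
Proof.
move=> dc; apply/eqP; rewrite eqEcard card_ord_lt ?leqnn ?andbT; last first.
  by rewrite -[X in (_ <= X)%N]card_ord max_card.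
apply/subsetP => b bP; rewrite inE -{1}(card_ord_lt (ltn_ord b)).
apply/subset_leq_card/subsetP => b'; rewrite inE ltnS; exact: dc.
Qed.

Lemma mono_block_perm (n : nat) (w : 'S_n) (T : eqType) (f : 'I_n -> T) :
  (forall a, f (w a) = f a) ->
  (forall a b : 'I_n, f a = f b -> (a < b)%N -> (w a < w b)%N) -> w = 1%g.
Proof.
move=> fw mono; apply/permP => a; rewrite perm1.
have [m] := ubnP (val a); elim: m a => // m IH a; rewrite ltnS => am.
have small (b : 'I_n) : (b < a)%N -> w b = b.
  by move=> ba; apply: IH; apply: leq_trans am.
case: (ltngtP (w a) a) => [lt|gt|/val_inj//].
  by have /perm_inj e := small _ lt; rewrite e ltnn in lt.
(* All points below [a] are fixed, so if [w a > a], then the preimage [c] of [a] lies above [a], and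
   monotonicity on their common fibre gives [w a < a]. *)
pose c := (w^-1)%g a; have wc : w c = a by rewrite permKV.
case: (ltngtP c a) => [lt|ac|/val_inj e].
- by have e := small _ lt; rewrite -wc e ltnn in lt.
- have := mono a c; rewrite wc -(fw c) wc => /(_ erefl ac).
  by rewrite ltnNge (ltnW gt).
- have wa : w a = a by rewrite -[in LHS]e wc.
  by rewrite wa ltnn in gt.
Qed.

Section Blocks.
Variable ns : seq nat.
Local Notation n := (sumn ns).

Lemma in_block_x (j : nat) (a : 'I_n) :
  in_block ns j.+1 a = (psum ns j <= x_perm ns a < psum ns j.+1)%N.
Proof.
rewrite permE /= leqNgt !x_val_psum // -ltnNge andbC /in_block.
by case: j.
Qed.

Lemma x_perm_mono (j : nat) (a b : 'I_n) : in_block ns j.+1 a -> in_block ns j.+1 b ->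
  (a < b)%N -> (x_perm ns a < x_perm ns b)%N.
Proof.
move=> ja jb ab.
have blockE (c : 'I_n) : in_block ns j.+1 c -> block_of ns c = j.+1.
  move=> jc; have [/andP[c0 _] /andP[c1 c2]] := block_ofP (ltn_ord c).
  case/andP: jc => j1 j2; move: c0 c1 c2 j1 j2.
  case: (block_of ns c) => // l _ c1 c2 j1 j2; congr S.
  case: (ltngtP l j) => // [lj|jl].
    have := leq_sub2l n (psum_leq ns lj); rewrite leqNgt => /negP[].
    exact: leq_ltn_trans c1 j2.
  have := leq_sub2l n (psum_leq ns jl); rewrite leqNgt => /negP[].
  exact: leq_ltn_trans j1 c2.
rewrite !permE /= /x_val !blockE //= -!addnA ltn_sub2r ?ltn_add2r //.
have /andP[+ _] := ja; rewrite leq_subLR => ja'.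
apply: leq_ltn_trans ja' _; rewrite addnC.
by apply: leq_trans (_ : _ < b + psum ns j.+1)%N _; rewrite ?ltn_add2r // leq_add2l leq_addr.
Qed.

Lemma W_J_in_block (w : 'S_n) (j : nat) (a : 'I_n) : (j < size ns)%N -> w \in W_J ns ->
  in_block ns j.+1 a -> in_block ns j.+1 (w a).
Proof.
move=> js; rewrite inE => /forallP/(_ (Ordinal js))/forallP/(_ a)/implyP; exact.
Qed.

Lemma in_block_unique (i j a : nat) : in_block ns i.+1 a -> in_block ns j.+1 a -> i = j.
Proof.
move=> /andP[i1 i2] /andP[j1 j2].
case: (ltngtP i j) => // [ij|ji].
  have := leq_sub2l n (psum_leq ns ij); rewrite leqNgt => /negP[].
  exact: leq_ltn_trans i1 j2.
have := leq_sub2l n (psum_leq ns ji); rewrite leqNgt => /negP[].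
exact: leq_ltn_trans j1 i2.
Qed.

Lemma in_block_exists (a : 'I_n) : exists2 j, (j < size ns)%N & in_block ns j.+1 a.
Proof.
have [/andP[c0 c1] c2] := block_ofP (ltn_ord a).
by exists (block_of ns a).-1; rewrite prednK.
Qed.

Lemma in_block_of (a : 'I_n) (j : nat) : in_block ns j.+1 a -> block_of ns a = j.+1.
Proof.
move=> ja; have [/andP[c0 _] c] := block_ofP (ltn_ord a).
by rewrite -(prednK c0) in c *; rewrite (in_block_unique c ja).
Qed.

Lemma W_JP (w : 'S_n) :
  reflect (forall a, block_of ns (w a) = block_of ns a) (w \in W_J ns).
Proof.
apply: (iffP idP) => [wW a|h].
  have [j js ja] := in_block_exists a.
  by rewrite (in_block_of ja) (in_block_of (W_J_in_block js wW ja)).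
rewrite inE; apply/forallP => j; apply/forallP => a; apply/implyP => ja.
have [i is_ ia] := in_block_exists (w a).
suff -> : val j = i by [].
by apply/succn_inj; rewrite -(in_block_of ja) -(in_block_of ia) h.
Qed.

Lemma JWP (u : 'S_n) :
  reflect (forall a b : 'I_n, block_of ns a = block_of ns b -> (a < b)%N ->
             ((u^-1)%g a < (u^-1)%g b)%N) (u \in JW ns).
Proof.
rewrite inE; apply: (iffP idP) => [/forallP h a b ab lt|h].
  have [j js ja] := in_block_exists a; have [i is_ ib] := in_block_exists b.
  have ij : i = j by apply/succn_inj; rewrite -(in_block_of ja) -(in_block_of ib) ab.
  have /forallP/(_ a)/forallP/(_ b)/implyP := h (Ordinal js); apply.
  by rewrite ij in ib; rewrite ja lt ib.
apply/forallP => j; apply/forallP => a; apply/forallP => b; apply/implyP.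
by case/and3P => /in_block_of ja /in_block_of jb; apply: h; rewrite ja jb.
Qed.

(** The quotient of the two permutations preserves every block. Both inverses increase on blocks, so
    the quotient is increasing on each block, hence trivial. *)
Lemma JW_coset_unique (u u' : 'S_n) : u \in JW ns -> u' \in JW ns ->
  (u^-1 * u')%g \in W_J ns -> u = u'.
Proof.
move=> /JWP uJ /JWP u'J /W_JP wW.
suff w1 : (u^-1 * u')%g = 1%g by rewrite -[u]mulg1 -w1 mulKVg.
apply: (mono_block_perm wW) => a b ab lt; rewrite ltnNge; apply/negP => le.
have {}le : ((u^-1 * u')%g b < (u^-1 * u')%g a)%N.
  rewrite ltn_neqAle le andbT; apply/eqP => /val_inj/perm_inj e.
  by rewrite e ltnn in lt.
have := u'J _ _ (etrans (wW b) (etrans (esym ab) (esym (wW a)))) le.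
by rewrite !permM !permK ltnNge ltnW // uJ.
Qed.

Lemma group_set_W_J : group_set (W_J ns).
Proof.
apply/group_setP; split=> [|u v /W_JP uW /W_JP vW]; apply/W_JP => a.
  by rewrite perm1.
by rewrite permM vW uW.
Qed.
Canonical W_J_group := group group_set_W_J.

(* Exchanging the values a < b of one block with v^-1 b < v^-1 a increases
   sum_a a * v^-1 a. *)
Lemma JW_coset_exists (u : 'S_n) : exists2 v, v \in JW ns & (u^-1 * v)%g \in W_J ns.
Proof.
pose f (v : 'S_n) := (\sum_(a < n) a * (v^-1)%g a)%N.
have u1 : (u^-1 * u)%g \in W_J ns by rewrite mulVg group1.
have [v vW max] := @arg_maxnP _ u (fun v => (u^-1 * v)%g \in W_J ns) f u1.
exists v => //; apply/JWP => a b ab lt; rewrite ltnNge; apply/negP => le.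
have {}le : ((v^-1)%g b < (v^-1)%g a)%N.
  rewrite ltn_neqAle le andbT; apply/eqP => /val_inj/perm_inj e.
  by rewrite e ltnn in lt.
have tW : tperm a b \in W_J ns by apply/W_JP => c; case: tpermP => // ->.
have : (f (v * tperm a b)%g <= f v)%N by apply: max; rewrite mulgA groupM.
have neq : b != a by apply: contraTneq lt => ->; rewrite ltnn.
rewrite leqNgt => /negP[]; rewrite /f.
rewrite (bigD1 a) //= (bigD1 b) //=.
rewrite [X in (_ < X)%N](bigD1 a) //= [X in (_ < _ + X)%N](bigD1 b) //=.
rewrite invMg tpermV !permM tpermL tpermR !addnA.
rewrite [X in (_ < _ + X)%N](eq_bigr (fun c : 'I_n => c * (v^-1)%g c)%N) => [|c /andP[ca cb]].
  rewrite ltn_add2r; move: lt le; clear.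
  set x := nat_of_ord _; set y := nat_of_ord _; set z := nat_of_ord _; set t := nat_of_ord _.
  nia.
by rewrite permM tpermD // eq_sym.
Qed.

End Blocks.

(** * Isomorphisms and normal bases *)

Section IsoMaps.
Variables (p : nat) (k : closedFieldType) (chk : p \in [pchar k]).

(* Isomorphisms of F-zips in terms of the lifts fz_psi of the phi_i. *)
Definition psi_iso (Z Z' : fzip chk) (f : 'Hom(fz_mod Z, fz_mod Z')) : Prop :=
  [/\ lfun_bij f,
      forall i, (f @: fz_C Z i)%VS = fz_C Z' i,
      forall i, (f @: fz_D Z i)%VS = fz_D Z' i
    & forall i x, x \in fz_C Z i ->
        fz_psi i (f x) - f (fz_psi i x) \in fz_D Z' (i - 1)].

Lemma fz_phi_qpr (Z : fzip chk) i (x : Z) :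
  fz_phi Z i (pbu (frob chk) (qpr (fz_C Z i) (fz_C Z (i + 1)) x)) =
  qpr (fz_D Z i) (fz_D Z (i - 1)) (fz_psi i x).
Proof. by rewrite /fz_psi qprK. Qed.

Lemma fzip_isoP (Z Z' : fzip chk) :
  fzip_iso Z Z' <-> exists f : 'Hom(fz_mod Z, fz_mod Z'), psi_iso f.
Proof.
have C1 (Y : fzip chk) i : (fz_C Y (i + 1) <= fz_C Y i)%VS.
  by apply: fz_C_anti; lia.
have D1 (Y : fzip chk) i : (fz_D Y (i - 1) <= fz_D Y i)%VS.
  by apply: fz_D_mono; lia.
have key (f : 'Hom(fz_mod Z, fz_mod Z')) i :
    (forall i, (f @: fz_C Z i)%VS = fz_C Z' i) ->
    (forall i, (f @: fz_D Z i)%VS = fz_D Z' i) ->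
    ((fz_phi Z' i \o pbmap (frob chk)
        (qmap (fz_C Z i) (fz_C Z (i + 1)) (fz_C Z' i) (fz_C Z' (i + 1)) f))%VF
     = (qmap (fz_D Z i) (fz_D Z (i - 1)) (fz_D Z' i) (fz_D Z' (i - 1)) f
          \o fz_phi Z i)%VF) <->
    (forall x, x \in fz_C Z i -> fz_psi i (f x) - f (fz_psi i x) \in fz_D Z' (i - 1)).
  move=> fC fD.
  have E x : x \in fz_C Z i ->
      ((fz_phi Z' i \o pbmap (frob chk)
        (qmap (fz_C Z i) (fz_C Z (i + 1)) (fz_C Z' i) (fz_C Z' (i + 1)) f))%VF
        (pbu (frob chk) (qpr (fz_C Z i) (fz_C Z (i + 1)) x))
      = (qmap (fz_D Z i) (fz_D Z (i - 1)) (fz_D Z' i) (fz_D Z' (i - 1)) f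
          \o fz_phi Z i)%VF (pbu (frob chk) (qpr (fz_C Z i) (fz_C Z (i + 1)) x)))
      <-> fz_psi i (f x) - f (fz_psi i x) \in fz_D Z' (i - 1).
    move=> xC; rewrite comp_lfunE [X in _ = X]comp_lfunE pbmapE qmapE ?fC // !fz_phi_qpr.
    rewrite qmapE ?fD ?fz_psi_mem //.
    rewrite -(@qpr_eq0 _ _ (fz_D Z' i)); last first.
      by rewrite rpredB ?fz_psi_mem // -fD memv_img // fz_psi_mem.
    by rewrite linearB /= subr_eq0; split=> /eqP.
  split=> [e x xC|h]; first by apply/(E x xC); rewrite e.
  apply: pbl_uniq => q; have [x xC <-] := qpr_surj q.
  by apply/(E x xC)/h.
split=> -[f [f1 f2 f3 f4]]; exists f; split=> // i.
  by apply/(key f i f2 f3); apply: f4.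
by apply/(key f i f2 f3); apply: f4.
Qed.

Lemma psi_iso_sym (Z Z' : fzip chk) (f : 'Hom(fz_mod Z, fz_mod Z')) :
  psi_iso f -> psi_iso (f^-1)%VF.
Proof.
move=> [fb fC fD fpsi]; have /andP[k0 /eqP s1] := fb.
have fK := lker0_lfunK k0.
have gfU (U : {vspace Z}) : (f^-1 @: (f @: U))%VS = U.
  by rewrite -limg_comp lker0_compVf // lim1g.
split.
- apply: lfun_bij_dim; last exact: esym (lfun_bij_dimE fb).
  by rewrite -s1 gfU.
- by move=> i; rewrite -fC gfU.
- by move=> i; rewrite -fD gfU.
move=> i y; rewrite -fC => /memv_imgP[x xC ->]; rewrite fK.
rewrite -[X in X - _]fK -linearB /= -[fz_D Z (i - 1)]gfU fD.
by apply: memv_img; rewrite -opprB memvN fpsi.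
Qed.

Section NormalBasis.
Variables (tau : int -> nat) (s : seq int).
Local Notation ns := (std_ns tau s).
Local Notation n := (sumn ns).
Implicit Types (u : 'S_n).

(* The image of the basis (e_a) of the standard F-zip of u under an isomorphism. *)
Definition normal_basis u (Z : fzip chk) (e : 'I_n -> fz_mod Z) : Prop :=
  [/\ \dim {: fz_mod Z} = n /\ famspan e setT = fullv,
      forall i, fz_C Z i = famspan e (std_Cset u i),
      forall i, fz_D Z i = famspan e (std_Dset tau s i)
    & forall i a, a \in std_Cset u i :\: std_Cset u (i + 1) ->
        fz_psi i (e a) - e (std_move u a) \in fz_D Z (i - 1)].

Lemma limg_famspan (V V' : vectType k) (f : 'Hom(V, V')) (e : 'I_n -> V) (P : {set 'I_n}) :
  (f @: famspan e P)%VS = famspan (fun a => f (e a)) P.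
Proof. by rewrite /famspan limg_span -map_comp. Qed.

Lemma eq_famspan (V : vectType k) (e e' : 'I_n -> V) (P : {set 'I_n}) :
  e =1 e' -> famspan e P = famspan e' P.
Proof. by move=> ee; congr span; apply: eq_map. Qed.

Lemma normal_basis_transport u (Z Z' : fzip chk) (f : 'Hom(fz_mod Z, fz_mod Z')) e :
  psi_iso f -> normal_basis u e -> normal_basis u (fun a => f (e a)).
Proof.
move=> [fb fC fD fpsi] [[dZ eT] eC eD epsi]; have /andP[_ /eqP s1] := fb.
split; first by rewrite -(lfun_bij_dimE fb) -limg_famspan eT s1.
- by move=> i; rewrite -fC eC limg_famspan.
- by move=> i; rewrite -fD eD limg_famspan.
move=> i a aC; have /setDP[aCi _] := aC.
rewrite -(subrK (f (fz_psi i (e a))) (fz_psi i _)) -addrA memvD //.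
  by apply: fpsi; rewrite eC famspan_mem.
by rewrite -linearB -fD memv_img // epsi.
Qed.

Lemma normal_basis_iso u (Z Z' : fzip chk) (e : 'I_n -> fz_mod Z) (e' : 'I_n -> fz_mod Z') :
  normal_basis u e -> normal_basis u e' -> fzip_iso Z Z'.
Proof.
move=> [[dZ eT] eC eD epsi] [[dZ' eT'] eC' eD' epsi']; apply/fzip_isoP.
pose fl (x : Z) := \sum_b famcoord e b x *: e' b.
have fllin : linear fl.
  move=> c x y; rewrite /fl scaler_sumr -big_split /=; apply: eq_bigr => b _.
  by rewrite linearP scalerDl scalerA.
pose fL := GRing.isLinear.Build _ _ _ _ fl fllin.
pose f := linfun (HB.pack_for {linear fz_mod Z -> fz_mod Z'} fl fL).
have fe a : f (e a) = e' a.
  rewrite lfunE /= /fl (bigD1 a) //= famcoord_family // eqxx scale1r big1 ?addr0 // => b ba.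
  by rewrite famcoord_family // (negbTE ba) scale0r.
have fspan P : (f @: famspan e P)%VS = famspan e' P.
  by rewrite limg_famspan; apply: eq_famspan.
exists f; split.
- apply: lfun_bij_dim; last by rewrite dZ dZ'.
  by rewrite -eT fspan eT'.
- by move=> i; rewrite eC eC' fspan.
- by move=> i; rewrite eD eD' fspan.
move=> i x; rewrite eC => /(mem_famspan eT dZ) xC.
rewrite [x](famcoord_sum eT dZ) linear_sum /=.
under [in X in X - _]eq_bigr => b _ do rewrite linearZ /= fe.
rewrite !(semilin_sum _ _ _ (@fz_psi_lin _ _ _ _ i)) linear_sum -sumrB.
apply: memv_suml => b _; rewrite linearZ /= -scalerBr.
have [bC|/xC->] := boolP (b \in std_Cset u i); last by rewrite rmorph0 scale0r mem0v.
(* For basis vectors in [C (i + 1)] both terms vanish modulo [D (i - 1)]; for the others both are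
   the standard image. *)
apply: memvZ; have [bC'|bC'] := boolP (b \in std_Cset u (i + 1)).
  apply: memvB; first by rewrite fz_psi_ker ?eC' famspan_mem.
  rewrite eD' -fspan memv_img // -eD.
  by rewrite fz_psi_ker ?eC famspan_mem.
have bD : b \in std_Cset u i :\: std_Cset u (i + 1) by rewrite inE bC bC'.
rewrite -(subrK (e' (std_move u b)) (fz_psi i (e' b))) -addrA memvD ?epsi' //.
rewrite -fe -linearB eD' -fspan memv_img // -eD -opprB memvN epsi //.
Qed.

End NormalBasis.
End IsoMaps.

Section StandardBasis.
Variables (p : nat) (p_pr : prime p) (k : closedFieldType) (chk : p \in [pchar k]).
Variables (tau : int -> nat) (s : seq int).
Local Notation n := (sumn (std_ns tau s)).
Variable u : 'S_n.

Definition std_basis (a : 'I_n) : fz_mod (std_fzip_over p_pr chk u) :=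
  pbu (Fp_emb chk) (delta_mx 0 a : 'rV['F_p]_n).

Lemma pbs_coordv (A : {set 'I_n}) : pbs (Fp_emb chk) (coordv p A) = famspan std_basis A.
Proof.
apply/eqP; rewrite eqEsubv; apply/andP; split.
  apply: pbsP => x /coordvP xA; rewrite [x]row_sum_delta.
  rewrite (semilin_sum _ _ _ (@pbu_semilinear _ _ (Fp_emb chk) _)).
  apply: memv_suml => a _; have [aA|/xA->] := boolP (a \in A).
    exact/memvZ/famspan_mem.
  by rewrite rmorph0 scale0r mem0v.
by apply/famspanP => a aA; apply: pbu_mem; rewrite delta_coordv.
Qed.

Lemma std_basis_normal : normal_basis u std_basis.
Proof.
split.
- split; first by rewrite [LHS]dim_pullback dimvf dim_matrix mul1r.
  by rewrite -pbs_coordv coordvT pbsT.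
- by move=> i; rewrite -pbs_coordv.
- by move=> i; rewrite -pbs_coordv.
move=> i a aC; have /setDP[aCi _] := aC.
have mD : std_move u a \in std_Dset tau s i.
  have := std_block p_pr u i (std_move u a).
  by rewrite /std_move !permKV aC => /esym/setDP[].
set Z := std_fzip_over p_pr chk u.
have Ea : fz_phi Z i (pbu (frob chk) (qpr (fz_C Z i) (fz_C Z (i + 1)) (std_basis a)))
    = qpr (fz_D Z i) (fz_D Z (i - 1)) (std_basis (std_move u a)).
  rewrite /= bc_phiE ?delta_coordv //.
    rewrite std_phiE // bc_quotE ?delta_coordv //.
  - by apply/coordvS/std_CsetS; lia.
rewrite /fz_psi Ea -opprB memvN; apply: qpr_subK.
by rewrite [fz_D _ _]pbs_coordv famspan_mem.
Qed.

End StandardBasis.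

Lemma psum_x_block (ns : seq nat) (a b : 'I_(sumn ns)) :
  block_of ns a = block_of ns b ->
  forall l, (psum ns l <= x_perm ns a)%N = (psum ns l <= x_perm ns b)%N.
Proof.
move=> ab l; have [j js ja] := in_block_exists a.
have jb : in_block ns j.+1 b.
  have [i is_ ib] := in_block_exists b.
  suff -> : j = i by [].
  by apply/succn_inj; rewrite -(in_block_of ja) -(in_block_of ib).
move: ja jb; rewrite !in_block_x => /andP[a1 a2] /andP[b1 b2].
have [lj|jl] := leqP l j.
  by rewrite !(leq_trans (psum_leq ns lj)).
have h (c : 'I_(sumn ns)) : (x_perm ns c < psum ns j.+1)%N ->
    (psum ns l <= x_perm ns c)%N = false.
  by move=> cj; rewrite leqNgt (leq_trans cj) // psum_leq.
by rewrite !h.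
Qed.

(** * Dimensions and blocks determined by the type *)

Section Index.
Variables (tau : int -> nat) (s : seq int).
Hypothesis s_sorted : sorted <%R s.
Hypothesis s_support : forall i : int, (i \in s) = (tau i != 0%N).
Local Notation ns := (std_ns tau s).
Local Notation n := (sumn ns).

(** This is the dimension that type [tau] forces on [C^i], written with the count that occurs in
    [std_Cset]. *)
Definition std_dim (i : int) : nat := psum ns (size s - count (fun l => (l < i)%R) s).

Lemma drop_count_lt (t : seq int) (i : int) : sorted <%R t ->
  drop (count (fun l => (l < i)%R) t) t = [seq l <- t | i <= l].
Proof.
elim: t => //= x t IH xt; have [xi|ix] /= := ltrP x i.
  by rewrite /= IH // (path_sorted xt).
have all_ge : all (fun l => i <= l) t.
  have /allP h := order_path_min lt_trans xt.
  by apply/allP => l /h; move/ltW; apply: le_trans.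
rewrite (all_filterP all_ge) (_ : count _ _ = 0%N) //.
apply/eqP; rewrite -leqn0 leqNgt -has_count -all_predC.
by apply: sub_all all_ge => l /=; rewrite leNgt.
Qed.

Lemma std_dimE i : std_dim i = (\sum_(l <- s | (i <= l)%R) tau l)%N.
Proof.
rewrite /std_dim /psum /std_ns -map_take take_rev subKn ?count_size //.
by rewrite map_rev sumn_rev drop_count_lt // sumnE big_map big_filter.
Qed.

Lemma std_dim_step i : std_dim i = (std_dim (i + 1) + tau i)%N.
Proof.
have su : uniq s by apply: sorted_uniq s_sorted; [exact: lt_trans|exact: ltxx].
rewrite !std_dimE; have [is_|/negP nis] := boolP (i \in s).
  rewrite (bigID (pred1 i)) /= addnC; congr (_ + _)%N.
    by apply: eq_bigl => l; lia.
  rewrite (eq_bigl (pred1 i)) => [|l /=].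
    by rewrite big_mkcond (bigD1_seq i) //= eqxx big1 ?addn0 // => l /negbTE->.
  by have [->|] := eqVneq l i; rewrite ?lexx ?andbF.
rewrite (_ : tau i = 0%N); last first.
  by apply/eqP; apply: contrapT => /negP h; apply: nis; rewrite s_support.
rewrite addn0 big_seq_cond [RHS]big_seq_cond; apply: eq_bigl => l.
case: (l \in s) / boolP => //= ls; have : l != i by apply/eqP => li; rewrite -li in nis.
lia.
Qed.

(** Every step of the flag occurs at some filtration index, so the filtration detects every block
    boundary. *)
Lemma count_lt_surj (t : seq int) (j : nat) : sorted <%R t -> (j <= size t)%N ->
  exists i : int, count (fun l => (l < i)%R) t = j.
Proof.
elim: t j => [|x t IH] j /=; first by rewrite leqn0 => _ /eqP->; exists 0.
move=> xt; have /allP xmin := order_path_min lt_trans xt.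
have count0 i : i <= x + 1 -> count (fun l => (l < i)%R) t = 0%N.
  move=> ix; apply/eqP; rewrite -leqn0 leqNgt -has_count; apply/hasPn => l /xmin; lia.
case: j => [_|j]; first by exists x; rewrite ltxx count0 //; lia.
rewrite ltnS => /(IH _ (path_sorted xt))[i ij].
have [xi|ix] := ltrP x i; first by exists i; rewrite xi ij.
exists (x + 1); rewrite count0 ?lexx // (_ : x < x + 1 = true); last by apply/idP; lia.
by rewrite -ij count0 //; lia.
Qed.

Lemma mem_std_Cset (u : 'S_n) i (b : 'I_n) : (u b \in std_Cset u i) = (b < std_dim i)%N.
Proof. by rewrite mem_imset ?inE //; apply: perm_inj. Qed.

Variables (p : nat) (p_pr : prime p).

(** After applying [x], the sets defining [D] are cut out by the same thresholds as those defining
    [C]. *)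
Lemma mem_std_Dset i (a : 'I_n) : (a \in std_Dset tau s i) = (std_dim (i + 1) <= x_perm ns a)%N.
Proof.
have := std_CD p_pr (1%g : 'S_n) (i + 1) a.
by rewrite mem_std_Cset addrK ltnNge => /negb_inj.
Qed.

(** The blocks of [W_J] are the graded pieces of [D]. This is how a statement about [D] becomes one
    about cosets. *)
Lemma std_Dset_block (a b : 'I_n) :
  block_of ns a = block_of ns b <->
  (forall i, (a \in std_Dset tau s i) = (b \in std_Dset tau s i)).
Proof.
split=> [ab i|h]; first by rewrite !mem_std_Dset; apply: psum_x_block.
have key j : (j <= size s)%N -> (psum ns j <= x_perm ns a)%N = (psum ns j <= x_perm ns b)%N.
  move=> js; have [i ij] := count_lt_surj s_sorted (leq_subr j (size s)).
  have := h (i - 1); rewrite !mem_std_Dset subrK /std_dim.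
  by rewrite ij subKn.
have [j + ja] := in_block_exists a; rewrite size_std_ns => js.
rewrite (in_block_of ja); symmetry; apply: in_block_of; move: ja.
by rewrite !in_block_x key ?(ltnW js) // !ltnNge key.
Qed.

Lemma std_dim_full : exists i0, forall i, i <= i0 -> std_dim i = n.
Proof.
have [[a b] /= h] := std_bounds p_pr s; exists a => i ia.
rewrite /std_dim (_ : count _ _ = 0%N).
  by rewrite subn0 -(size_std_ns tau) /psum take_size.
apply/eqP; rewrite -leqn0 leqNgt -has_count; apply/hasPn => l /h /andP[al _].
by rewrite -leNgt; apply/ltW/(le_lt_trans ia).
Qed.

Lemma std_dim_zero : exists i0, forall i, i0 <= i -> std_dim i = 0%N.
Proof.
have [[a b] /= h] := std_bounds p_pr s; exists b => i ib.
rewrite /std_dim (_ : count _ _ = size s); first by rewrite subnn /psum take0.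
by apply/eqP; rewrite -all_count; apply/allP => l /h /andP[_ /lt_le_trans]; apply.
Qed.

Variables (K : fieldType) (chK : p \in [pchar K]).

Lemma fz_C_dim (Z : fzip chK) : fzip_type tau Z -> forall i, \dim (fz_C Z i) = std_dim i.
Proof.
move=> Ztau; have [b1 h1] := fz_C_zero Z; have [b2 h2] := std_dim_zero.
(* The sign turns the upward induction into one descending from the indices where [C] vanishes. *)
suff h i : \dim (fz_C Z (- i)) = std_dim (- i) by move=> i; rewrite -[i]opprK.
move: i; apply: (@int_ind_up _ (- (Num.max b1 b2))) => [i ib|i IH].
  by rewrite h1 ?h2 ?dimv0 //; lia.
have e : - i + 1 = - (i - 1) by lia.
rewrite std_dim_step e -IH -e -(Ztau (- i)) addnC; apply/esym/dim_quot.
by have := fz_C_desc Z (- i + 1); rewrite addrK.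
Qed.

Lemma fz_dim (Z : fzip chK) : fzip_type tau Z -> \dim {: fz_mod Z} = n.
Proof.
move=> Ztau; have [a1 h1] := fz_C_full Z; have [a2 h2] := std_dim_full.
by rewrite -(h1 (Num.min a1 a2)) ?fz_C_dim ?h2 //; lia.
Qed.

Lemma std_fzip_type (u : 'S_n) : fzip_type tau (std_fzip p_pr u).
Proof.
move=> i; have cC j : \dim (std_C p u j) = std_dim j.
  rewrite dim_coordv card_imset; last exact: perm_inj.
  by rewrite card_ord_lt // psum_le_sum.
have sC : (std_C p u (i + 1) <= std_C p u i)%VS.
  by have := std_C_desc p_pr u (i + 1); rewrite addrK.
apply/eqP; rewrite -(eqn_add2r (\dim (std_C p u (i + 1)))) dim_quot // !cC.
by rewrite std_dim_step addnC.
Qed.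

End Index.

(** * Existence and uniqueness of the normal form *)

Section Classification.
Variables (p : nat) (p_pr : prime p) (k : closedFieldType) (chk : p \in [pchar k]).
Variables (tau : int -> nat) (s : seq int).
Hypothesis s_sorted : sorted <%R s.
Hypothesis s_support : forall i : int, (i \in s) = (tau i != 0%N).
Local Notation ns := (std_ns tau s).
Local Notation n := (sumn ns).

(** With [u = x^-1] after theta and [e (u b) = v b], the relation between [v (theta b)] and [v b]
    becomes the standard one, since [std_move (u (theta b)) = x^-1 (theta b) = u b]. *)
Theorem normal_basis_exists (Z : fzip chk) : fzip_type tau Z ->
  exists2 u : 'S_n, u \in JW ns & exists e : 'I_n -> fz_mod Z, normal_basis u e.
Proof.
move=> Ztau; have dZ := fz_dim s_sorted s_support p_pr Ztau.
have dC := fz_C_dim s_sorted s_support p_pr Ztau.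
have Ls := canonical_chainP Z.
have [v [vT vC vD vpsi]] := normal_positions Ls.
pose w := pos_word Ls; pose theta := pos_theta Ls.
have ltN (b : 'I_n) : (b < \dim {: fz_mod Z})%N by rewrite dZ.
have thlt (b : 'I_n) : (theta b < n)%N by have := pos_theta_lt Ls (ltN b); rewrite dZ.
pose th0 (b : 'I_n) := Ordinal (thlt b).
have th0I : injective th0.
  by move=> b b' /(congr1 val) /= /pos_theta_inj h; apply/val_inj/h.
pose th := perm th0I.
have thE b : th b = theta b :> nat by rewrite permE.
pose u := (th * (x_perm ns)^-1)%g.
have xu b : x_perm ns (u b) = th b by rewrite permM permKV.
have wblock (b : 'I_n) : (std_dim tau s (w b + 1) <= th b < std_dim tau s (w b))%N.
  by rewrite thE -!dC pos_theta_block.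
pose e (a : 'I_n) := v ((u^-1)%g a).
have eu b : e (u b) = v b by rewrite /e permK.
have span_mk (m : nat) (P : {set 'I_n}) : (m <= n)%N ->
    (forall b, (u b \in P) = (b < m)%N) -> <<mkseq v m>>%VS = famspan e P.
  move=> mn hP; apply/eqP; rewrite eqEsubv; apply/andP; split.
    apply/span_subvP => _ /mapP[j + ->]; rewrite mem_iota add0n /= => jm.
    have jn : (j < n)%N by apply: leq_trans mn.
    by rewrite -(eu (Ordinal jn)); apply: famspan_mem; rewrite hP.
  apply/famspanP => a; rewrite -[a](permKV u) hP eu => am.
  by apply/memv_span/map_f; rewrite mem_iota add0n.
exists u.
  apply/JWP => a b ab lt; pose b1 := (u^-1)%g a; pose b2 := (u^-1)%g b.
  have xab : (th b1 < th b2)%N.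
    rewrite -!xu !permKV; have [j _ ja] := in_block_exists a.
    apply: (x_perm_mono ja) => //; have [i _ ib] := in_block_exists b.
    suff <- : i = j by [].
    by apply/succn_inj; rewrite -(in_block_of ja) -(in_block_of ib).
  have pE l : (psum ns l <= th b1)%N = (psum ns l <= th b2)%N.
    by rewrite -!xu !permKV; apply: psum_x_block.
  (* Positions whose theta-images lie between the same thresholds belong to the same graded piece of
     [C], which determines the index and makes [pos_theta_mono] applicable. *)
  have ww : w b1 = w b2.
    apply: (@C_block_unique p k chk Z _ _ (th b1)); rewrite !dC ?wblock //.
    have := wblock b2; rewrite !ltnNge /std_dim -!pE //.
  rewrite ltnNge; apply/negP => le.
  have {}le : (b2 < b1)%N.
    rewrite ltn_neqAle le andbT; apply/eqP => /val_inj b12.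
    by rewrite b12 ltnn in xab.
  have : (theta b2 < theta b1)%N by apply: pos_theta_mono le (ltN b1) (esym ww).
  by rewrite -!thE ltnNge ltnW.
exists e; split.
- split=> //; rewrite -(span_mk n) -?dZ // => b; by rewrite inE ltn_ord.
- move=> i; rewrite vC dC; apply: span_mk => [|b]; first exact: psum_le_sum.
  exact: mem_std_Cset.
- move=> i; rewrite vD.
  have memD b : (u b \in std_Dset tau s i) = (w b <= i).
    rewrite (mem_std_Dset p_pr) xu; have /andP[h1 h2] := wblock b; apply/idP/idP => [h|wi].
      rewrite leNgt; apply/negP => iw.
      have := leq_ltn_trans h h2; rewrite -!dC ltnNge => /negP[].
      by apply/dimvS/fz_C_anti; lia.
    apply: leq_trans h1; rewrite -!dC; apply/dimvS/fz_C_anti; lia.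
  apply/eqP; rewrite eqEsubv; apply/andP; split.
    apply/span_subvP => _ /mapP[j + ->]; rewrite mem_filter mem_iota add0n /= => /andP[wj jN].
    have jn : (j < n)%N by rewrite -dZ.
    by rewrite -(eu (Ordinal jn)); apply: famspan_mem; rewrite memD.
  apply/famspanP => a; rewrite -[a](permKV u) memD eu => wa.
  by apply/memv_span/map_f; rewrite mem_filter wa mem_iota add0n /= ltN.
move=> i a; rewrite -[a](permKV u); set b' := (u^-1)%g a.
rewrite in_setD !mem_std_Cset -leqNgt => hb'.
pose b := (th^-1)%g b'; have tb : th b = b' by rewrite permKV.
have wi : w b = i.
  by apply: (@C_block_unique p k chk Z _ _ b'); rewrite !dC // -tb wblock.
have -> : std_move u (u b') = u b by rewrite /std_move permK -tb -xu permK.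
rewrite !eu -wi -tb thE; exact: vpsi.
Qed.

(** * The operators [R_i] on the flag of a normal basis *)

Section NormalBasisPull.
Variables (Z : fzip chk) (u : 'S_n) (e : 'I_n -> fz_mod Z).
Hypothesis uJ : u \in JW ns.
Hypothesis eN : normal_basis u e.

Let v (b : 'I_n) : fz_mod Z := e (u b).
Local Notation F a := (famspan v [set b : 'I_n | (b < a)%N]).
Let theta (b : 'I_n) : 'I_n := x_perm ns (u b).
Let dg (b : 'I_n) (i : int) : bool := u b \in std_Dset tau s i :\: std_Dset tau s (i - 1).

Let v_famspan (P : {set 'I_n}) : famspan e (u @: P) = famspan v P.
Proof.
apply/eqP; rewrite eqEsubv; apply/andP; split; apply/famspanP.
  by move=> _ /imsetP[b bP ->]; apply: (famspan_mem v bP).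
by move=> b bP; apply: (famspan_mem e); apply: imset_f.
Qed.

Let dimZ : \dim {: fz_mod Z} = n. Proof. by have [[]] := eN. Qed.

Let vfull : famspan v setT = fullv.
Proof.
have [[_ <-] _ _ _] := eN; rewrite -v_famspan; congr famspan.
by apply/setP => a; rewrite inE -[a](permKV u) imset_f.
Qed.

Lemma normal_C i : fz_C Z i = F (std_dim tau s i).
Proof. by have [_ -> _ _] := eN; rewrite -v_famspan. Qed.

Let v_D i : fz_D Z i = famspan v [set b | u b \in std_Dset tau s i].
Proof.
have [_ _ -> _] := eN; rewrite -v_famspan; congr famspan.
apply/setP => a; rewrite -[a](permKV u) mem_imset ?inE //; exact: perm_inj.
Qed.

Let theta_block b i : dg b i = (std_dim tau s (i + 1) <= theta b < std_dim tau s i)%N.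
Proof. by rewrite /dg in_setD !(mem_std_Dset p_pr) subrK -ltnNge andbC. Qed.

Let theta_inj : injective theta.
Proof. by move=> b b' /perm_inj/perm_inj. Qed.

Let theta_surj (b : 'I_n) : exists d, theta d = b.
Proof.
by exists ((u^-1)%g (((x_perm ns)^-1)%g b)); rewrite /theta !permKV.
Qed.

Let v_psi b i : dg b i -> fz_psi i (v (theta b)) - v b \in fz_D Z (i - 1).
Proof.
move=> bi; have [_ _ _ h] := eN; have := h i (u (theta b)).
by rewrite (std_block p_pr) std_moveK; apply.
Qed.

(** Positions with the same index have their [u]-values in one block. There [u] preserves order
    because [u] is in [JW], and so does [x]. *)
Let theta_mono b b' i : dg b i -> dg b' i -> (b < b')%N -> (theta b < theta b')%N.
Proof.
move=> bi b'i lt; have bl : block_of ns (u b) = block_of ns (u b').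
  apply/(std_Dset_block s_sorted p_pr) => j.
  have [ij|ji] := lerP i j.
    by rewrite !(subsetP (std_DsetS tau s ij)) //; [case/setDP: b'i|case/setDP: bi].
  have no c : dg c i -> (u c \in std_Dset tau s j) = false.
    case/setDP => _ h; apply/negP => cj; case/negP: h.
    by apply: (subsetP (std_DsetS tau s _)) cj; lia.
  by rewrite !no.
have [j _ jb] := in_block_exists (u b); have [i' _ jb'] := in_block_exists (u b').
have ij : i' = j by apply/succn_inj; rewrite -(in_block_of jb) -(in_block_of jb').
rewrite ij in jb'; apply: (x_perm_mono jb jb').
rewrite ltnNge; apply/negP => le.
have {}le : (u b' < u b)%N.
  rewrite ltn_neqAle le andbT; apply/eqP => /val_inj/perm_inj e'.
  by rewrite e' ltnn in lt.
have /JWP/(_ _ _ (esym bl) le) := uJ.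
by rewrite !permK ltnNge ltnW.
Qed.

Local Notation fcoord := (famcoord v).

(** Modulo [D (i - 1)], which has no coordinate at [d], the map [psi_i] permutes basis vectors of
    [C i] outside [C (i + 1)] and kills the rest. *)
Let coord_psi x i d : x \in fz_C Z i -> dg d i ->
  fcoord d (fz_psi i x) = frob chk (fcoord (theta d) x).
Proof.
rewrite normal_C => /(mem_famspan vfull dimZ) xC di.
have coordD y b : y \in fz_D Z (i - 1) -> dg b i -> fcoord b y = 0.
  rewrite v_D => /(mem_famspan vfull dimZ) h /setDP[_ bD].
  by apply: h; rewrite inE.
rewrite {1}[x](famcoord_sum vfull dimZ) (semilin_sum _ _ _ (@fz_psi_lin _ _ _ _ i)).
rewrite linear_sum /= (bigD1 (theta d)) //= [X in _ + X]big1 ?addr0; last first.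
  move=> b bd; rewrite linearZ /=.
  have [bC|bC] := boolP (b < std_dim tau s i)%N; last first.
    by rewrite [famcoord _ _ _]xC ?inE // rmorph0 mul0r.
  have [b1|b1] := boolP (b < std_dim tau s (i + 1))%N.
    by rewrite [X in _ * X]coordD ?mulr0 // fz_psi_ker normal_C famspan_mem // inE.
  have [d' Ed'] := theta_surj b.
  have d'i : dg d' i by rewrite theta_block Ed' leqNgt b1 bC.
  have := coordD _ d (v_psi d'i) di.
  rewrite linearB /= [fcoord d (v d')]famcoord_family // Ed'.
  by case: (d =P d') bd => [->|_ _ /eqP]; rewrite ?Ed' ?eqxx // subr0 => /eqP->; rewrite mulr0.
rewrite linearZ /=; have := coordD _ d (v_psi di) di.
rewrite linearB /= [fcoord d (v d)]famcoord_family // eqxx => /eqP.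
by rewrite subr_eq0 => /eqP->; rewrite mulr1.
Qed.

(** By [coord_psi], a vector of [C i] lies in [R_i(F a)] exactly when its coordinates at [theta d]
    vanish for all [d >= a] of index [i]; the remaining positions form this set. *)
Let pull_set i a : {set 'I_n} := [set b : 'I_n | (b < std_dim tau s i)%N &
   [forall d, dg d i ==> (a <= d)%N ==> (theta d != b)]].

Let pull_famspan i a : fz_pull i (F a) = famspan v (pull_set i a).
Proof.
apply/vspaceP => x; rewrite fz_pullP.
have [xC|xC] := boolP (x \in fz_C Z i); last first.
  apply/esym/negP => h; case/negP: xC; rewrite normal_C.
  by apply: (subvP (famspanS _ _)) h; apply/subsetP => b; rewrite !inE => /andP[].
rewrite /= v_D famspan_add.
have /(mem_famspan vfull dimZ) psiD :
    fz_psi i x \in famspan v [set b | u b \in std_Dset tau s i].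
  by rewrite -v_D fz_psi_mem.
have xC' := xC; rewrite normal_C in xC'.
apply/(mem_famspan vfull dimZ)/(mem_famspan vfull dimZ) => h b.
  rewrite inE negb_and => /orP[bC|].
    by have /(mem_famspan vfull dimZ) := xC'; apply; rewrite inE.
  rewrite negb_forall => /existsP[d]; rewrite negb_imply negb_imply negbK.
  case/and3P => di ad /eqP <-.
  have : fcoord d (fz_psi i x) = 0.
    apply: h; rewrite in_setU negb_or; apply/andP; split; rewrite in_set -?leqNgt //.
    by case/setDP: di.
  by rewrite coord_psi // => /eqP; rewrite fmorph_eq0 => /eqP.
rewrite in_setU negb_or => /andP[]; rewrite in_set -leqNgt => ab; rewrite in_set => bD.
have [bDi|bDi] := boolP (u b \in std_Dset tau s i); last by apply: psiD; rewrite inE.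
have bi : dg b i by rewrite /dg inE bD bDi.
rewrite coord_psi // [fcoord _ _]h ?rmorph0 //.
rewrite inE negb_and; apply/orP; right; rewrite negb_forall; apply/existsP; exists b.
by rewrite bi ab eqxx.
Qed.

(** The excluded positions are images under theta of positions [d >= a] of index [i]. As theta is
    increasing there, they lie above all other positions of the block. Thus [R_i] maps the flag to
    itself. *)
Let pull_set_down i a (b b' : 'I_n) : b \in pull_set i a -> (b' <= b)%N -> b' \in pull_set i a.
Proof.
rewrite !inE => /andP[bC /forallP bP] b'b; rewrite (leq_ltn_trans b'b) //=.
apply/forallP => d'; apply/implyP => d'i; apply/implyP => ad'; apply/eqP => Ed'.
have [d Ed] := theta_surj b.
have di : dg d i.
  rewrite theta_block Ed bC andbT; move: d'i; rewrite theta_block => /andP[h _].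
  by apply: leq_trans h _; rewrite Ed'.
have := bP d; rewrite di Ed eqxx implybF /= -ltnNge => da.
have := theta_mono di d'i (leq_trans da ad'); rewrite Ed Ed'.
by rewrite ltnNge b'b.
Qed.

Lemma normal_pull i a : exists2 c, (c <= n)%N & fz_pull i (F a) = F c.
Proof.
exists #|pull_set i a|; first by rewrite -[X in (_ <= X)%N]card_ord max_card.
by rewrite pull_famspan {1}(down_closed_set (@pull_set_down i a)).
Qed.

Lemma normal_dim a : (a <= n)%N -> \dim (F a) = a.
Proof. by move=> an; rewrite (dim_famspan vfull dimZ) card_ord_lt. Qed.

(** The vector [v (theta b)] separates the two: its image is [v b] modulo [D (i - 1)]. *)
Lemma normal_jump b i a a' : dg b i -> (a <= b < a')%N ->
  ~~ (fz_pull i (F a') <= fz_pull i (F a))%VS.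
Proof.
move=> bi /andP[ab ba']; apply/negP => /subvP/(_ (v (theta b))).
rewrite !pull_famspan famspan_mem; last first.
  move: (bi); rewrite inE theta_block => /andP[_ ->] /=.
  apply/forallP => d; apply/implyP => _; apply/implyP => a'd; apply/eqP => /theta_inj db.
  by move: a'd; rewrite db leqNgt ba'.
move/(_ isT)/(mem_famspan vfull dimZ)/(_ (theta b)).
rewrite famcoord_family // eqxx => h; have /eqP := oner_neq0 k; apply; apply: h.
rewrite inE negb_and; apply/orP; right; rewrite negb_forall; apply/existsP; exists b.
by rewrite bi ab eqxx.
Qed.

End NormalBasisPull.

Theorem normal_basis_unique (Z : fzip chk) (u u' : 'S_n) (e e' : 'I_n -> fz_mod Z) :
  u \in JW ns -> u' \in JW ns -> normal_basis u e -> normal_basis u' e' -> u = u'.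
Proof.
move=> uJ u'J eN e'N.
pose F a := famspan (fun b => e (u b)) [set b : 'I_n | (b < a)%N].
pose F' a := famspan (fun b => e' (u' b)) [set b : 'I_n | (b < a)%N].
pose L U := exists a, [/\ (a <= n)%N, U = F a & U = F' a].
have Ls : stable_chain L.
  split.
  - move=> U U' [a [an -> _]] [a' [a'n -> _]].
    have mono c c' : (c <= c')%N -> (F c <= F c')%VS.
      move=> cc'; apply/famspanS/subsetP => b; rewrite !inE => /leq_trans; exact.
    by case/orP: (leq_total a a') => /mono; auto.
  - move=> i; exists (std_dim tau s i); split; first exact: psum_le_sum.
      exact: normal_C eN i.
    exact: normal_C e'N i.
  - move=> i U [a [an UF UF']].
    have [c cn Ec] := normal_pull uJ eN i a; have [c' c'n Ec'] := normal_pull u'J e'N i a.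
    have cc' : c = c'.
      by rewrite -(normal_dim eN cn) -(normal_dim e'N c'n) -Ec -Ec' -/(F a) -/(F' a) -UF -UF'.
    by exists c; split=> //; [rewrite UF|rewrite UF' cc'].
have [[dZ _] _ _ _] := eN.
have stepF a : chain_dim L a -> chain_step L a = F a /\ chain_step L a = F' a.
  move=> /chain_stepP[[c [cn E1 E2]] da].
  have ca : c = a by rewrite -da E1 (normal_dim eN).
  by rewrite -ca in E1 E2 *; split.
(* The index of the graded piece of [D] containing [e (u b)] is read off from the common chain [L]
   alone, so it is the same for the second basis. *)
have wE (b : 'I_n) i :
    u b \in std_Dset tau s i :\: std_Dset tau s (i - 1) -> i = pos_word Ls b.
  move=> bi; have bN : (b < \dim {: fz_mod Z})%N by rewrite dZ.
  apply: (pos_word_unique Ls bN).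
  have [Ah _ _] := chain_hiP Ls bN; have [Al _ _] := chain_loP Ls b.
  have [-> _] := stepF _ Ah; have [-> _] := stepF _ Al.
  exact: (normal_jump eN) bi (chain_lo_hi_bounds Ls bN).
have wE' (b : 'I_n) i :
    u' b \in std_Dset tau s i :\: std_Dset tau s (i - 1) -> i = pos_word Ls b.
  move=> bi; have bN : (b < \dim {: fz_mod Z})%N by rewrite dZ.
  apply: (pos_word_unique Ls bN).
  have [Ah _ _] := chain_hiP Ls bN; have [Al _ _] := chain_loP Ls b.
  have [_ ->] := stepF _ Ah; have [_ ->] := stepF _ Al.
  exact: (normal_jump e'N) bi (chain_lo_hi_bounds Ls bN).
(* Each position enters the ascending sets [std_Dset] at exactly one index; knowing that index
   determines membership for all [i]. *)
have Dw (f : 'I_n -> 'I_n) : (forall (b : 'I_n) i,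
    f b \in std_Dset tau s i :\: std_Dset tau s (i - 1) -> i = pos_word Ls b) ->
    forall b i, (f b \in std_Dset tau s i) = (pos_word Ls b <= i).
  move=> fw b i; have [a0 h0] := std_dim_full tau s p_pr.
  have [b0 h1] := std_dim_zero tau s p_pr.
  apply/idP/idP.
    move: i; apply: (@int_ind_up _ (a0 - 1)) => [i ia|i IH fi].
      rewrite (mem_std_Dset p_pr) h0; last lia.
      by rewrite leqNgt ltn_ord.
    have [/IH|fi'] := boolP (f b \in std_Dset tau s (i - 1)); first lia.
    by rewrite -(fw b i) // inE fi' fi.
  move=> wi; apply: contraT => fi.
  suff h j : f b \notin std_Dset tau s j.
    have := h (Num.max b0 i); rewrite (mem_std_Dset p_pr) h1 //; lia.
  move: j; apply: (@int_ind_up _ i) => [j ji|j IH].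
    by apply: contra fi; apply: (subsetP (std_DsetS tau s ji)).
  have [ji|ij] := lerP j i; first by apply: contra fi; apply: (subsetP (std_DsetS tau s ji)).
  apply/negP => fj; have : j = pos_word Ls b by apply: fw; rewrite inE IH fj.
  lia.
apply: (JW_coset_unique uJ u'J); apply/W_JP => a.
apply/(std_Dset_block s_sorted p_pr) => i.
by rewrite -[a in RHS](permKV u) permM (Dw _ wE) (Dw _ wE').
Qed.

End Classification.

Lemma block_of_eqP (ns : seq nat) (a b : 'I_(sumn ns)) :
  block_of ns a = block_of ns b <->
  (forall l, (l <= size ns)%N -> (sumn ns - psum ns l <= a)%N = (sumn ns - psum ns l <= b)%N).
Proof.
split=> [ab l _|h].
  have := psum_x_block ab l; rewrite !permE /= ![(psum ns l <= _)%N]leqNgt.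
  by rewrite !x_val_psum // => /negb_inj.
have [j js ja] := in_block_exists a.
rewrite (in_block_of ja); symmetry; apply: in_block_of; move: ja.
by rewrite /in_block /= h // ![(_ < sumn ns - _)%N]ltnNge h // ltnW.
Qed.

(** * Reversing the order of the blocks *)

Section Reversal.
Variable ns : seq nat.
Local Notation m := (sumn (rev ns)).
Local Notation n := (sumn ns).

Definition rev_pos (a : 'I_m) : 'I_n := rev_ord (cast_ord (sumn_rev ns) a).
Definition rev_pos_inv (b : 'I_n) : 'I_m := cast_ord (esym (sumn_rev ns)) (rev_ord b).

Lemma rev_posK : cancel rev_pos rev_pos_inv.
Proof. by move=> a; rewrite /rev_pos /rev_pos_inv rev_ordK cast_ordK. Qed.

Lemma rev_pos_invK : cancel rev_pos_inv rev_pos.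
Proof. by move=> a; rewrite /rev_pos /rev_pos_inv cast_ordKV rev_ordK. Qed.

Lemma rev_pos_block (a b : 'I_m) :
  block_of ns (rev_pos a) = block_of ns (rev_pos b) <->
  block_of (rev ns) a = block_of (rev ns) b.
Proof.
(* Reversal turns lying at or above the boundary number [l] into lying below the boundary number
   [size ns - l]. *)
have E l (c : 'I_m) : (l <= size ns)%N ->
    (n - psum ns l <= rev_pos c)%N = ~~ (m - psum (rev ns) (size ns - l) <= c)%N.
  move=> ls; rewrite /psum take_rev subKn // [X in (X - _ <= c)%N]sumn_rev.
  rewrite [sumn (rev (drop _ _))]sumn_rev -ltnNge /=.
  have cn : (c < n)%N by rewrite -[X in (_ < X)%N](sumn_rev ns).
  have : (sumn (take l ns) + sumn (drop l ns) = n)%N by rewrite -sumn_cat cat_take_drop.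
  by move: cn; clear; set x := nat_of_ord _; lia.
rewrite !block_of_eqP size_rev; split=> h l ls.
  have := h (size ns - l)%N (leq_subr _ _); rewrite !E ?leq_subr // subKn //.
  exact: negb_inj.
by rewrite !E // h ?leq_subr.
Qed.

Fact rev_perm_subproof (w : 'S_m) : injective (fun b => rev_pos (w (rev_pos_inv b))).
Proof. exact: inj_comp (can_inj rev_posK) (inj_comp perm_inj (can_inj rev_pos_invK)). Qed.

Definition rev_perm (w : 'S_m) : 'S_n := perm (@rev_perm_subproof w).

Lemma rev_permE w b : rev_perm w b = rev_pos (w (rev_pos_inv b)).
Proof. by rewrite permE. Qed.

Lemma rev_permM (w w' : 'S_m) : rev_perm (w * w')%g = (rev_perm w * rev_perm w')%g.
Proof. by apply/permP => b; rewrite permM !rev_permE rev_posK permM. Qed.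

Lemma rev_permV (w : 'S_m) : rev_perm (w^-1)%g = ((rev_perm w)^-1)%g.
Proof.
apply/(mulgI (rev_perm w)); rewrite mulgV -rev_permM mulgV.
by apply/permP => b; rewrite rev_permE !perm1 rev_pos_invK.
Qed.

Lemma rev_perm_inj : injective rev_perm.
Proof.
move=> w w' e; apply/permP => a; apply: (can_inj rev_posK).
by have := congr1 (fun v : 'S_n => v (rev_pos a)) e; rewrite !rev_permE rev_posK.
Qed.

Lemma rev_perm_surj (v : 'S_n) : exists w, rev_perm w = v.
Proof.
have fI : injective (fun a => rev_pos_inv (v (rev_pos a))).
  exact: inj_comp (can_inj rev_pos_invK) (inj_comp perm_inj (can_inj rev_posK)).
by exists (perm fI); apply/permP => b; rewrite rev_permE permE !rev_pos_invK.
Qed.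

Lemma rev_perm_W_J (w : 'S_m) : (rev_perm w \in W_J ns) = (w \in W_J (rev ns)).
Proof.
apply/W_JP/W_JP => h a.
  by apply/rev_pos_block; have := h (rev_pos a); rewrite rev_permE rev_posK.
by rewrite -[a]rev_pos_invK rev_permE rev_posK; apply/rev_pos_block.
Qed.

Lemma rev_perm_lcoset (w : 'S_m) :
  [set rev_perm x | x in (w *: W_J (rev ns))%g] = (rev_perm w *: W_J ns)%g.
Proof.
apply/setP => v; have [x <-] := rev_perm_surj v.
rewrite mem_imset; last exact: rev_perm_inj.
by rewrite !mem_lcoset -rev_permV -rev_permM rev_perm_W_J.
Qed.

End Reversal.

(** Conjugation by the reversal of positions relates the two orders in which the [n_j] can be
    listed: that of the support of [tau] and the opposite one, imposed by the flags of the standard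
    F-zips. *)
Lemma W_J_cosets_rev (ns ms : seq nat) : ms = rev ns ->
  exists h : {set 'S_(sumn ms)} -> {set 'S_(sumn ns)},
  [/\ injective h, forall X, X \in W_J_cosets ms -> h X \in W_J_cosets ns
    & forall Y, Y \in W_J_cosets ns -> exists2 X, X \in W_J_cosets ms & h X = Y].
Proof.
move=> ->; exists (fun X : {set 'S_(sumn (rev ns))} => [set @rev_perm ns x | x in X]); split.
- exact: imset_inj (@rev_perm_inj ns).
- move=> _ /lcosetsP[w _ ->]; rewrite rev_perm_lcoset; apply/lcosetsP.
  by exists (rev_perm w).
move=> _ /lcosetsP[v _ ->]; have [w <-] := rev_perm_surj v.
by exists (w *: W_J (rev ns))%g; rewrite ?rev_perm_lcoset //; apply/lcosetsP; exists w.
Qed.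

Lemma classifies_comp (p : nat) (K : fieldType) (chK : p \in [pchar K]) tau
    (T T' : finType) (X : {set T}) (X' : {set T'}) (cl : fzip chK -> T) (h : T -> T') :
  classifies tau X cl -> injective h -> (forall x, x \in X -> h x \in X') ->
  (forall x', x' \in X' -> exists2 x, x \in X & h x = x') ->
  classifies tau X' (fun Z => h (cl Z)).
Proof.
move=> [cX cI cS] hI hX hS; split=> [Z Zt|Z Z' Zt Zt'|c /hS[x /cS[Z Zt <-] <-]].
- exact/hX/cX.
- by rewrite -cI //; split=> [/hI|->].
- by exists Z.
Qed.

Lemma fzip_bc_type (K L : fieldType) (iota : {rmorphism K -> L}) (p : nat)
    (chK : p \in [pchar K]) (chL : p \in [pchar L]) (tau : int -> nat) (Z : fzip chK) :
  fzip_type tau Z -> fzip_type tau (fzip_bc iota chL Z).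
Proof.
move=> Zt i; have sC : (fz_C Z (i + 1) <= fz_C Z i)%VS.
  by have := fz_C_desc Z (i + 1); rewrite addrK.
apply/eqP; rewrite -(eqn_add2r (\dim (fz_C Z (i + 1)))) -{1}(dim_pbs iota).
by rewrite dim_quot ?pbsS //= dim_pbs -(dim_quot sC) -(Zt i).
Qed.

Theorem theorem1 (p : nat) (p_pr : prime p) (k : closedFieldType)
    (chk : p \in [pchar k]) (tau : int -> nat) (s : seq int)
    (s_sorted : sorted <%R s)
    (s_support : forall i : int, (i \in s) = (tau i != 0%N)) :
  [/\ exists cl : fzip chk -> {set 'S_(sumn [seq tau i | i <- s])},
        classifies tau (W_J_cosets [seq tau i | i <- s]) cl,
      exists cl : fzip chk -> {set 'S_(sumn (std_ns tau s))},
        classifies tau (W_J_cosets (std_ns tau s)) cl /\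
        (forall u : 'S_(sumn (std_ns tau s)), u \in JW (std_ns tau s) ->
           cl (std_fzip_over p_pr chk u) = lcoset (W_J (std_ns tau s)) u),
      forall u : 'S_(sumn (std_ns tau s)), u \in JW (std_ns tau s) ->
        fzip_type tau (std_fzip p_pr u)
    & forall Z : fzip chk, fzip_type tau Z ->
        exists! u : 'S_(sumn (std_ns tau s)),
          u \in JW (std_ns tau s) /\ fzip_iso Z (std_fzip_over p_pr chk u)].
Proof.
have uniq (Z : fzip chk) (u u' : 'S_(sumn (std_ns tau s))) e e' :
    u \in JW (std_ns tau s) -> u' \in JW (std_ns tau s) ->
    normal_basis u (e : _ -> fz_mod Z) -> normal_basis u' (e' : _ -> fz_mod Z) -> u = u'.
  exact: normal_basis_unique.
have typeP (u : 'S_(sumn (std_ns tau s))) : fzip_type tau (std_fzip_over p_pr chk u).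
  exact/fzip_bc_type/std_fzip_type.
(* Quantifying over all normal bases makes the class independent of choices, by uniqueness. Outside
   type [tau] the condition is vacuous, and [set0] serves as a default. *)
pose is_class (Z : fzip chk) c := forall u (e : 'I_(sumn (std_ns tau s)) -> fz_mod Z),
  fzip_type tau Z -> u \in JW (std_ns tau s) -> normal_basis u e ->
  c = lcoset (W_J (std_ns tau s)) u.
have /choice[cl clE] : forall Z : fzip chk, exists c, is_class Z c.
  move=> Z; have [Zt|] := pselect (fzip_type tau Z); last by exists set0.
  have [u uJ [e eN]] := normal_basis_exists p_pr s_sorted s_support Zt.
  exists (lcoset (W_J (std_ns tau s)) u) => u' e' _ u'J e'N.
  by rewrite (uniq _ _ _ _ _ uJ u'J eN e'N).
have clC : classifies tau (W_J_cosets (std_ns tau s)) cl.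
  split=> [Z Zt|Z Z' Zt Zt'|_ /lcosetsP[v _ ->]].
  - have [u uJ [e eN]] := normal_basis_exists p_pr s_sorted s_support Zt.
    by rewrite (clE _ _ _ Zt uJ eN) lcosetE; apply/lcosetsP; exists u.
  - have [u uJ [e eN]] := normal_basis_exists p_pr s_sorted s_support Zt.
    have [u' u'J [e' e'N]] := normal_basis_exists p_pr s_sorted s_support Zt'.
    rewrite (clE _ _ _ Zt uJ eN) (clE _ _ _ Zt' u'J e'N) !lcosetE; split=> [uu'|].
      have uE : u = u'.
        apply: (JW_coset_unique uJ u'J); rewrite -mem_lcoset uu'.
        exact: lcoset_refl (W_J_group _) u'.
      by rewrite -uE in e'N; apply: normal_basis_iso eN e'N.
    move=> /fzip_isoP[f fi]; have fN := normal_basis_transport fi eN.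
    by rewrite (uniq _ _ _ _ _ uJ u'J fN e'N).
  - have [u uJ vu] := JW_coset_exists v; exists (std_fzip_over p_pr chk u) => //.
    rewrite (clE _ _ _ (typeP u) uJ (std_basis_normal p_pr chk u)) lcosetE.
    by apply/(@lcoset_eqP _ (W_J_group _)); rewrite mem_lcoset.
split.
(* The classification is by [std_ns tau s]; the reversal bijection transports it to the list in the
   order of [s]. *)
- have [|h [hI hX hS]] := @W_J_cosets_rev [seq tau i | i <- s] (std_ns tau s).
    exact: map_rev.
  by exists (fun Z => h (cl Z)); apply: classifies_comp clC _ _ _.
- exists cl; split=> // u uJ.
  exact: clE (typeP u) uJ (std_basis_normal p_pr chk u).
- by move=> u _; apply: std_fzip_type.
move=> Z Zt; have [u uJ [e eN]] := normal_basis_exists p_pr s_sorted s_support Zt.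
exists u; split=> [|u' [u'J /fzip_isoP[f fi]]].
  by split=> //; apply: normal_basis_iso eN (std_basis_normal p_pr chk u).
have := normal_basis_transport (psi_iso_sym fi) (std_basis_normal p_pr chk u').
exact: uniq uJ u'J eN.
Qed.
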